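(* Let $d\ge 1$ and $n\geq d+1$ be integers, and let $X,X_1,\ldots,X_n$ be independent standard Gaussian random vectors in $\mathbb{R}^d$. Then, for every $\sigma\geq 0$, $$ \mathbb{P}[\sigma X \notin \operatorname{Conv} (X_1,\ldots, X_n)] = 2\left(b_{n,d-1}(\sigma^2) + b_{n,d-3}(\sigma^2) +b_{n,d-5}(\sigma^2)+\ldots\right), $$ where $$ b_{n,k}(\sigma^2) = \binom nk\, g_k\left(-\frac{\sigma^2}{1+k\sigma^2}\right) g_{n-k} \left(\frac{\sigma^2}{1+k\sigma^2}\right) $$ for $k=0,\ldots,n$, and $b_{n,k}=0$ for $k\notin \{0,1,\ldots,n\}$.
   Context: $\operatorname{Conv}$ denotes the convex hull. The functions $g_n$ are defined by $g_0(r):=1$ for all $r$ and, for $n\in\{1,2,\ldots\}$ and $r\ge -1/n$, $g_n(r)=\mathbb{P}[\eta_1<0,\ldots,\eta_n<0]$, where $(\eta_1,\ldots,\eta_n)$ is a zero-mean Gaussian vector with $\operatorname{Cov}(\eta_i,\eta_i)=1+r$ and $\operatorname{Cov}(\eta_i,\eta_j)=r$ for $i\ne j$. *)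

(* Defs.v *)
From HB Require Import structures.
From mathcomp Require Import all_boot all_order all_algebra.
From mathcomp Require Import all_classical all_reals all_analysis.

Set Implicit Arguments.
Unset Strict Implicit.
Unset Printing Implicit Defensive.

Import Order.TTheory GRing.Theory Num.Theory.
Import numFieldNormedType.Exports.

Local Open Scope classical_set_scope.
Local Open Scope ring_scope.

(* A random vector in R^n is a measurable map into n.-tuple R, whose
   sigma-algebra is the one generated by the coordinates, i.e. the Borel
   sigma-algebra of R^n. The linear structure is that of 'rV[R]_n. *)
Definition row_of_tuple (R : realType) (n : nat) (t : n.-tuple R) : 'rV[R]_n :=
  \row_(j < n) tnth t j.

Definition convex_hull (R : realType) (V : lmodType R) (A : set V) : set V :=
  smallest (@convex_set R V) A.

Definition independent (R : realType) (disp disp' : measure_display)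
    (T : measurableType disp) (T' : measurableType disp')
    (P : probability T R) (I : finType) (Y : I -> T -> T') : Prop :=
  forall (J : {set I}) (B : I -> set T'), (forall i, measurable (B i)) ->
    P (\bigcap_(i in [set i | i \in J]) (Y i @^-1` B i)) =
    \big[mule/1%E]_(i in J) P (Y i @^-1` B i).

Definition standard_gaussian (R : realType) (disp : measure_display)
    (T : measurableType disp) (P : probability T R) (n : nat)
    (Z : {RV P >-> n.-tuple R}) : Prop :=
  (forall (j : 'I_n) (B : set R), measurable B ->
     P ((fun w => tnth (Z w) j) @^-1` B) = normal_prob 0 1 B) /\
  independent P (fun (j : 'I_n) (w : T) => tnth (Z w) j).

Definition affine_map (R : realType) (n m : nat) (A : 'M[R]_(n, m))
    (c : 'cV[R]_n) (z : m.-tuple R) : n.-tuple R :=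
  [tuple \sum_(j < m) A i j * tnth z j + c i 0 | i < n].

(* A Gaussian vector is one distributed as an affine image of a standard
   Gaussian vector, possibly living on another probability space; degenerate
   covariances are allowed. *)
Definition gaussian_vector (R : realType) (disp : measure_display)
    (T : measurableType disp) (P : probability T R) (n : nat)
    (eta : {RV P >-> n.-tuple R}) : Prop :=
  exists (disp' : measure_display) (T' : measurableType disp')
    (P' : probability T' R) (m : nat) (Z : {RV P' >-> m.-tuple R})
    (A : 'M[R]_(n, m)) (c : 'cV[R]_n),
    standard_gaussian Z /\
    forall B : set (n.-tuple R), measurable B ->
      P (eta @^-1` B) = P' ((affine_map A c \o Z) @^-1` B).

(* The values P[eta_1 < 0, ..., eta_n < 0] over all admissible eta; since the
   mean and the covariance determine the law, there is at most one, and there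
   is one exactly when r >= - 1/n (for n > 0). *)
Definition orthant_probability (R : realType) (n : nat) (r : R) : set R :=
  [set p | exists (disp : measure_display) (T : measurableType disp)
    (P : probability T R) (eta : {RV P >-> n.-tuple R}),
    [/\ gaussian_vector eta,
        forall i : 'I_n, ('E_P[fun w => tnth (eta w) i] = 0)%E,
        forall i j : 'I_n,
          covariance P (fun w => tnth (eta w) i) (fun w => tnth (eta w) j) =
          (if i == j then 1 + r else r)%:E
      & P [set w | forall i : 'I_n, tnth (eta w) i < 0] = p%:E]].

(* For n > 0 and r < - 1/n, where g_n is not defined, this is 0. *)
Definition g (R : realType) (n : nat) (r : R) : R :=
  if n is 0 then 1 else xget 0 (orthant_probability n r).

(* b n k s is b_{n,k}(s), with k an arbitrary integer. *)
Definition b (R : realType) (n : nat) (k : int) (s : R) : R :=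
  match k with
  | Posz k =>
    if (k <= n)%N then
      'C(n, k)%:R * g k (- (s / (1 + k%:R * s)))
                  * g (n - k) (s / (1 + k%:R * s))
    else 0
  | Negz _ => 0
  end.

(* Main.v *)
Require Import Defs.
From HB Require Import structures.
From mathcomp Require Import all_boot all_order all_algebra.
From mathcomp Require Import all_classical all_reals all_analysis.
From mathcomp Require Import interval_inference measurable_realfun ring lra zify.

Set Implicit Arguments.
Unset Strict Implicit.
Unset Printing Implicit Defensive.

Import Order.TTheory GRing.Theory Num.Theory.
Import numFieldNormedType.Exports.

Local Open Scope classical_set_scope.
Local Open Scope ring_scope.

(** Write [s] for [sigma], [Y_i = X_i - s X] and [rho_k = s^2 / (1 + k s^2)]. By
    Gordan's alternative ([gordan], [not_in_convex_hull]), [s X] is outside the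
    convex hull of the [X_i] if and only if some linear form is positive at all
    the [Y_i] (event [hit d]).

    Let [p_D] be the probability that such a form exists on the first [D]
    coordinates, and [h_D] the probability that there is one on the first [D + 1]
    coordinates with a positive last coefficient. By symmetry a negative last
    coefficient is as likely, and both signs are possible if and only if a zero
    coefficient is; hence [p_(D+1) + p_D = 2 h_D] ([hit_step]). With [p_0 = 0],
    the theorem follows from [h_D = b_0 + ... + b_D], where [b_k] is
    [b n k (s ^+ 2)].

    The increment [h_(k+1) - h_k] is the probability that the linear program:
    minimize [u_k] subject to [u_(k+1) = 1] and [u . Y_i >= 0] for all [i], is
    feasible and bounded (event [leaves]). In general position, which holds
    almost surely ([not_generic_null]), this program has exactly one optimal basis,
    a set [S] of [k + 1] points ([leaves_optimal], [optimal_unique]). Optimality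
    of [S] is a condition on the points of [S], together with the positivity of
    the optimal form, itself determined by these points, at the others
    ([optimalP]). The form vanishes on [S], so its value at [Y_i] is its value at
    [Y_i - rho_(k+1) \sum_(a in S) Y_a], and these residuals are independent of
    the points of [S]. Evaluated at the residuals, any form of norm one gives
    Gaussian variables of covariance [delta + rho_(k+1)] ([split_probability]).
    Therefore [S] is optimal with probability [q_(k+1) g_(n-k-1)(rho_(k+1))] for
    some numbers [q_k] that do not depend on [n] ([opt_event_prob]), and
    [h_D = \sum_(k <= D) 'C(n, k) q_k g_(n-k)(rho_k)] ([hitU_prob]).

    It remains to see that [q_k = g_k(- rho_k)]. As [h_n = 1], the numbers [q_k]
    satisfy [\sum_(k <= n) 'C(n, k) q_k g_(n-k)(rho_k) = 1] for every [n], and these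
    equations determine them. The numbers [g_k(- rho_k)] satisfy the same
    equations ([complementarity_sum]): for real numbers [y_1, ..., y_n] let [t] be
    the solution of [t = s^2 \sum_i max(0, - (y_i + t))] and [S] the set of the [i]
    with [y_i + t < 0]. If the [y_i] are the one-dimensional [Y_i], then [S] takes
    each value of cardinal [k] with probability [g_k(- rho_k) g_(n-k)(rho_k)], by
    the same separation of [S] from its complement.

    The analytic input is the rotation invariance of the Gaussian law
    ([orthonormal_keeps_iid]), deduced from that of planar reflections, and the
    fact that [g m r] is the orthant probability of any linear forms in
    independent standard normal variables with Gram matrix [delta + r]
    ([g_family]). *)

(** * Families of independent standard normal variables *)

Section vec.
Context {R : realType} {I : finType}.

Definition coord_sets : set (set (I -> R)) :=
  [set A | exists i B, measurable B /\ A = (fun x => x i) @^-1` B].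

End vec.

(** [I -> R] with the sigma-algebra generated by the coordinates: a Gaussian
    vector indexed by an arbitrary finite type needs no enumeration of it. *)
Definition vec (R : realType) (I : finType) := g_sigma_algebraType (@coord_sets R I).

Section vec_theory.
Context {R : realType} {I : finType}.

Lemma measurable_coord (i : I) : measurable_fun setT (fun x : vec R I => x i).
Proof.
move=> _ B mB; rewrite setTI; apply: sub_sigma_algebra.
by exists i, B.
Qed.

Lemma measurable_vec d (T : measurableType d) (f : T -> vec R I) :
  (forall i, measurable_fun setT (fun t => f t i)) -> measurable_fun setT f.
Proof.
move=> mf; apply: (@measurability _ _ _ _ _ f (@coord_sets R I)) => //.
by move=> _ [_ [i [B [mB ->]]] <-]; exact: (mf i).
Qed.

Definition box (B : I -> set R) : set (vec R I) := [set x | forall i, B i (x i)].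

Lemma measurable_box (B : I -> set R) :
  (forall i, measurable (B i)) -> measurable (box B).
Proof.
move=> mB; have -> : box B = \bigcap_(i in [set: I]) ((fun x : vec R I => x i) @^-1` B i).
  by apply/seteqP; split => x /= h i; [move=> _|]; exact: h.
apply: fin_bigcap_measurable => // i _.
by rewrite -[X in measurable X]setTI; apply: measurable_coord.
Qed.

(** Boxes form a pi-system that generates the coordinate sigma-algebra. *)
Lemma vec_measure_unique (m1 m2 : {measure set (vec R I) -> \bar R}) :
  (m1 setT < +oo)%E ->
  (forall B : I -> set R, (forall i, measurable (B i)) -> m1 (box B) = m2 (box B)) ->
  forall E, measurable E -> m1 E = m2 E.
Proof.
move=> fin1 m12 E mE.
pose G : set (set (vec R I)) := [set A | exists B, (forall i, measurable (B i)) /\ A = box B].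
have boxT : @box (fun=> setT) = setT by apply/seteqP; split.
apply: (measure_unique G (fun=> setT)) => //.
- apply/seteqP; split; last first.
    apply: smallest_sub; first exact: sigma_algebra_measurable.
    by move=> _ [B [mB ->]]; exact: measurable_box.
  apply: smallest_sub; first exact: smallest_sigma_algebra.
  move=> _ [i [B [mB ->]]]; apply: sub_gen_smallest.
  exists (fun j => if j == i then B else setT); split.
    by move=> j; case: ifP.
  apply/seteqP; split => [x /= Bx j|x /= /(_ i)]; last by rewrite eqxx.
  by case: ifP => [/eqP ->|].
- move=> _ _ [B [mB ->]] [C [mC ->]]; exists (fun i => B i `&` C i); split.
    by move=> i; exact: measurableI.
  apply/seteqP; split=> [x [/= Bx Cx] i //|x /= BCx].
  by split => i; have [] := BCx i.
- by move=> _; exists (fun=> setT); split => //; rewrite boxT.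
- by apply/seteqP; split => // x _; exists 0%N.
- by move=> A [B [mB ->]]; exact: m12.
Qed.

End vec_theory.

Section product_probability.
Context d1 d2 (T1 : measurableType d1) (T2 : measurableType d2) (R : realType).
Variables (P : probability T1 R) (Q : probability T2 R).

(** The product measure, repackaged so that it carries a probability structure. *)
Definition prodP : set (T1 * T2) -> \bar R := (P \x Q)%E.

HB.instance Definition _ := Measure.on prodP.

Let prodP_setT : prodP setT = 1%E.
Proof.
rewrite /prodP -setXTT product_measure1E//.
by rewrite -[RHS]mule1 -{1}(@probability_setT _ _ _ P) -(@probability_setT _ _ _ Q).
Qed.

HB.instance Definition _ := Measure_isProbability.Build _ _ _ prodP prodP_setT.

End product_probability.

Local Notation nrm := (normal_prob 0 1).

Section iid.
Context {R : realType}.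

(** Independence and the marginal laws are asserted at once, on boxes. *)
Definition iid d (T : measurableType d) (P : {measure set T -> \bar R}) (I : finType)
    (xi : I -> T -> R) : Prop :=
  (forall i, measurable_fun setT (xi i)) /\
  forall B : I -> set R, (forall i, measurable (B i)) ->
    P [set w | forall i, B i (xi i w)] = (\big[mule/1]_i nrm (B i))%E.

Lemma gauss_ord_exists n :
  exists mu : probability (vec R 'I_n) R, iid mu (fun i x => x i).
Proof.
elim: n => [|n [mu [_ imu]]].
  exists (dirac ((fun=> 0) : vec R 'I_0)); split; first exact: measurable_coord.
  move=> B mB; rewrite big_ord0.
  set S := [set w | _]; have -> : S = setT by apply/seteqP; split => // x _ [].
  exact: probability_setT.
pose f (p : measurableTypeR R * vec R 'I_n) : vec R 'I_n.+1 := fun i => oapp p.2 p.1 (unlift ord0 i).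
have mf : measurable_fun setT f.
  apply: measurable_vec => i; rewrite /f; case: unliftP => [j _|_] /=.
    by apply: (measurableT_comp (measurable_coord j)); exact: measurable_snd.
  exact: measurable_fst.
pose X : {mfun (measurableTypeR R * vec R 'I_n)%type >-> vec R 'I_n.+1} :=
  HB.pack f (isMeasurableFun.Build _ _ _ _ _ mf).
exists (distribution (prodP (nrm : probability (measurableTypeR R) R) mu) X).
split; first exact: measurable_coord.
move=> B mB.
change ((nrm \x mu)%E (f @^-1` box B) = (\big[mule/1]_i nrm (B i))%E).
rewrite (_ : _ @^-1` _ = B ord0 `*` box (fun i => B (lift ord0 i))); last first.
  apply/seteqP; split => [[x y]|[x y] [/= Bx By] i] /=; rewrite /f.
    move=> h; split; first by have /= := h ord0; rewrite unlift_none.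
    by move=> i; have /= := h (lift ord0 i); rewrite liftK.
  by case: unliftP => [j ->|->] //=; exact: By.
rewrite big_ord_recl product_measure1E; first by congr (_ * _)%E; rewrite -imu.
  exact: mB.
exact: measurable_box.
Qed.

Lemma gauss_exists (I : finType) :
  exists mu : probability (vec R I) R, iid mu (fun i x => x i).
Proof.
have [mu [_ imu]] := gauss_ord_exists #|I|.
pose f (x : vec R 'I_#|I|) : vec R I := fun i => x (enum_rank i).
have mf : measurable_fun setT f by apply: measurable_vec => i; exact: measurable_coord.
pose X : {mfun (vec R 'I_#|I|) >-> vec R I} := HB.pack f (isMeasurableFun.Build _ _ _ _ _ mf).
exists (distribution mu X); split; first exact: measurable_coord.
move=> B mB.
change (mu (f @^-1` box B) = (\big[mule/1]_i nrm (B i))%E).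
rewrite (_ : _ @^-1` _ = [set x | forall k, B (enum_val k) (x k)]); last first.
  apply/seteqP; split => x /= h i; first by have := h (enum_val i); rewrite /f enum_valK.
  by have := h (enum_rank i); rewrite enum_rankK.
have -> := imu (fun k => B (enum_val k)) (fun k => mB _).
by rewrite [RHS](reindex (@enum_val I I))//; exists enum_rank => i _;
  rewrite ?enum_valK ?enum_rankK.
Qed.

Definition gauss (I : finType) : probability (vec R I) R := sval (cid (gauss_exists I)).

Lemma iid_gauss (I : finType) : iid (gauss I) (fun i x => x i).
Proof. by rewrite /gauss; case: cid. Qed.

Lemma gauss_box (I : finType) (B : I -> set R) : (forall i, measurable (B i)) ->
  gauss I (box B) = (\big[mule/1]_i nrm (B i))%E.
Proof. by case: (iid_gauss I) => _; apply. Qed.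

Section law.
Context d (T : measurableType d) (P : {measure set T -> \bar R}) (I : finType).
Variable xi : I -> T -> R.
Hypothesis iidxi : iid P xi.

Lemma iid_measurable_vec : measurable_fun setT (fun w => (xi ^~ w) : vec R I).
Proof. by apply: measurable_vec; case: iidxi. Qed.

(** All events about an i.i.d. standard normal family can be computed on the
    canonical space [vec R I]: probabilities are transported through this
    lemma. *)
Lemma iid_law (E : set (vec R I)) : measurable E ->
  P [set w | E (xi ^~ w)] = gauss I E.
Proof.
move=> mE.
pose X : {mfun T >-> vec R I} :=
  HB.pack (fun w => (xi ^~ w) : vec R I) (isMeasurableFun.Build _ _ _ _ _ iid_measurable_vec).
symmetry; apply: (@vec_measure_unique _ _ (gauss I) (pushforward P X)) => //.
  by rewrite [ltLHS](@probability_setT _ _ _ (gauss I)) ltry.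
move=> B mB; transitivity (\big[mule/1]_i nrm (B i))%E; first exact: gauss_box.
by case: iidxi => _ <-.
Qed.

End law.

Lemma iid_sub d (T : measurableType d) (P : {measure set T -> \bar R}) (I J : finType)
    (xi : I -> T -> R) (f : J -> I) : injective f -> iid P xi -> iid P (xi \o f).
Proof.
move=> finj [mxi xiB]; split=> [j|B mB]; first exact: mxi.
pose C i := if [pick j | f j == i] is Some j then B j else setT.
have CE j : C (f j) = B j.
  rewrite /C; case: pickP => [j' /eqP/finj -> //|/(_ j)]; by rewrite eqxx.
have mC i : measurable (C i) by rewrite /C; case: pickP.
rewrite (_ : [set w | _] = [set w | forall i, C i (xi i w)]); last first.
  apply/seteqP; split => w /= h; last by move=> j; rewrite -CE; exact: h.
  by move=> i; rewrite /C; case: pickP => // j /eqP <-; exact: h.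
rewrite xiB// (bigID [pred i | i \in codom f])/= [X in (_ * X)%E]big1 ?mule1.
  rewrite -(eq_bigr _ (fun j _ => congr1 _ (CE j))).
  rewrite -(big_map f xpredT (fun i => nrm (C i)))/=.
  rewrite -big_filter; apply: perm_big.
  apply: uniq_perm; first by rewrite filter_uniq// index_enum_uniq.
    by rewrite map_inj_uniq// index_enum_uniq.
  move=> i; rewrite mem_filter mem_index_enum andbT.
  apply/codomP/mapP => [[j ->]|[j _ ->]]; last by exists j.
  by exists j => //; rewrite mem_index_enum.
move=> i; rewrite /C; case: pickP => [j /eqP <-|_ _]; first by rewrite codom_f.
exact: probability_setT.
Qed.

(** Replacing some of the coordinates by those of an independent copy does not
    change the law. *)
Lemma iid_mix (I : finType) (K : pred I) :
  iid (prodP (gauss I) (gauss I)) (fun i p => if K i then p.2 i else p.1 i).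
Proof.
split=> [i|B mB].
  case: (K i).
    by apply: (measurableT_comp (measurable_coord i)); exact: measurable_snd.
  by apply: (measurableT_comp (measurable_coord i)); exact: measurable_fst.
rewrite (_ : [set w | _] = box (fun i => if K i then setT else B i) `*`
   box (fun i => if K i then B i else setT)); last first.
  apply/seteqP; split => [[x y] /= h|[x y] [/= h1 h2] i].
    by split => i; have := h i; case: (K i).
  by have := h1 i; have := h2 i; case: (K i).
transitivity (gauss I (box (fun i => if K i then setT else B i)) *
  gauss I (box (fun i => if K i then B i else setT)))%E.
  by apply: product_measure1E; apply: measurable_box => i; case: (K i).
rewrite !gauss_box; [|by move=> i; case: (K i)..].
rewrite -big_split/=; apply: eq_bigr => i _.
case: (K i); first by rewrite [X in (X * _)%E]probability_setT mul1e.
by rewrite [X in (_ * X)%E]probability_setT mule1.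
Qed.

Definition mix (I : finType) (K : pred I) (x y : vec R I) : vec R I :=
  fun i => if K i then y i else x i.

Lemma measurable_mix2 (I : finType) (K : pred I) (x : vec R I) :
  measurable_fun setT (mix K x).
Proof.
by apply: measurable_vec => i; rewrite /mix; case: (K i) => //; exact: measurable_coord.
Qed.

(** Conditioning on the coordinates outside [K], obtained by resampling those
    in [K]: it spares splitting the index type into two types. *)
Lemma gauss_mix (I : finType) (K : pred I) (E : set (vec R I)) : measurable E ->
  gauss I E = (\int[gauss I]_x gauss I [set y | E (mix K x y)])%E.
Proof.
move=> mE; rewrite -(iid_law (iid_mix K) mE) /prodP /product_measure1/=.
apply: eq_integral => x _; congr (gauss I _).
by apply/seteqP; split => y; rewrite /xsection/= ?inE.
Qed.

End iid.

(** * Rotation invariance of the Gaussian law *)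

Definition image_measure d1 d2 (T1 : measurableType d1) (T2 : measurableType d2)
  (R : realType) (m : {measure set T1 -> \bar R}) (f : T1 -> T2)
  (mf : measurable_fun setT f) : {measure set T2 -> \bar R}.
Proof. by refine (pushforward m f : {measure set T2 -> \bar R}); exact: mf. Defined.

Section normal_law.
Context {R : realType}.
Notation mu := (@lebesgue_measure R).
Notation phi := (@normal_pdf R 0 1).

Lemma ge0_integral_normal (f : R -> \bar R) :
  measurable_fun setT f -> (forall x, 0 <= f x)%E ->
  (\int[nrm]_x f x = \int[mu]_x (f x * (phi x)%:E))%E.
Proof.
move=> mf f0.
have dom : nrm `<< mu := normal_prob_dominates 0 1.
rewrite -(Radon_Nikodym_SigmaFinite.change_of_variables dom f0 measurableT mf).
have ig := Radon_Nikodym_SigmaFinite.f_integrable dom.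
apply: ae_eq_integral => //.
- by apply: emeasurable_funM => //; exact: measurable_int ig.
- apply: emeasurable_funM => //; apply/measurable_EFinP; exact: measurable_normal_pdf.
- apply: ae_eqe_mul2l; apply: integral_ae_eq => //.
    by apply/measurable_EFinP; exact: measurable_normal_pdf.
  by move=> E _ mE; rewrite -Radon_Nikodym_SigmaFinite.f_integral.
Qed.

Lemma measurable_affine (a b : R) :
  measurable_fun setT (fun x : measurableTypeR R => (a * x + b)%R : measurableTypeR R).
Proof. by apply: measurable_funD => //; apply: measurable_funM. Qed.

(** Both sides are measures in [A] that agree on half-open intervals. *)
Lemma lebesgue_measure_affine (a b : R) : 0 < a -> forall A, measurable A ->
  mu A = (a%:E * mu ((fun x => a * x + b)%R @^-1` A))%E.
Proof.
move=> a0 A mA.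
pose nu := mscale (NngNum (ltW a0)) (image_measure mu (measurable_affine a b)).
suff h : forall X, ocitv X -> mu X = nu X by exact: (lebesgue_measure_unique h mA).
move=> _ [[u v]] _ <-.
rewrite /nu /mscale/= /pushforward/=.
rewrite (_ : _ @^-1` _ = `](u - b) / a, (v - b) / a]%classic); last first.
  apply/seteqP; split => x /=; rewrite !in_itv/=;
    by rewrite ltr_pdivrMr// ler_pdivlMr// ltrBlDr lerBrDr mulrC.
rewrite !lebesgue_measure_itv/= !lte_fin ltr_pM2r ?invr_gt0// ltrD2r.
case: ifP => _; last by rewrite mule0.
by rewrite -!EFinB -EFinM; congr EFin; field; rewrite gt_eqF.
Qed.

Lemma ge0_integral_affine (a b : R) (f : R -> \bar R) : 0 < a ->
  measurable_fun setT f -> (forall x, 0 <= f x)%E ->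
  (\int[mu]_x f x = \int[mu]_x (a%:E * f (a * x + b)%R))%E.
Proof.
move=> a0 mf f0.
pose nu := mscale (NngNum (ltW a0)) (image_measure mu (measurable_affine a b)).
transitivity (\int[nu]_x f x)%E.
  apply: eq_measure_integral => A mA _; exact: lebesgue_measure_affine.
rewrite ge0_integral_mscale//= [RHS]ge0_integralZl//; last first.
- by rewrite lee_fin ltW.
- by apply: measurableT_comp => //; exact: measurable_affine.
congr (_ * _)%E.
rewrite [LHS](ge0_integral_pushforward (measurable_affine a b))//.
Qed.

(** The product of two standard normal densities depends on the norm only. *)
Lemma normal_pdf_rot (c s x y : R) : c ^+ 2 + s ^+ 2 = 1 ->
  phi (s * x + c * y) * phi (s * y - c * x) = phi x * phi y.
Proof.
move=> cs1; rewrite normal_pdfE ?oner_neq0// /normal_fun.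
rewrite mulrACA [RHS]mulrACA -!expRD; congr (_ * expR _).
rewrite !subr0 expr1n -!mulrDl -!opprD; congr (- _ / _).
transitivity ((c ^+ 2 + s ^+ 2) * (x ^+ 2 + y ^+ 2)); first by ring.
by rewrite cs1 mul1r.
Qed.

Lemma normal_integral_indic (A : set R) : measurable A ->
  (nrm A = \int[mu]_x (\1_A x * phi x)%:E)%E.
Proof.
move=> mA; transitivity (\int[nrm]_x (\1_A x)%:E)%E.
  by rewrite integral_indic// setIT.
rewrite ge0_integral_normal//.
by apply/measurable_EFinP; exact: measurable_indic.
Qed.

(** The planar reflection [(x, y) |-> (c x + s y, s x - c y)] preserves the
    standard Gaussian law. Instead of a change of variables in the plane, it is
    factored into two shears: the substitution [b = c x + s y] at fixed [x],
    an exchange of the integrals, and the substitution [x = s a + c b] at fixed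
    [b]. Both have positive slope since [0 < s]. *)
Lemma normal_reflect_pos (c s : R) (B1 B2 : set R) : c ^+ 2 + s ^+ 2 = 1 -> 0 < s ->
  measurable B1 -> measurable B2 ->
  (\int[nrm]_x nrm [set y | B1 (c * x + s * y)%R /\ B2 (s * x - c * y)%R] =
   nrm B1 * nrm B2)%E.
Proof.
move=> cs1 s0 mB1 mB2.
have s1 : s != 0 by rewrite gt_eqF.
pose H (x y : R) : R := \1_B1 (c * x + s * y) * \1_B2 (s * x - c * y) * phi y * phi x.
have mlin (u v : R) : measurable_fun setT (fun p : measurableTypeR R * measurableTypeR R =>
    (u * p.1 + v * p.2)%R : R).
  by apply: measurable_funD; apply: measurable_funM.
have mI (A : set R) (u v : R) : measurable A -> measurable_fun setT
   (fun p : measurableTypeR R * measurableTypeR R => (\1_A (u * p.1 + v * p.2)%R : R)).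
  move=> mA; have mA1 : measurable_fun setT (\1_A : R -> R) by exact: measurable_indic.
  exact: (measurableT_comp mA1 (mlin u v)).
have mphi (u v : R) : measurable_fun setT
   (fun p : measurableTypeR R * measurableTypeR R => (phi (u * p.1 + v * p.2)%R : R)).
  have mp : measurable_fun setT (phi : R -> R) by exact: measurable_normal_pdf.
  exact: (measurableT_comp mp (mlin u v)).
have mpair x : measurable_fun setT (pair x : measurableTypeR R -> measurableTypeR R * measurableTypeR R).
  exact: pair1_measurable.
have mneg (u v : R) : measurable_fun setT (fun p : measurableTypeR R * measurableTypeR R =>
    (u * p.1 - v * p.2)%R : R).
  by under eq_fun do rewrite -mulNr; exact: mlin.
have mINeg (A : set R) (u v : R) : measurable A -> measurable_fun setT
   (fun p : measurableTypeR R * measurableTypeR R => (\1_A (u * p.1 - v * p.2)%R : R)).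
  by move=> mA; under eq_fun do rewrite -mulNr; exact: mI.
pose Z : set (measurableTypeR R * measurableTypeR R) :=
  [set p | B1 (c * p.1 + s * p.2)%R /\ B2 (s * p.1 - c * p.2)%R].
have mZ : measurable Z.
  apply: measurableI; rewrite -[X in measurable X]setTI; first exact: (mlin c s).
  exact: (mneg s c).
have ZE x : [set y | B1 (c * x + s * y)%R /\ B2 (s * x - c * y)%R] = xsection Z x.
  by apply/seteqP; split => y; rewrite /xsection/= inE.
have mS x : measurable [set y | B1 (c * x + s * y)%R /\ B2 (s * x - c * y)%R].
  by rewrite ZE; exact: measurable_xsection.
have phi0 x : 0 <= phi x by exact: normal_pdf_ge0.
have I0 (A : set R) x : 0 <= \1_A x :> R by rewrite indicE ler0n.
have mphi1 : measurable_fun setT (phi : R -> R) by exact: measurable_normal_pdf.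
have mH : measurable_fun setT (fun p : measurableTypeR R * measurableTypeR R => H p.1 p.2).
  apply: measurable_funM; last exact: measurableT_comp mphi1 (measurable_fst).
  apply: measurable_funM; last exact: measurableT_comp mphi1 (measurable_snd).
  apply: measurable_funM; [exact: mI|exact: mINeg].
transitivity (\int[mu]_x \int[mu]_y (H x y)%:E)%E.
  have step x : nrm [set y | B1 (c * x + s * y)%R /\ B2 (s * x - c * y)%R] =
      (\int[mu]_y (\1_B1 (c * x + s * y) * \1_B2 (s * x - c * y) * phi y)%:E)%E.
    rewrite normal_integral_indic//.
    apply: eq_integral => y _; congr (_ * _)%:E.
    by rewrite !indicE -natrM mulnb; congr (nat_of_bool _)%:R; apply/idP/andP; rewrite !inE.
  rewrite ge0_integral_normal; last 2 first.
  - under eq_fun do rewrite ZE.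
    exact: (measurable_fun_xsection _ mZ).
  - by move=> x.
  apply: eq_integral => x _; rewrite step -ge0_integralZr//.
  - apply/measurable_EFinP; apply: measurable_funM => //.
    apply: measurable_funM.
      exact: (measurableT_comp (mI B1 c s mB1) (mpair x)).
    exact: (measurableT_comp (mINeg B2 s c mB2) (mpair x)).
  - by move=> y _; rewrite lee_fin !mulr_ge0.
  - by rewrite lee_fin.
(* The integrand after the substitution [b = c * x + s * y]. *)
pose K (x b : R) : R := s^-1 * (\1_B1 b * \1_B2 ((x - c * b) / s) * phi ((b - c * x) / s) * phi x).
transitivity (\int[mu]_x \int[mu]_b (K x b)%:E)%E.
  apply: eq_integral => x _.
  rewrite (@ge0_integral_affine s^-1 (- (c * x) / s)) ?invr_gt0//; first last.
  - by move=> y; rewrite lee_fin !mulr_ge0.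
  - apply/measurable_EFinP; exact: (measurableT_comp mH (mpair x)).
  apply: eq_integral => b _; rewrite -EFinM; congr (_%:E); rewrite /K /H.
  have -> : s^-1 * b + - (c * x) / s = (b - c * x) / s by field.
  have -> : c * x + s * ((b - c * x) / s) = b by field.
  suff -> : s * x - c * ((b - c * x) / s) = (x - c * b) / s by [].
  by transitivity (((c ^+ 2 + s ^+ 2) * x - c * b) / s); [field|rewrite cs1 mul1r].
have K0 x b : 0 <= K x b by rewrite !mulr_ge0// invr_ge0 ltW.
have mK : measurable_fun setT (fun p : measurableTypeR R * measurableTypeR R => K p.1 p.2).
  apply: measurable_funM => //.
  apply: measurable_funM; last exact: measurableT_comp mphi1 (measurable_fst).
  apply: measurable_funM.
    apply: measurable_funM.
      rewrite (_ : (fun _ => _) = (fun p => \1_B1 (0 * p.1 + 1 * p.2))); first exact: mI.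
      by apply/funext => p; rewrite mul0r add0r mul1r.
    rewrite (_ : (fun _ => _) = (fun p => \1_B2 (s^-1 * p.1 + (- c / s) * p.2))).
      exact: mI.
    by apply/funext => p; congr (\1_B2 _); field.
  rewrite (_ : (fun _ => _) = (fun p => phi ((- c / s) * p.1 + s^-1 * p.2))).
    exact: mphi.
  by apply/funext => p; congr (phi _); field.
transitivity (\int[mu]_b \int[mu]_x (K x b)%:E)%E.
  apply: (@fubini_tonelli _ _ (measurableTypeR R) (measurableTypeR R) R mu mu (fun p => (K p.1 p.2)%:E)).
  - exact/measurable_EFinP.
  - by move=> p; rewrite lee_fin.
transitivity (\int[mu]_b \int[mu]_a ((\1_B1 b * phi b) * (\1_B2 a * phi a))%:E)%E.
  apply: eq_integral => b _.
  rewrite (@ge0_integral_affine s (c * b))//; first last.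
  - by move=> y; rewrite lee_fin.
  - apply/measurable_EFinP.
    exact: (measurableT_comp mK (pair2_measurable b)).
  apply: eq_integral => a _; rewrite -EFinM; congr (_%:E); rewrite /K.
  have -> : (s * a + c * b - c * b) / s = a by field.
  have -> : (b - c * (s * a + c * b)) / s = s * b - c * a.
    rewrite -[in LHS](mul1r b) -{1}cs1.
    by field.
  rewrite [RHS]mulrACA [phi b * _]mulrC -(normal_pdf_rot a b cs1).
  by field.
under eq_integral => b _ do under eq_integral do rewrite EFinM.
under eq_integral => b _.
  rewrite ge0_integralZl//; last 3 first.
  - by apply/measurable_EFinP; apply: measurable_funM => //; exact: measurable_indic.
  - by move=> a _; rewrite lee_fin mulr_ge0.
  - by rewrite lee_fin mulr_ge0.
  rewrite -normal_integral_indic//.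
  over.
rewrite ge0_integralZr//.
- by rewrite -normal_integral_indic.
- by apply/measurable_EFinP; apply: measurable_funM => //; exact: measurable_indic.
- by move=> b _; rewrite lee_fin mulr_ge0.
Qed.

Lemma normal_sym (A : set R) : measurable A -> nrm (-%R @^-1` A) = nrm A.
Proof.
move=> mA.
have mN : measurable_fun setT (-%R : measurableTypeR R -> measurableTypeR R) by [].
have mNA : measurable (-%R @^-1` A) by rewrite -[X in measurable X]setTI; exact: mN.
have mphi1 : measurable_fun setT (phi : R -> R) by exact: measurable_normal_pdf.
rewrite !normal_integral_indic//.
transitivity (\int[image_measure mu mN]_x (\1_A x * phi x)%:E)%E; last first.
  by apply: eq_measure_integral => B mB _; exact: lebesgue_measureN.
rewrite (ge0_integral_pushforward mN)//; last 2 first.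
- by apply/measurable_EFinP; apply: measurable_funM => //; exact: measurable_indic.
- by move=> x _; rewrite lee_fin mulr_ge0// ?normal_pdf_ge0// indicE ler0n.
apply: eq_integral => x _; congr (_%:E).
rewrite !normal_pdfE ?oner_neq0// /normal_fun/= !subr0 sqrrN; congr (_ * _).
Qed.

End normal_law.

Section rotation.
Context {R : realType}.

Section reflection.
Variable (I : finType) (i i' : I) (ii' : i' != i) (c s : R).
Hypotheses (cs1 : c ^+ 2 + s ^+ 2 = 1) (s0 : 0 < s).

(** The planar reflection acting on the coordinates [i] and [i']. *)
Definition reflect_at (x : I -> R) : I -> R := fun k =>
  if k == i then c * x i + s * x i'
  else if k == i' then s * x i - c * x i' else x k.

Let glue (p : (measurableTypeR R * measurableTypeR R) * vec R I) : vec R I :=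
  fun k => if k == i then p.1.1 else if k == i' then p.1.2 else p.2 k.

Let mglue : measurable_fun setT glue.
Proof.
apply: measurable_vec => k; rewrite /glue.
have [_|_] := eqVneq k i.
  by apply: (measurableT_comp measurable_fst); exact: measurable_fst.
have [_|_] := eqVneq k i'.
  by apply: (measurableT_comp measurable_snd); exact: measurable_fst.
by apply: (measurableT_comp (measurable_coord k)); exact: measurable_snd.
Qed.

Let N : probability (measurableTypeR R) R := nrm.

Let iid_glue : iid (prodP (prodP N N) (gauss I)) (fun k p => glue p k).
Proof.
split=> [k|B mB].
  by apply: (measurableT_comp (measurable_coord k) mglue).
have mC k : measurable (if (k == i) || (k == i') then setT else B k).
  by case: ifP.
rewrite (_ : [set w | _] = (B i `*` B i') `*`
    box (fun k => if (k == i) || (k == i') then setT else B k)); last first.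
  apply/seteqP; split => [[[x y] z]|[[x y] z]] /=; rewrite /glue/=.
    move=> h; split; first split.
    - by have := h i; rewrite eqxx.
    - by have := h i'; rewrite (negbTE ii') eqxx.
    - by move=> k; have := h k; case: eqVneq => //= _; case: eqVneq.
  move=> [[h1 h2] h3] k; have := h3 k; case: eqVneq => [->//|_] /=.
  by case: eqVneq => [->//|_].
transitivity ((N \x N) (B i `*` B i') *
   gauss I (box (fun k => if (k == i) || (k == i') then setT else B k)))%E.
  apply: product_measure1E; last exact: measurable_box.
  by apply: measurableX; exact: mB.
transitivity ((nrm (B i) * nrm (B i')) *
   gauss I (box (fun k => if (k == i) || (k == i') then setT else B k)))%E.
  by congr (_ * _)%E; exact: (@product_measure1E _ _ (measurableTypeR R) (measurableTypeR R) R
    N N _ _ (mB i) (mB i')).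
rewrite gauss_box//.
rewrite [RHS](bigD1 i)//= [X in _ = (_ * X)%E](bigD1 i')//= [RHS]muleA; congr (_ * _)%E.
rewrite (bigD1 i)//= eqxx/= [X in (X * _)%E]probability_setT mul1e.
rewrite (bigD1 i')//= eqxx orbT [X in (X * _)%E]probability_setT mul1e.
by apply: eq_bigr => k /andP[/negbTE -> /negbTE ->].
Qed.

(** The canonical law is realised on a product of two lines and the remaining
    coordinates, which reduces the claim to the planar case. *)
Lemma iid_reflect d (T : measurableType d) (P : {measure set T -> \bar R}) (xi : I -> T -> R) :
  iid P xi -> iid P (fun k w => reflect_at (xi ^~ w) k).
Proof.
move=> ixi; have [mxi _] := ixi.
have mr : measurable_fun setT (fun x : vec R I => reflect_at x : vec R I).
  apply: measurable_vec => k; rewrite /reflect_at.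
  have mc j := @measurable_coord R I j.
  case: eqVneq => _; first by apply: measurable_funD; apply: measurable_funM.
  case: eqVneq => _ //; first by apply: measurable_funB; apply: measurable_funM.
split=> [k|B mB].
  exact: (measurableT_comp (measurable_coord k) (measurableT_comp mr (iid_measurable_vec ixi))).
have mbB := measurable_box mB.
have mrB : measurable [set x : vec R I | box B (reflect_at x)].
  by rewrite -[X in measurable X]setTI; exact: mr.
transitivity (gauss I [set x : vec R I | box B (reflect_at x)]).
  by rewrite -(iid_law ixi).
rewrite -gauss_box// -(iid_law iid_glue mrB) -(iid_law iid_glue mbB).
have mC k : measurable (if (k == i) || (k == i') then setT else B k).
  by case: ifP.
pose C := box (fun k => if (k == i) || (k == i') then setT else B k).
pose Z : set (measurableTypeR R * measurableTypeR R) :=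
  [set p | B i (c * p.1 + s * p.2) /\ B i' (s * p.1 - c * p.2)].
have mZ : measurable Z.
  have h1 : measurable_fun setT (fun p : measurableTypeR R * measurableTypeR R =>
    (c * p.1 + s * p.2)%R : R) by apply: measurable_funD; apply: measurable_funM.
  have h2 : measurable_fun setT (fun p : measurableTypeR R * measurableTypeR R =>
    (s * p.1 - c * p.2)%R : R) by apply: measurable_funB; apply: measurable_funM.
  by apply: measurableI; rewrite -[X in measurable X]setTI; [exact: h1|exact: h2].
rewrite (_ : [set w | _] = Z `*` C); last first.
  apply/seteqP; split => [[[x y] z]|[[x y] z]] /=; rewrite /glue/= /Z /C/=.
    move=> h; split; first split.
    - by have := h i; rewrite /reflect_at !eqxx (negbTE ii').
    - by have := h i'; rewrite /reflect_at !eqxx (negbTE ii').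
    - by move=> k; have := h k; rewrite /reflect_at; case: (k =P i) => //= _; case: (k =P i').
  move=> [[h1 h2] h3] k; have := h3 k; rewrite /reflect_at !eqxx (negbTE ii').
  by case: (k =P i) => [->//|_] /=; case: (k =P i') => [->//|_].
rewrite (_ : [set w | box B _] = (B i `*` B i') `*` C); last first.
  apply/seteqP; split => [[[x y] z]|[[x y] z]] /=; rewrite /glue/= /C/=.
    move=> h; split; first split.
    - by have := h i; rewrite !eqxx.
    - by have := h i'; rewrite !eqxx (negbTE ii').
    - by move=> k; have := h k; case: (k =P i) => //= _; case: (k =P i').
  move=> [[h1 h2] h3] k; have := h3 k.
  by case: (k =P i) => [->//|_] /=; case: (k =P i') => [->//|_].
have mCb := measurable_box mC.
transitivity ((N \x N) Z * gauss I C)%E.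
  exact: product_measure1E.
transitivity ((N \x N) (B i `*` B i') * gauss I C)%E; last first.
  symmetry; apply: product_measure1E => //; exact: measurableX (mB i) (mB i').
congr (_ * _)%E.
transitivity (nrm (B i) * nrm (B i'))%E; last first.
  by symmetry; exact: (@product_measure1E _ _ (measurableTypeR R) (measurableTypeR R) R
    N N _ _ (mB i) (mB i')).
rewrite -(normal_reflect_pos cs1 s0 (mB i) (mB i')).
apply: eq_integral => x _; congr (nrm _).
by apply/seteqP; split => y; rewrite /xsection/= inE.
Qed.

End reflection.
End rotation.

Section rotation.
Context {R : realType}.

Lemma dot_reflect (I : finType) (i i' : I) (ii' : i' != i) (c s : R) (x y : I -> R) :
  c ^+ 2 + s ^+ 2 = 1 ->
  \sum_k reflect_at i i' c s x k * reflect_at i i' c s y k = \sum_k x k * y k.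
Proof.
move=> cs1; rewrite (bigD1 i)//= [RHS](bigD1 i)//= (bigD1 i')//= [in RHS](bigD1 i')//=.
rewrite !addrA; congr (_ + _); last first.
  by apply: eq_bigr => k /andP[/negbTE ki /negbTE ki']; rewrite /reflect_at ki ki'.
rewrite /reflect_at !eqxx (negbTE ii').
transitivity ((c ^+ 2 + s ^+ 2) * (x i * y i + x i' * y i')); first by ring.
by rewrite cs1 mul1r.
Qed.

Lemma iid_sign (I : finType) (sg : I -> R) d (T : measurableType d)
    (P : {measure set T -> \bar R}) (xi : I -> T -> R) :
  (forall i, sg i ^+ 2 = 1) -> iid P xi -> iid P (fun i w => sg i * xi i w).
Proof.
move=> sg1 [mxi xiB]; split=> [i|B mB]; first by apply: measurable_funM.
have ml i : measurable_fun setT (fun x : R => sg i * x) by apply: measurable_funM.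
have mC i : measurable ((fun x : R => sg i * x) @^-1` B i).
  by rewrite -[X in measurable X]setTI; exact: ml.
transitivity (\big[mule/1]_i nrm ((fun x : R => (sg i * x)%R) @^-1` B i))%E.
  by rewrite -xiB.
apply: eq_bigr => i _.
have /eqP := sg1 i; rewrite sqrf_eq1 => /orP[/eqP ->|/eqP ->].
  by congr (nrm _); apply/seteqP; split => x /=; rewrite mul1r.
rewrite -[RHS]normal_sym//.
by congr (nrm _); apply/seteqP; split => x /=; rewrite mulN1r.
Qed.

Section orthonormal.
Variables (I J : finType).
Implicit Type Q : J -> I -> R.

Definition orthonormal_rows Q := forall j j', \sum_i Q j i * Q j' i = (j == j')%:R.

Definition nz Q j : {set I} := [set i | Q j i != 0]%SET.

(** Stated for all families at once, since the proof composes [Q] with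
    reflections. *)
Definition keeps_iid Q := forall d (T : measurableType d) (P : {measure set T -> \bar R})
  (xi : I -> T -> R), iid P xi -> iid P (fun j w => \sum_i Q j i * xi i w).

(** If every row has a single nonzero entry, [Q] only permutes coordinates and
    changes signs. *)
Lemma keeps_iid_monomial Q : orthonormal_rows Q -> (forall j, (#|nz Q j| <= 1)%N) ->
  keeps_iid Q.
Proof.
move=> oQ nz1 d T P xi ixi.
have fex j : exists i, Q j i != 0.
  apply/existsP; apply: contraT; rewrite negb_exists => /forallP Q0.
  have := oQ j j; rewrite eqxx big1 => [/eqP|i _]; first by rewrite eq_sym oner_eq0.
  by have := Q0 i; rewrite negbK => /eqP ->; rewrite mul0r.
pose f j := xchoose (fex j).
have fP j : Q j (f j) != 0 by exact: xchooseP (fex j).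
have Q0 j i : i != f j -> Q j i = 0.
  move=> ij; apply/eqP; apply: contraNT ij => Qij.
  by apply/eqP; apply: (card_le1_eqP (nz1 j)); rewrite inE//; exact: fP.
have Qs (y : I -> R) j : \sum_i Q j i * y i = Q j (f j) * y (f j).
  by rewrite (bigD1 (f j))//= big1 ?addr0// => i /Q0 ->; rewrite mul0r.
have finj : injective f.
  move=> j j' jj'; apply/eqP; apply: contraT => njj'.
  have := oQ j j'; rewrite Qs (negbTE njj') jj' => /eqP.
  by rewrite mulf_eq0 -{1}jj' (negbTE (fP j)) (negbTE (fP j')).
have sg1 j : Q j (f j) ^+ 2 = 1 by rewrite expr2 -Qs oQ eqxx.
have := iid_sign sg1 (iid_sub finj ixi).
by under [in X in _ -> X]eq_fun do under eq_fun do rewrite Qs.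
Qed.

Lemma orthonormal_reflect Q i i' c s : i' != i -> c ^+ 2 + s ^+ 2 = 1 ->
  orthonormal_rows Q -> orthonormal_rows (fun j => reflect_at i i' c s (Q j)).
Proof. by move=> ii' cs1 oQ j j'; rewrite dot_reflect. Qed.

Lemma keeps_iid_reflect Q i i' c s : i' != i -> c ^+ 2 + s ^+ 2 = 1 -> 0 < s ->
  keeps_iid (fun j => reflect_at i i' c s (Q j)) -> keeps_iid Q.
Proof.
move=> ii' cs1 s0 kQ d T P xi ixi.
have := kQ _ _ _ _ (iid_reflect ii' cs1 s0 ixi).
by under [in X in X -> _]eq_fun do under eq_fun do rewrite dot_reflect//.
Qed.

(** Rotation invariance. Reflections in coordinate planes are used to cancel
    the entries of [Q] one by one, until each row has a single nonzero entry. A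
    row that already has one nonzero entry is left alone: by orthogonality its
    support avoids the supports of the other rows. *)
Lemma orthonormal_keeps_iid Q : orthonormal_rows Q -> keeps_iid Q.
Proof.
move=> oQ; pose bad Q : {set J} := [set j | (1 < #|nz Q j|)%N]%SET.
(* Induction on the number of rows with several nonzero entries; inside, on the
   number of nonzero entries of one of them. *)
suff: forall N Q, orthonormal_rows Q -> (#|bad Q| <= N)%N -> keeps_iid Q by move=> /(_ _ _ oQ (leqnn _)).
elim=> [|N IHN] {}Q {}oQ badN.
  apply: keeps_iid_monomial => // j; rewrite leqNgt; apply/negP => jb.
  have : j \in bad Q by rewrite inE.
  have /cards0_eq -> : #|bad Q| = 0%N by apply/eqP; rewrite -leqn0.
  by rewrite inE.
have [bad0|[j jbad]] := set_0Vmem (bad Q); first by apply: IHN; rewrite // bad0 cards0.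
suff main : forall A : {set J}, j \in A -> (#|A| <= N.+1)%N -> forall m Q,
    orthonormal_rows Q -> bad Q \subset A -> (#|nz Q j| <= m)%N -> keeps_iid Q.
  by apply: (main _ jbad badN _ Q oQ (fintype.subxx _) (leqnn _)).
move=> A {}jbad {}badN; clear Q oQ.
elim=> [|m IHm] Q oQ badA nzm.
all: have [jQ|jQ] := boolP (j \in bad Q); last first.
1,3: apply: IHN => //; rewrite -ltnS (leq_trans _ badN)// (cardsD1 j A) jbad add1n ltnS.
1,2: by apply: subset_leq_card; apply/fintype.subsetP => k kQ;
     rewrite !inE (fintype.subsetP badA _ kQ) andbT; apply: contraNneq jQ => <-.
  by move: jQ nzm; rewrite inE leqn0 => /ltnW; case: #|_|.
have jQ2 := jQ; move: jQ2; rewrite inE => /card_gt1P[i [i' [iz iz' ii']]].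
rewrite !inE in iz iz'.
have i'i : i' != i by rewrite eq_sym.
pose r := Num.sqrt (Q j i ^+ 2 + Q j i' ^+ 2).
have r2 : r ^+ 2 = Q j i ^+ 2 + Q j i' ^+ 2 by rewrite sqr_sqrtr// addr_ge0// sqr_ge0.
have r0 : 0 < r by rewrite sqrtr_gt0 ltr_wpDl ?sqr_ge0// exprn_even_gt0.
(* This reflection cancels the entry of [Q j] at [i'], and [0 < s]. *)
pose s := `|Q j i'| / r; pose c := Q j i * Num.sg (Q j i') / r.
have sg2 : Num.sg (Q j i') ^+ 2 = 1 by rewrite sqr_sg iz'.
have s0 : 0 < s by rewrite divr_gt0// normr_gt0.
have cs1 : c ^+ 2 + s ^+ 2 = 1.
  rewrite /c /s !expr_div_n exprMn sg2 mulr1 -normrX ger0_norm ?sqr_ge0// -mulrDl -r2.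
  by rewrite divff// gt_eqF// exprn_gt0.
apply: (keeps_iid_reflect i'i cs1 s0); apply: IHm.
- exact: orthonormal_reflect.
- apply/fintype.subsetP => k kQ'; apply: (fintype.subsetP badA).
  have [->//|kj] := eqVneq k j.
  apply: contraLR kQ'; rewrite !inE -!leqNgt => nzk.
  have kz l : l \in nz Q j -> Q k l = 0.
    move=> lj; apply/eqP; apply: contraT => lk.
    have := oQ k j; rewrite (negbTE kj) (bigD1 l)//= big1 ?addr0.
      by move/eqP; rewrite mulf_eq0 (negbTE lk)/=; move: lj; rewrite inE => /negbTE ->.
    move=> l' l'l; suff -> : Q k l' = 0 by rewrite mul0r.
    apply/eqP; apply: contraNT l'l => kl'.
    by apply/eqP; apply: (card_le1_eqP nzk); rewrite inE.
  rewrite (_ : nz _ _ = nz Q k)//; apply/setP => l; rewrite !inE /reflect_at.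
  have [->|_] := eqVneq l i; first by rewrite !kz ?inE// !mulr0 addr0.
  have [->|_//] := eqVneq l i'; by rewrite !kz ?inE// !mulr0 subr0.
- rewrite -ltnS (leq_trans _ nzm)//; apply: proper_card; apply/properP; split.
    apply/fintype.subsetP => l; rewrite !inE /reflect_at.
    have [->//|_] := eqVneq l i; by have [->//|_] := eqVneq l i'.
  exists i'; rewrite inE// negbK /reflect_at (negbTE i'i) eqxx /s /c.
  by rewrite normrEsg; apply/eqP; ring.
Qed.

End orthonormal.
End rotation.

(** * Moments of linear forms *)

Section normal_moments.
Context {R : realType}.
Notation mu := (@lebesgue_measure R).
Notation phi := (@normal_pdf R 0 1).

(** A centred normal density is the standard one times an exponential; comparing
    the exponential with its tangent bounds the second moment. *)
Lemma normal_pdf_scale (q x : R) : 0 < q ->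
  q * normal_pdf 0 q x = phi x * expR (x ^+ 2 * (1 - q ^- 2) / 2).
Proof.
move=> q0; rewrite !normal_pdfE ?oner_neq0 ?gt_eqF// /normal_peak /normal_fun.
rewrite expr1n mul1r !subr0 -[RHS]mulrA -expRD mulrA; congr (_ * expR _); last first.
  by field; rewrite gt_eqF.
rewrite -mulrnAr sqrtrM ?sqr_ge0// sqrtr_sqr gtr0_norm// invfM mulrA divff ?mul1r//.
by rewrite gt_eqF.
Qed.

(** The densities of standard deviation [q] all have integral 1. With
    [1 + x <= expR x] and [normal_pdf_scale], the moment [m] satisfies
    [1 + (1 - q^-2) / 2 * m <= q] for [1 < q] and a reverse bound for [q < 1];
    letting [q] tend to 1 gives [m = 1]. *)
Lemma normal_second_moment : (\int[nrm]_x (x ^+ 2)%:E = 1 :> \bar R)%E.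
Proof.
have phi0 x : 0 <= phi x by exact: normal_pdf_ge0.
have mphi s : measurable_fun setT (normal_pdf 0 s : R -> R) by exact: measurable_normal_pdf.
have mphi1 := mphi 1.
have msq : measurable_fun setT (fun x : R => x ^+ 2) by exact: measurable_funX.
have int_q (q : R) : (\int[mu]_x (q * normal_pdf 0 q x)%:E = q%:E)%E.
  transitivity (q%:E * \int[mu]_x (normal_pdf 0 q x)%:E)%E; last first.
    by rewrite integral_normal_pdf mule1.
  under eq_integral do rewrite EFinM.
  rewrite integralZl//; exact: integrable_normal_pdf.
have int1 : (\int[mu]_x (phi x)%:E = 1)%E by exact: integral_normal_pdf.
have -> : (\int[nrm]_x (x ^+ 2)%:E = \int[mu]_x (x ^+ 2 * phi x)%:E)%E.
  rewrite ge0_integral_normal//; first exact/measurable_EFinP.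
  by move=> x; rewrite lee_fin sqr_ge0.
set M := (X in X = _).
have mM : measurable_fun setT (fun x : R => x ^+ 2 * phi x) by exact: measurable_funM.
have M0 : (0 <= M)%E by apply: integral_ge0 => x _; rewrite lee_fin mulr_ge0// ?sqr_ge0.
have mphiE : measurable_fun setT (fun x => (phi x)%:E) by exact/measurable_EFinP.
have phiE0 x : setT x -> (0 <= (phi x)%:E)%E by rewrite lee_fin.
have mME : measurable_fun setT (fun x : R => (x ^+ 2 * phi x)%:E) by exact/measurable_EFinP.
have ME0 (x : R) : setT x -> (0 <= (x ^+ 2 * phi x)%:E)%E.
  by rewrite lee_fin mulr_ge0// sqr_ge0.
have maM a : measurable_fun setT (fun x : R => a%:E * (x ^+ 2 * phi x)%:E)%E.
  by apply/measurable_EFinP; exact: measurable_funM.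
have aM0 a : 0 <= a -> forall x : R, setT x -> (0 <= a%:E * (x ^+ 2 * phi x)%:E)%E.
  by move=> a0 x _; rewrite mule_ge0// ME0.
have mqE (q : R) : measurable_fun setT (fun x : R => (q * normal_pdf 0 q x)%:E).
  by apply/measurable_EFinP; exact: measurable_funM.
have q0E (q : R) : 0 < q -> forall x : R, setT x -> (0 <= (q * normal_pdf 0 q x)%:E)%E.
  by move=> q0 x _; rewrite lee_fin mulr_ge0 ?normal_pdf_ge0// ltW.
have ub (q : R) : 1 < q -> (1 + ((1 - q ^- 2) / 2)%:E * M <= q%:E)%E.
  move=> q1; have q0 : 0 < q := lt_trans ltr01 q1.
  have a0 : 0 <= (1 - q ^- 2) / 2.
    by rewrite divr_ge0// subr_ge0 invf_le1 ?exprn_gt0// exprn_ege1// ltW.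
  have h1 := aM0 _ a0; have h2 := maM ((1 - q ^- 2) / 2).
  have h3 := mqE q; have h4 := q0E q q0.
  rewrite -int_q -int1 -ge0_integralZl// -ge0_integralD//.
  apply: ge0_le_integral => //.
  - by move=> x _; rewrite adde_ge0 ?phiE0 ?h1.
  - exact: emeasurable_funD.
  move=> x _; rewrite -EFinM -EFinD lee_fin normal_pdf_scale//.
  apply: (@le_trans _ _ (phi x * (1 + x ^+ 2 * (1 - q ^- 2) / 2))); last first.
    by rewrite ler_wpM2l// expR_ge1Dx.
  by rewrite le_eqVlt; apply/orP; left; apply/eqP; field; rewrite gt_eqF.
have lb (q : R) : 0 < q -> q < 1 -> (1 <= q%:E + ((q ^- 2 - 1) / 2)%:E * M)%E.
  move=> q0 q1.
  have a0 : 0 <= (q ^- 2 - 1) / 2.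
    by rewrite divr_ge0// subr_ge0 invf_ge1 ?exprn_gt0// exprn_ile1// ltW.
  have h1 := aM0 _ a0; have h2 := maM ((q ^- 2 - 1) / 2).
  have h3 := mqE q; have h4 := q0E q q0.
  rewrite -int_q -int1 -ge0_integralZl// -ge0_integralD//.
  apply: ge0_le_integral => //.
  - exact: emeasurable_funD.
  move=> x _; rewrite -EFinM -EFinD lee_fin normal_pdf_scale//.
  apply: (@le_trans _ _ (phi x * (1 + x ^+ 2 * (1 - q ^- 2) / 2) +
    (q ^- 2 - 1) / 2 * (x ^+ 2 * phi x))); last first.
    by rewrite lerD2r ler_wpM2l// expR_ge1Dx.
  by rewrite le_eqVlt; apply/orP; left; apply/eqP; field; rewrite gt_eqF.
have Mfin : M \is a fin_num.
  rewrite ge0_fin_numE// ltey; apply/eqP => My.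
  have := ub 2 (ltr1n R 2); rewrite My gt0_muley//.
  by rewrite lte_fin; lra.
move: ub lb; rewrite -(fineK Mfin); set m := fine M => ub lb.
have ub' (q : R) : 1 < q -> m <= q ^+ 2.
  move=> q1; have := ub q q1; rewrite -EFinM -EFinD lee_fin => h.
  have q0 : 0 < q := lt_trans ltr01 q1.
  have h2 : 2 * q ^+ 2 + (q ^+ 2 - 1) * m <= 2 * q ^+ 2 * q.
    rewrite (_ : 2 * q ^+ 2 + _ = 2 * q ^+ 2 * (1 + (1 - q ^- 2) / 2 * m)).
      by rewrite ler_pM2l// mulr_gt0// exprn_gt0.
    by field; rewrite gt_eqF.
  have h3 : (q - 1) * (q + 1) * m <= (q - 1) * (2 * q ^+ 2) by lra.
  have : (q + 1) * m <= 2 * q ^+ 2.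
    by rewrite -(ler_pM2l (x := q - 1)) ?subr_gt0// mulrA.
  have : 0 <= m by rewrite fine_ge0.
  nra.
have lb' (q : R) : 0 < q -> q < 1 -> q ^+ 2 <= m.
  move=> q0 q1; have := lb q q0 q1; rewrite -EFinM -EFinD lee_fin => h.
  have h2 : 2 * q ^+ 2 <= 2 * q ^+ 2 * q + (1 - q ^+ 2) * m.
    rewrite (_ : _ + (1 - q ^+ 2) * m = 2 * q ^+ 2 * (q + (q ^- 2 - 1) / 2 * m)).
      by apply: ler_peMr => //; rewrite mulr_ge0// sqr_ge0.
    by field; rewrite gt_eqF.
  have h3 : (1 - q) * (2 * q ^+ 2) <= (1 - q) * (q + 1) * m by lra.
  have : 2 * q ^+ 2 <= (q + 1) * m.
    by rewrite -(ler_pM2l (x := 1 - q)) ?subr_gt0// [leRHS]mulrA.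
  have : 0 <= m by rewrite fine_ge0.
  nra.
congr EFin; apply/eqP; rewrite eq_le; apply/andP; split.
(* If [1 < m], then [q ^+ 2 < m] for this [q], as [q ^+ 2 <= 1 + 3 * (q - 1)]. *)
- rewrite leNgt; apply/negP => m1.
  pose q := 1 + Num.min 1 ((m - 1) / 4).
  have q1 : 1 < q by rewrite ltrDl lt_min ltr01 divr_gt0// subr_gt0.
  have := ub' q q1.
  have : q - 1 <= 1 by rewrite addrAC subrr add0r ge_min lexx.
  have : q - 1 <= (m - 1) / 4 by rewrite addrAC subrr add0r ge_min lexx orbT.
  nra.
(* If [m < 1], the square of the mean of [1] and [m] exceeds [m]. *)
- rewrite leNgt; apply/negP => m1.
  have m0 : 0 <= m by rewrite fine_ge0.
  pose q := (1 + m) / 2.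
  have q0 : 0 < q by rewrite divr_gt0// ltr_pwDl.
  have q1 : q < 1 by rewrite /q; lra.
  have := lb' q q0 q1; rewrite /q; nra.
Qed.
End normal_moments.

Section iid_moments.
Context {R : realType} d (T : measurableType d) (P : probability T R) (I : finType).
Variable xi : I -> T -> R.
Hypothesis ixi : iid P xi.
Let mxi i : measurable_fun setT (xi i). Proof. by case: ixi. Qed.

Lemma iid_marginal i (A : set R) : measurable A -> P (xi i @^-1` A) = nrm A.
Proof.
move=> mA; case: ixi => _ /(_ (fun k => if k == i then A else setT)).
have -> : [set w | forall k, (if k == i then A else setT) (xi k w)] = xi i @^-1` A.
  apply/seteqP; split => w /=; first by move=> /(_ i); rewrite eqxx.
  by move=> h k; case: eqP => // ->.
move=> ->; last by move=> k; case: ifP.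
rewrite (bigD1 i)//= eqxx big1 ?mule1// => k /negbTE ->.
exact: probability_setT.
Qed.

Lemma iid_integral_sqr i : (\int[P]_w (xi i w ^+ 2)%:E = 1)%E.
Proof.
rewrite -(@normal_second_moment R).
have mxi' : measurable_fun setT (xi i : T -> measurableTypeR R) by exact: mxi.
transitivity (\int[image_measure P mxi']_x (x ^+ 2)%:E)%E.
  rewrite (ge0_integral_pushforward mxi')//; first exact/measurable_EFinP.
  by move=> x _; rewrite lee_fin sqr_ge0.
by apply: eq_measure_integral => A mA _; exact: iid_marginal.
Qed.

Lemma iid_integrable_sqr i : P.-integrable setT (fun w => (xi i w ^+ 2)%:E).
Proof.
apply/integrableP; split; first by apply/measurable_EFinP; exact: measurable_funX.
under eq_integral do rewrite gee0_abs ?lee_fin ?sqr_ge0//.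
by rewrite iid_integral_sqr ltry.
Qed.

Lemma iid_integrableM i j : P.-integrable setT (fun w => (xi i w * xi j w)%:E).
Proof.
apply: (@le_integrable _ _ _ P _ measurableT _ (fun w => (xi i w ^+ 2 + xi j w ^+ 2)%:E)).
- by apply/measurable_EFinP; exact: measurable_funM.
- move=> w _; rewrite lee_fin normrM [leRHS]ger0_norm ?addr_ge0 ?sqr_ge0//.
  rewrite -[xi i w ^+ 2]ger0_norm ?sqr_ge0// -[xi j w ^+ 2]ger0_norm ?sqr_ge0// !normrX.
  have := sqr_ge0 (`|xi i w| - `|xi j w|); have := normr_ge0 (xi i w).
  by have := normr_ge0 (xi j w); nra.
- under eq_fun do rewrite EFinD; apply: integrableD => //; exact: iid_integrable_sqr.
Qed.

Lemma iid_integrable i : P.-integrable setT (fun w => (xi i w)%:E).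
Proof.
apply: (@le_integrable _ _ _ P _ measurableT _ (fun w => (1 + xi i w ^+ 2)%:E)).
- exact/measurable_EFinP.
- move=> w _; rewrite lee_fin [leRHS]ger0_norm ?addr_ge0 ?sqr_ge0//.
  rewrite -[xi i w ^+ 2]ger0_norm ?sqr_ge0// !normrX.
  have := sqr_ge0 (`|xi i w| - 1); have := normr_ge0 (xi i w); nra.
- under eq_fun do rewrite EFinD; apply: integrableD => //; last exact: iid_integrable_sqr.
  exact: finite_measure_integrable_cst.
Qed.

Lemma iid_integral_law (f : vec R I -> \bar R) : measurable_fun setT f ->
  P.-integrable setT (fun w => f (xi ^~ w)) ->
  (\int[P]_w f (xi ^~ w) = \int[gauss I]_x f x)%E.
Proof.
move=> mf intf.
transitivity (\int[image_measure P (iid_measurable_vec ixi)]_x f x)%E.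
  by rewrite (integral_pushforward (iid_measurable_vec ixi) mf).
by apply: eq_measure_integral => A mA _; exact: (iid_law ixi).
Qed.

End iid_moments.

Section iid_moments2.
Context {R : realType} d (T : measurableType d) (P : probability T R) (I : finType).
Variable xi : I -> T -> R.
Hypothesis ixi : iid P xi.
Let mxi i : measurable_fun setT (xi i). Proof. by case: ixi. Qed.

Let flip (i k : I) : R := if k == i then -1 else 1.
Let iflip i : iid P (fun k w => flip i k * xi k w).
Proof.
by apply: iid_sign => // k; rewrite /flip; case: ifP => _; rewrite ?sqrrN expr1n.
Qed.

Lemma eq_oppe_fin0 (x : \bar R) : x \is a fin_num -> (x = - x)%E -> x = 0%E.
Proof. by case: x => // r _ [] h; congr EFin; lra. Qed.

(** By the symmetry of the law. *)
Lemma iid_integral i : (\int[P]_w (xi i w)%:E = 0)%E.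
Proof.
apply: eq_oppe_fin0; first by apply: integrable_fin_num => //; exact: (iid_integrable ixi).
have mf : measurable_fun setT (fun x : vec R I => (x i)%:E).
  by apply/measurable_EFinP; exact: measurable_coord.
transitivity (\int[P]_w (flip i i * xi i w)%:E)%E; last first.
  rewrite -mulN1e -integralZl//; last exact: (iid_integrable ixi).
  by apply: eq_integral => w _; rewrite /flip eqxx EFinM.
rewrite (iid_integral_law ixi mf); last exact: (iid_integrable ixi).
by rewrite (iid_integral_law (iflip i) mf)//; exact: (iid_integrable (iflip i)).
Qed.

(** Distinct coordinates are uncorrelated because flipping the sign of one of
    them preserves the law. *)
Lemma iid_integralM i j : (\int[P]_w (xi i w * xi j w)%:E = (i == j)%:R%:E)%E.
Proof.
have [<-|ij] := eqVneq i j.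
  by under eq_integral do rewrite -expr2; rewrite iid_integral_sqr.
have mf : measurable_fun setT (fun x : vec R I => (x i * x j)%:E).
  by apply/measurable_EFinP; apply: measurable_funM; exact: measurable_coord.
apply: eq_oppe_fin0; first by apply: integrable_fin_num => //; exact: (iid_integrableM ixi).
transitivity (\int[P]_w ((flip i i * xi i w) * (flip i j * xi j w))%:E)%E; last first.
  rewrite -mulN1e -integralZl//; last exact: (iid_integrableM ixi).
  by apply: eq_integral => w _; rewrite /flip eqxx eq_sym (negbTE ij) mul1r -mulrA EFinM.
rewrite (iid_integral_law ixi mf); last exact: (iid_integrableM ixi).
by rewrite (iid_integral_law (iflip i) mf)//; exact: (iid_integrableM (iflip i)).
Qed.

Section linear_forms.
Variables a b : I -> R.

Lemma iid_lin_integrable : P.-integrable setT (fun w => (\sum_i a i * xi i w)%:E).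
Proof.
under eq_fun do rewrite -sumEFin; apply: integrable_sum => // i _.
by under eq_fun do rewrite EFinM; apply: integrableZl => //; exact: (iid_integrable ixi).
Qed.

Lemma iid_lin_integral : (\int[P]_w (\sum_i a i * xi i w)%:E = 0)%E.
Proof.
under eq_integral do rewrite -sumEFin.
rewrite integral_sum//; last first.
  move=> i; under eq_fun do rewrite EFinM; apply: integrableZl => //; exact: (iid_integrable ixi).
rewrite big1// => i _; under eq_integral do rewrite EFinM.
by rewrite integralZl ?iid_integral ?mule0//; exact: (iid_integrable ixi).
Qed.

Let prodE w : (\sum_i a i * xi i w) * (\sum_i b i * xi i w) =
  \sum_(p : I * I) (a p.1 * b p.2) * (xi p.1 w * xi p.2 w).
Proof.
rewrite big_distrl/= -(pair_bigA _ (fun i j => (a i * b j) * (xi i w * xi j w)))/=.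
by apply: eq_bigr => i _; rewrite big_distrr/=; apply: eq_bigr => j _; rewrite mulrACA.
Qed.

Let term_integrable (p : I * I) :
  P.-integrable setT (fun w => (a p.1 * b p.2 * (xi p.1 w * xi p.2 w))%:E).
Proof.
by under eq_fun do rewrite EFinM; apply: integrableZl => //; exact: (iid_integrableM ixi).
Qed.

Lemma iid_linM_integrable : P.-integrable setT
  (fun w => ((\sum_i a i * xi i w) * (\sum_i b i * xi i w))%:E).
Proof.
by under eq_fun do rewrite prodE -sumEFin; apply: integrable_sum.
Qed.

Lemma iid_linM_integral :
  (\int[P]_w ((\sum_i a i * xi i w) * (\sum_i b i * xi i w))%:E = (\sum_i a i * b i)%:E)%E.
Proof.
under eq_integral do rewrite prodE -sumEFin.
rewrite integral_sum//.
transitivity (\sum_(p : I * I) (a p.1 * b p.2 * (p.1 == p.2)%:R)%:E)%E.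
  apply: eq_bigr => p _; under eq_integral do rewrite EFinM.
  by rewrite integralZl ?iid_integralM//; exact: (iid_integrableM ixi).
rewrite sumEFin -(pair_bigA _ (fun i j => a i * b j * (i == j)%:R))/=; congr EFin.
apply: eq_bigr => i _; rewrite (bigD1 i)//= eqxx mulr1 big1 ?addr0// => j.
by rewrite eq_sym => /negbTE ->; rewrite mulr0.
Qed.

End linear_forms.
End iid_moments2.

(** * Orthant probabilities of equicorrelated Gaussian vectors *)

Lemma same_law_integral (R : realType) d1 d2 d (T1 : measurableType d1)
    (T2 : measurableType d2) (S : measurableType d)
    (m1 : {measure set T1 -> \bar R}) (m2 : {measure set T2 -> \bar R})
    (X1 : T1 -> S) (X2 : T2 -> S) (f : S -> \bar R) :
  measurable_fun setT X1 -> measurable_fun setT X2 ->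
  (forall B, measurable B -> m1 (X1 @^-1` B) = m2 (X2 @^-1` B)) ->
  measurable_fun setT f -> m2.-integrable setT (f \o X2) ->
  (\int[m1]_w f (X1 w) = \int[m2]_w f (X2 w))%E.
Proof.
move=> mX1 mX2 law mf int2.
have eqI (h : S -> \bar R) :
    (\int[image_measure m1 mX1]_x h x = \int[image_measure m2 mX2]_x h x)%E.
  by apply: eq_measure_integral => B mB _; exact: law.
have int1 : m1.-integrable setT (f \o X1).
  apply/integrableP; split; first exact: measurableT_comp mf mX1.
  have maf : measurable_fun setT (fun x => `|f x|%E) by exact: measurableT_comp.
  have step d' (T : measurableType d') (m : {measure set T -> \bar R}) X (mX : measurable_fun setT X) :
      (\int[image_measure m mX]_x `|f x| = \int[m]_w `|f (X w)|)%E.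
    by rewrite (ge0_integral_pushforward mX).
  have /integrableP[_] := int2.
  by rewrite /= -step -[X in (_ -> (X < _)%E)]step eqI.
transitivity (\int[image_measure m1 mX1]_x f x)%E.
  by rewrite (integral_pushforward mX1 mf).
by rewrite eqI (integral_pushforward mX2 mf).
Qed.

Section gaussian_orthants.
Context {R : realType}.

Lemma standard_gaussian_iid d (T : measurableType d) (P : probability T R) n
    (Z : {RV P >-> n.-tuple R}) :
  standard_gaussian Z -> iid P (fun j w => tnth (Z w) j).
Proof.
move=> [mZ indZ]; split=> [j|B mB].
  exact: measurableT_comp (measurable_tnth j) _.
rewrite (_ : [set w | _] = \bigcap_(i in [set i | i \in [set: 'I_n]%SET])
    ((fun w => tnth (Z w) i) @^-1` B i)); last first.
  by apply/seteqP; split => w /= h i; [move=> _; exact: h|apply: h; rewrite /= inE].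
transitivity (\big[mule/1%E]_(i in [set: 'I_n]%SET) P ((fun w => tnth (Z w) i) @^-1` B i)).
  exact: (indZ [set: 'I_n]%SET B mB).
by apply: eq_big => [i|i _]; [rewrite inE|exact: mZ].
Qed.

Lemma iid_standard_gaussian d (T : measurableType d) (P : probability T R) n
    (Z : {RV P >-> n.-tuple R}) :
  iid P (fun j w => tnth (Z w) j) -> standard_gaussian Z.
Proof.
move=> iZ; have [mZ boxZ] := iZ; split=> [j B mB|].
  exact: (iid_marginal iZ j mB).
move=> J B mB.
rewrite (_ : \bigcap_(i in _) _ =
    [set w | forall i, (if i \in J then B i else setT) (tnth (Z w) i)]); last first.
  apply/seteqP; split => w /= h i; first by case: ifP => // iJ; exact: h.
  by move=> iJ; have := h i; rewrite iJ.
transitivity (\big[mule/1%E]_i nrm (if i \in J then B i else setT)).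
  by apply: (boxZ (fun i => if i \in J then B i else setT)) => i; case: ifP.
rewrite (bigID (mem J))/= [X in (_ * X)%E]big1 ?mule1; last first.
  by move=> i /negbTE ->; exact: probability_setT.
by apply: eq_bigr => i iJ; rewrite iJ (iid_marginal iZ i (mB i)).
Qed.

(** The event that the vector [(I + a J) x] is negative, with [J] the all-ones
    matrix. *)
Definition orthant_set (J : finType) (a : R) : set (vec R J) :=
  [set x | forall j, x j + a * \sum_k x k < 0].
Arguments orthant_set : clear implicits.

Lemma measurable_sum_coord (J : finType) (f : J -> R) :
  measurable_fun setT (fun x : vec R J => \sum_j f j * x j).
Proof.
by apply: measurable_sum => j; apply: measurable_funM => //; exact: measurable_coord.
Qed.

Lemma measurable_forall_lt0 d (T : measurableType d) (J : finType) (f : J -> T -> R) :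
  (forall j, measurable_fun setT (f j)) -> measurable [set w | forall j, f j w < 0].
Proof.
move=> mf; rewrite (_ : [set w | _] = \bigcap_(j in [set: J]) (f j @^-1` `]-oo, 0[)).
  apply: fin_bigcap_measurable => // j _; rewrite -[X in measurable X]setTI.
  exact: mf.
apply/seteqP; split => w /= h j; first by move=> _ /=; rewrite in_itv/= h.
by have := h j I; rewrite /= in_itv/=.
Qed.

Lemma measurable_orthant_set (J : finType) (a : R) : measurable (orthant_set J a).
Proof.
apply: measurable_forall_lt0 => j; apply: measurable_funD; first exact: measurable_coord.
apply: measurable_funM => //; apply: measurable_sum => k; exact: measurable_coord.
Qed.

(** The coefficient [a] such that [I + a J] is the square root of [I + r J], for
    matrices of size [m]. *)
Definition sqrt_coef (m : nat) (r : R) := r / (1 + Num.sqrt (1 + m%:R * r)).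

(** Linear forms with Gram matrix [I + r J] are the image by [I + a J] of the
    orthonormal family obtained by subtracting from each of them a multiple of
    their sum, so that rotation invariance determines their law. *)
Lemma orthant_family d (T : measurableType d) (P : {measure set T -> \bar R})
    (I J : finType) (xi : I -> T -> R) (A : J -> I -> R) (r : R) :
  iid P xi -> (forall j k, \sum_i A j i * A k i = (j == k)%:R + r) ->
  0 < 1 + #|J|%:R * r ->
  P [set w | forall j, \sum_i A j i * xi i w < 0] =
  gauss J (orthant_set J (sqrt_coef #|J| r)).
Proof.
move=> ixi AK k0; set m := #|J|%:R in k0.
pose t := Num.sqrt (1 + m * r).
have t0 : 0 < t by rewrite sqrtr_gt0.
have t2 : t ^+ 2 = 1 + m * r by rewrite sqr_sqrtr// ltW.
have t1 : 1 + t != 0 by rewrite gt_eqF// addr_gt0.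
have tn0 : t != 0 by rewrite gt_eqF.
pose a := sqrt_coef #|J| r; pose b := a / t.
have aE : a = r / (1 + t) by [].
pose S i := \sum_j A j i.
have AS j : \sum_i A j i * S i = t ^+ 2.
  under eq_bigr do rewrite /S big_distrr/=.
  rewrite exchange_big/=; under eq_bigr do rewrite AK.
  rewrite big_split/= sumr_const -[X in _ + r *+ X]/#|J| -mulr_natl -/m t2.
  by rewrite (bigD1 j)//= eqxx big1 ?addr0// => i; rewrite eq_sym => /negbTE ->.
have SS : \sum_i S i * S i = m * t ^+ 2.
  under eq_bigr do rewrite {1}/S big_distrl/=.
  rewrite exchange_big/=; under eq_bigr do rewrite AS.
  by rewrite sumr_const -[X in _ *+ X]/#|J| -mulr_natl.
pose Q j i := A j i - b * S i.
have oQ : orthonormal_rows Q.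
  move=> j k; rewrite /Q.
  transitivity (\sum_i A j i * A k i - b * \sum_i A j i * S i - b * (\sum_i A k i * S i)
      + b ^+ 2 * \sum_i S i * S i).
    rewrite !mulr_sumr -!sumrB -big_split/=; apply: eq_bigr => i _; ring.
  rewrite AK !AS SS /b aE.
  have mr : m * r = t ^+ 2 - 1 by rewrite t2 addrAC subrr add0r.
  transitivity ((j == k)%:R + r * (1 - 2 * t / (1 + t) + m * r / (1 + t) ^+ 2)).
    by field; rewrite t1 tn0.
  rewrite mr; by field.
have iQ := orthonormal_keeps_iid oQ ixi.
have SQ i : \sum_k Q k i = S i / t.
  rewrite /Q sumrB sumr_const -[X in _ - _ *+ X]/#|J| -mulr_natl -/m -[\sum_i0 _]/(S i).
  have -> : m * (b * S i) = m * r / (1 + t) / t * S i by rewrite /b aE; field; rewrite t1 tn0.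
  have -> : m * r = t ^+ 2 - 1 by rewrite t2 addrAC subrr add0r.
  by field; rewrite t1 tn0.
have lin w j : \sum_i A j i * xi i w =
    \sum_i Q j i * xi i w + a * \sum_k \sum_i Q k i * xi i w.
  rewrite exchange_big mulr_sumr -big_split/=; apply: eq_bigr => i _.
  by rewrite -mulr_suml SQ /Q /b; field.
rewrite -(iid_law iQ (@measurable_orthant_set J a)).
by congr (P _); apply/seteqP; split => w /= h j; have := h j; rewrite lin.
Qed.

(** The set defining [g m r] is inhabited: the square root of the covariance
    matrix, applied to the canonical Gaussian vector, is a suitable [eta]. *)
Lemma g_witness m (r : R) : 0 < 1 + m%:R * r ->
  orthant_probability m r (fine (gauss 'I_m (orthant_set 'I_m (sqrt_coef m r)))).
Proof.
move=> k0.
pose t := Num.sqrt (1 + m%:R * r).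
have t0 : 0 < t by rewrite sqrtr_gt0.
have t2 : t ^+ 2 = 1 + m%:R * r by rewrite sqr_sqrtr// ltW.
have t1 : 1 + t != 0 by rewrite gt_eqF// addr_gt0.
pose a := sqrt_coef m r.
have aE : a = r / (1 + t) by [].
pose M : 'M[R]_m := \matrix_(i, j) ((i == j)%:R + a).
have ME i (y : 'I_m -> R) : \sum_j M i j * y j = y i + a * \sum_j y j.
  under eq_bigr do rewrite mxE mulrDl.
  rewrite big_split/= -mulr_sumr; congr (_ + _).
  rewrite (bigD1 i)//= eqxx mul1r big1 ?addr0// => j.
  by rewrite eq_sym => /negbTE ->; rewrite mul0r.
have MM i j : \sum_k M i k * M j k = (i == j)%:R + r.
  rewrite ME mxE; under eq_bigr do rewrite mxE.
  rewrite big_split/= sumr_const card_ord -[a *+ m]mulr_natl (bigD1 j)//= eqxx big1 ?addr0; last first.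
    by move=> k; rewrite eq_sym => /negbTE ->.
  rewrite eq_sym -!addrA; congr (_ + _).
  transitivity (2 * a + m%:R * r * a / (1 + t)); first by rewrite aE mulr1n; field.
  have -> : m%:R * r = t ^+ 2 - 1 by rewrite t2 addrAC subrr add0r.
  by rewrite aE; field.
pose Z0 (x : vec R 'I_m) : m.-tuple R := [tuple x i | i < m].
have mZ0 : measurable_fun setT Z0.
  apply/measurable_fun_tnthP => i; rewrite (_ : _ \o _ = fun x => x i).
    exact: measurable_coord.
  by apply/funext => x /=; rewrite tnth_mktuple.
pose e0 (x : vec R 'I_m) : m.-tuple R := affine_map M 0 (Z0 x).
have e0E x i : tnth (e0 x) i = \sum_k M i k * x k.
  rewrite tnth_mktuple mxE addr0; apply: eq_bigr => k _; by rewrite tnth_mktuple.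
have me0 : measurable_fun setT e0.
  apply/measurable_fun_tnthP => i.
  rewrite (_ : _ \o _ = fun x => \sum_k M i k * x k); last by apply/funext => x; exact: e0E.
  exact: measurable_sum_coord.
pose Z : {RV (gauss 'I_m) >-> m.-tuple R} := HB.pack Z0 (isMeasurableFun.Build _ _ _ _ _ mZ0).
pose e : {RV (gauss 'I_m) >-> m.-tuple R} := HB.pack e0 (isMeasurableFun.Build _ _ _ _ _ me0).
have iZ : iid (gauss 'I_m) (fun j w => tnth (Z w) j).
  rewrite (_ : (fun j w => tnth (Z w) j) = (fun j x => x j)); first exact: iid_gauss.
  by apply/funext => j; apply/funext => x; rewrite tnth_mktuple.
have ig := @iid_gauss R 'I_m.
have Ee i : ('E_(gauss 'I_m)[fun w => tnth (e w) i] = 0)%E.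
  rewrite unlock -[RHS](iid_lin_integral ig (M i)).
  by apply: eq_integral => x _; congr EFin; exact: e0E.
exists _, _, (gauss 'I_m), e; split => //.
- exists _, _, (gauss 'I_m), m, Z, M, 0; split; last by [].
  exact: iid_standard_gaussian.
- move=> i j; rewrite unlock !Ee/=.
  rewrite (_ : (if _ then _ else _) = \sum_k M i k * M j k); last first.
    by rewrite MM; case: eqP => _; rewrite ?add0r.
  rewrite unlock -(iid_linM_integral ig (M i) (M j)).
  apply: eq_integral => x _; congr EFin.
  by rewrite -!e0E -[LHS]/((tnth (e0 x) i - 0) * (tnth (e0 x) j - 0)) !subr0 ?e0E.
- have mo : measurable (orthant_set 'I_m (sqrt_coef m r)) by exact: measurable_orthant_set.
  transitivity (gauss 'I_m (orthant_set 'I_m (sqrt_coef m r))).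
    congr (gauss 'I_m _); apply/seteqP; split => x /= h i; have := h i.
      by rewrite [tnth _ _]e0E ME.
    by rewrite [tnth _ _]e0E ME.
  apply/esym/fineK; exact: fin_num_measure.
Qed.

End gaussian_orthants.
Arguments orthant_set {R} J a.

Section g_value.
Context {R : realType}.

(** A Gaussian vector is an affine image of independent normal variables; its
    moments force the translation to vanish and the Gram matrix of the rows to
    be [I + r J], and [orthant_family] applies. *)
Lemma orthant_probability_unique m (r p : R) : 0 < 1 + m%:R * r ->
  orthant_probability m r p -> p%:E = gauss 'I_m (orthant_set 'I_m (sqrt_coef m r)).
Proof.
move=> k0 [d [T [P [eta [[d' [T' [P' [n [Z [A [c [stdZ law]]]]]]]] E0 cov <-]]]]].
have iZ := standard_gaussian_iid stdZ.
pose xi j w := tnth (Z w) j.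
have mxi j : measurable_fun setT (xi j) by have [h _] := iZ; exact: h.
pose X w := affine_map A c (Z w).
have XE w i : tnth (X w) i = \sum_j A i j * xi j w + c i 0 by rewrite tnth_mktuple.
have mX : measurable_fun setT X.
  apply/measurable_fun_tnthP => i.
  rewrite (_ : _ \o _ = fun w => \sum_j A i j * xi j w + c i 0); last first.
    by apply/funext => w; exact: XE.
  by apply: measurable_funD => //; apply: measurable_sum => j; exact: measurable_funM.
have meta : measurable_fun setT eta by [].
have law' B : measurable B -> P (eta @^-1` B) = P' (X @^-1` B) by exact: law.
have mco i : measurable_fun setT (fun t : m.-tuple R => tnth t i) by exact: measurable_tnth.
have intc (k : R) : P'.-integrable setT (fun=> k%:E) by exact: finite_measure_integrable_cst.
have intX i : P'.-integrable setT (fun w => (tnth (X w) i)%:E).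
  under eq_fun do rewrite XE EFinD.
  by apply: integrableD => //; exact: iid_lin_integrable.
have EX i : (\int[P']_w (tnth (X w) i)%:E = (c i 0)%:E)%E.
  under eq_integral do rewrite XE EFinD.
  rewrite integralD//; last exact: iid_lin_integrable.
  by rewrite iid_lin_integral// integral_cst//= probability_setT mule1 add0e.
have c0 i : c i 0 = 0.
  apply: EFin_inj; rewrite -EX; transitivity ('E_P[fun w => tnth (eta w) i])%E; last exact: E0.
  rewrite unlock; symmetry; apply: (same_law_integral (f := fun t : m.-tuple R => (tnth t i)%:E)) => //.
  - by apply/measurable_EFinP; exact: mco.
  - exact: intX.
have XE0 w i : tnth (X w) i = \sum_j A i j * xi j w by rewrite XE c0 addr0.
have AA (i j : (fintype.ordinal m)) : \sum_k A i k * A j k = (i == j)%:R + r.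
  apply: EFin_inj; rewrite -(iid_linM_integral iZ (A i) (A j)).
  transitivity (\int[P']_w (tnth (X w) i * tnth (X w) j)%:E)%E.
    by apply: eq_integral => w _; rewrite !XE0.
  transitivity (covariance P (fun w => tnth (eta w) i) (fun w => tnth (eta w) j)); last first.
    by rewrite cov; case: eqP => _; rewrite ?add0r.
  rewrite unlock !E0/= unlock.
  transitivity (\int[P]_w (tnth (eta w) i * tnth (eta w) j)%:E)%E; last first.
    apply: eq_integral => w _; congr EFin.
    by rewrite -[RHS]/((tnth (eta w) i - 0) * (tnth (eta w) j - 0)) !subr0.
  symmetry; apply: (same_law_integral (f := fun t : m.-tuple R => (tnth t i * tnth t j)%:E)) => //.
  - by apply/measurable_EFinP; exact: measurable_funM.
  - rewrite (_ : _ \o _ = fun w => ((\sum_k A i k * xi k w) * (\sum_k A j k * xi k w))%:E).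
      exact: iid_linM_integrable.
    by apply/funext => w; rewrite /= !XE0.
have mO : measurable [set t : m.-tuple R | forall i, tnth t i < 0].
  exact: measurable_forall_lt0.
transitivity (P' [set w | forall i, \sum_j A i j * xi j w < 0]).
  rewrite -[LHS]/(P (eta @^-1` [set t : m.-tuple R | forall i, tnth t i < 0])) law'//.
  by congr (P' _); apply/seteqP; split => w /= h i; have := h i; rewrite XE0.
have := orthant_family iZ AA; rewrite card_ord; exact.
Qed.

Lemma gE m (r : R) : 0 < 1 + m%:R * r ->
  (g m r)%:E = gauss 'I_m (orthant_set 'I_m (sqrt_coef m r)).
Proof.
have mO : measurable (orthant_set 'I_m (sqrt_coef m r)) by exact: measurable_orthant_set.
case: m mO => [|m] mO k0.
  rewrite /g (_ : orthant_set _ _ = setT) ?probability_setT//.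
  by apply/seteqP; split => // x _ [].
rewrite /g; set p := fine (gauss 'I_m.+1 (orthant_set 'I_m.+1 (sqrt_coef m.+1 r))).
rewrite (@xget_unique _ 0 (orthant_probability m.+1 r) p).
- apply/fineK; exact: fin_num_measure.
- exact: g_witness.
- move=> y oy; apply: EFin_inj; rewrite (orthant_probability_unique k0 oy).
  apply/esym/fineK; exact: fin_num_measure.
Qed.

(** The only access to [g] in what follows: no random vector needs to be built,
    only the scalar products of linear forms have to be computed. *)
Lemma g_family d (T : measurableType d) (P : {measure set T -> \bar R})
    (I J : finType) (xi : I -> T -> R) (A : J -> I -> R) (r : R) :
  iid P xi -> (forall j k, \sum_i A j i * A k i = (j == k)%:R + r) ->
  0 < 1 + #|J|%:R * r ->
  P [set w | forall j, \sum_i A j i * xi i w < 0] = (g #|J| r)%:E.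
Proof.
move=> ixi AA k0; rewrite gE//.
transitivity (P [set w | forall k : 'I_#|J|, \sum_i A (enum_val k) i * xi i w < 0]).
  congr (P _); apply/seteqP; split => w /= h j //.
  by have := h (enum_rank j); rewrite enum_rankK.
have := @orthant_family _ _ _ _ _ _ _ (fun k : 'I_#|J| => A (enum_val k)) r ixi.
rewrite card_ord; apply => // j k; rewrite AA; congr (_%:R + _).
by rewrite (inj_eq enum_val_inj).
Qed.

End g_value.

(** * Theorems of the alternative and convex hulls *)

Section farkas.
Context {R : realFieldType}.
Implicit Types (D : nat) (u y : nat -> R).

(** Vectors are functions on [nat] of which the first [D] values count: the
    dimension varies in the argument, and this encoding makes the inclusions of
    coordinate subspaces invisible. *)
Definition dot D u y : R := \sum_(j < D) u j * y j.

Lemma dotS D u y : dot D.+1 u y = dot D u y + u D * y D.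
Proof. by rewrite /dot big_ord_recr. Qed.

Lemma dotDl D u v y : dot D (fun j => u j + v j) y = dot D u y + dot D v y.
Proof. by rewrite /dot -big_split; apply: eq_bigr => j _; rewrite mulrDl. Qed.

Lemma dotZl D (a : R) u y : dot D (fun j => a * u j) y = a * dot D u y.
Proof. by rewrite /dot mulr_sumr; apply: eq_bigr => j _; rewrite mulrA. Qed.

Lemma dotDr D u v y : dot D u (fun j => v j + y j) = dot D u v + dot D u y.
Proof. by rewrite /dot -big_split; apply: eq_bigr => j _; rewrite mulrDr. Qed.

Lemma dotZr D (a : R) u y : dot D u (fun j => a * y j) = a * dot D u y.
Proof. by rewrite /dot mulr_sumr; apply: eq_bigr => j _; rewrite mulrCA. Qed.

Lemma eq_dot D u v y z : (forall j, (j < D)%N -> u j = v j) ->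
  (forall j, (j < D)%N -> y j = z j) -> dot D u y = dot D v z.
Proof. by move=> uv yz; apply: eq_bigr => j _; rewrite uv ?yz. Qed.

Lemma dot_sumr D u (I : finType) (w : I -> R) (y : I -> nat -> R) :
  dot D u (fun j => \sum_i w i * y i j) = \sum_i w i * dot D u (y i).
Proof.
rewrite /dot; under eq_bigr do rewrite mulr_sumr.
rewrite exchange_big; apply: eq_bigr => i _; rewrite mulr_sumr.
by apply: eq_bigr => j _; rewrite mulrCA.
Qed.

(** Induction on the number of inequalities. If the first one is not
    redundant, some [x0] is negative at [c] and [a ord0] and nonnegative at the
    other vectors; projecting all vectors along [a ord0] onto the kernel of [x0]
    removes that inequality. *)
Lemma farkas_ord D m (a : 'I_m -> nat -> R) (c : nat -> R) :
  (forall u, (forall i, 0 <= dot D u (a i)) -> 0 <= dot D u c) ->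
  exists w : 'I_m -> R, (forall i, 0 <= w i) /\
    forall j, (j < D)%N -> \sum_i w i * a i j = c j.
Proof.
elim: m a c => [|m IHm] a c H.
  exists (fun=> 0); split => // j jD; rewrite big_ord0.
  have : 0 <= dot D (fun k => - c k) c by apply: H => -[].
  rewrite -oppr_le0 /dot -sumrN; under eq_bigr do rewrite mulNr opprK -expr2.
  move=> c0; have s0 : \sum_(k < D) c k ^+ 2 = 0.
    by apply/eqP; rewrite eq_le c0 sumr_ge0// => k _; rewrite sqr_ge0.
  have /allP/(_ (Ordinal jD)) : all (fun k : 'I_D => true ==> (c k ^+ 2 == 0)) (index_enum 'I_D).
    by rewrite -psumr_eq0 ?s0// => k _; rewrite sqr_ge0.
  by rewrite mem_index_enum sqrf_eq0 => /(_ isT)/eqP/= ->.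
pose a' i := a (lift ord0 i).
have [H'|/existsNP[x0 /not_implyP[x0a' /negP]]] :=
  pselect (forall u, (forall i, 0 <= dot D u (a' i)) -> 0 <= dot D u c).
  have [w [w0 wE]] := IHm a' c H'.
  exists (fun i => oapp w 0 (unlift ord0 i)); split=> [i|j jD].
    by case: unliftP => [k _|_] /=.
  rewrite big_ord_recl unlift_none mul0r add0r -wE//.
  by apply: eq_bigr => i _; rewrite liftK.
rewrite -ltNge => x0c.
have x0a : dot D x0 (a ord0) < 0.
  rewrite ltNge; apply/negP => x0a; move: x0c; rewrite ltNge => /negP; apply.
  by apply: H => i; case: (unliftP ord0 i) => [k ->|->]; [exact: x0a'|].
pose be := - dot D x0 (a ord0); have be0 : 0 < be by rewrite oppr_gt0.
pose x1 j := be^-1 * x0 j.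
have x1a : dot D x1 (a ord0) = -1.
  by rewrite dotZl -[dot D x0 _]opprK -/be mulrN mulVf// gt_eqF.
have x1a' i : 0 <= dot D x1 (a' i).
  by rewrite dotZl mulr_ge0 ?invr_ge0 ?(ltW be0)//; exact: x0a'.
have x1c : dot D x1 c < 0 by rewrite dotZl pmulr_rlt0 ?invr_gt0.
pose proj (y : nat -> R) j := y j + dot D x1 y * a ord0 j.
have dotp u y : dot D u (proj y) = dot D (fun j => u j + dot D u (a ord0) * x1 j) y.
  by rewrite /proj dotDr dotZr dotDl dotZl mulrC.
have [w [w0 wE]] : exists w : 'I_m -> R, (forall i, 0 <= w i) /\
    forall j, (j < D)%N -> \sum_i w i * proj (a' i) j = proj c j.
  apply: IHm => u ua; rewrite dotp; apply: H => i.
  case: (unliftP ord0 i) => [k ->|->]; first by rewrite -dotp; exact: ua.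
  by rewrite dotDl dotZl x1a mulrN1 subrr.
pose w1 := \sum_i w i * dot D x1 (a' i) - dot D x1 c.
have w10 : 0 <= w1.
  by rewrite addr_ge0 ?sumr_ge0 ?oppr_ge0 ?(ltW x1c)// => i _; rewrite mulr_ge0.
exists (fun i => oapp w w1 (unlift ord0 i)); split=> [i|j jD].
  by case: unliftP => [k _|_] /=.
have h : \sum_i w i * a' i j + (\sum_i w i * dot D x1 (a' i)) * a ord0 j =
    c j + dot D x1 c * a ord0 j.
  rewrite -[RHS](wE j jD) mulr_suml -big_split/=; apply: eq_bigr => i _.
  by rewrite mulrDr mulrA.
rewrite big_ord_recl unlift_none/=.
have -> : \sum_(i < m) oapp w w1 (unlift ord0 (lift ord0 i)) * a (lift ord0 i) j =
    \sum_(i < m) w i * a' i j by apply: eq_bigr => i _; rewrite liftK.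
by rewrite /w1; lra.
Qed.

Lemma farkas D (I : finType) (a : I -> nat -> R) (c : nat -> R) :
  (forall u, (forall i, 0 <= dot D u (a i)) -> 0 <= dot D u c) ->
  exists w : I -> R, (forall i, 0 <= w i) /\
    forall j, (j < D)%N -> \sum_i w i * a i j = c j.
Proof.
move=> H; have [u ua|w [w0 wE]] := @farkas_ord D #|I| (fun k => a (enum_val k)) c.
  by apply: H => i; have := ua (enum_rank i); rewrite enum_rankK.
exists (w \o enum_rank); split=> [i|j jD]; first exact: w0.
rewrite -(wE j jD) (reindex (@enum_val I I))/=; last first.
  by exists enum_rank => k _; rewrite ?enum_valK ?enum_rankK.
by apply: eq_bigr => k _; rewrite enum_valK.
Qed.

(** Some linear form on the first [D] coordinates is positive at all points;
    equivalently, the column space of [y] meets the open positive orthant. *)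
Definition hit D (I : finType) (y : I -> nat -> R) := exists u, forall i, 0 < dot D u (y i).

(** Farkas' lemma in dimension [D + 1], the extra coordinate being constant. *)
Lemma gordan D (I : finType) (y : I -> nat -> R) :
  ~ hit D y -> exists w : I -> R, [/\ forall i, 0 <= w i, \sum_i w i = 1 &
    forall j, (j < D)%N -> \sum_i w i * y i j = 0].
Proof.
move=> nhit.
pose a i j := if (j < D)%N then y i j else -1.
pose c j : R := if (j < D)%N then 0 else -1.
have [u ua|w [w0 wE]] := @farkas D.+1 I a c.
  have dE z v : dot D.+1 u (fun j => if (j < D)%N then z j else v) = dot D u z - u D * (- v).
    rewrite dotS ltnn mulrN opprK; congr (_ + _); by apply: eq_dot => // j ->.
  rewrite dE opprK mulr1 [dot _ _ _]big1 ?sub0r ?oppr_ge0 => [|j _]; last by rewrite mulr0.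
  rewrite leNgt; apply/negP => uD; apply: nhit; exists u => i.
  have := ua i; rewrite dE opprK mulr1 subr_ge0; exact: lt_le_trans.
exists w; split => //; last first.
  move=> j jD; have := wE j (ltnW jD); rewrite /c jD => h; rewrite -[RHS]h.
  by apply: eq_bigr => i _; rewrite /a jD.
have := wE D (ltnSn D); rewrite /a /c ltnn.
by under eq_bigr do rewrite mulrN1; rewrite sumrN => /oppr_inj.
Qed.

End farkas.

Section convex_hull.
Context {R : realType}.

Lemma convex_comb (V : lmodType R) (A : set V) : @convex_set R V A ->
  forall n (w : 'I_n -> R) (v : 'I_n -> V), (forall i, 0 <= w i) ->
    \sum_i w i = 1 -> (forall i, A (v i)) -> A (\sum_i w i *: v i).
Proof.
move=> cA; elim=> [|n IHn] w v w0 w1 Av.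
  by move: w1; rewrite big_ord0 => /eqP; rewrite eq_sym oner_eq0.
move: w1; rewrite !big_ord_recl; set q := \sum_(i < n) _ => w1.
have q0 : 0 <= q by apply: sumr_ge0.
have w01 : w ord0 <= 1 by rewrite -w1 lerDl.
have qE : q = 1 - w ord0 by rewrite -w1 addrAC subrr add0r.
have [q00|qn0] := eqVneq q 0.
  have -> : w ord0 = 1 by rewrite -w1 q00 addr0.
  rewrite scale1r [X in _ + X]big1 ?addr0// => i _.
  have /eqP := q00; rewrite psumr_eq0// => /allP/(_ i); rewrite mem_index_enum => /(_ isT).
  by move=> /eqP ->; rewrite scale0r.
have AS : A (\sum_(i < n) (w (lift ord0 i) / q) *: v (lift ord0 i)).
  apply: IHn => //; first by move=> i; rewrite divr_ge0.
  by rewrite -mulr_suml divff.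
have := cA (v ord0) _ (Itv01 (w0 ord0) w01) (mem_set (Av ord0)) (mem_set AS).
rewrite inE; congr A.
rewrite -[LHS]/(w ord0 *: v ord0 + (1 - w ord0) *: _) -qE; congr (_ + _).
rewrite scaler_sumr; apply: eq_bigr => i _.
by rewrite scalerA mulrC divfK.
Qed.

(** A point outside the hull of finitely many points is strictly separated from
    them; conversely the open half-space defined by the form is convex. *)
Lemma not_in_convex_hull d n (X : d.-tuple R) (Xs : 'I_n -> d.-tuple R) (s : R) :
  ~ convex_hull (range (fun i => row_of_tuple (Xs i))) (s *: row_of_tuple X) <->
  hit d (fun i j => nth 0 (Xs i) j - s * nth 0 X j).
Proof.
pose y i j := nth 0 (Xs i) j - s * nth 0 X j.
split=> [nhull|[u uy] hull].
  apply: contrapT => /gordan[w [w0 w1 wE]]; apply: nhull => A [cA rA].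
  have -> : s *: row_of_tuple X = \sum_i w i *: row_of_tuple (Xs i).
    apply/rowP => j; rewrite summxE !mxE.
    have h : \sum_i w i * nth 0 (Xs i) j = s * nth 0 X j.
      apply/eqP; rewrite -subr_eq0 -[X in _ - X]mul1r -w1 mulr_suml -sumrB.
      rewrite -[eqbRHS](wE j (ltn_ord j)); apply/eqP; apply: eq_bigr => i _.
      by rewrite mulrBr.
    by rewrite (tnth_nth 0) -h; apply: eq_bigr => i _; rewrite !mxE (tnth_nth 0).
  by apply: convex_comb => // i; apply: rA; exists i.
pose f (v : 'rV[R]_d) := \sum_(j < d) u j * v 0 j.
have fX (t : d.-tuple R) : f (row_of_tuple t) = dot d u (nth 0 t).
  by apply: eq_bigr => j _; rewrite mxE (tnth_nth 0).
pose A : set 'rV[R]_d := [set v | s * dot d u (nth 0 X) < f v].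
have fD v1 v2 : f (v1 + v2) = f v1 + f v2.
  by rewrite /f -big_split; apply: eq_bigr => j _; rewrite mxE mulrDr.
have fZ k v : f (k *: v) = k * f v.
  by rewrite /f mulr_sumr; apply: eq_bigr => j _; rewrite mxE mulrCA.
have : A (s *: row_of_tuple X).
  apply: hull; split.
    move=> v1 v2 l; rewrite !inE /A/= => Av1 Av2.
    rewrite -[X in f X]/(l%:num *: v1 + (1 - l%:num) *: v2) fD !fZ.
    have l0 : 0 <= l%:num by [].
    have l1 : l%:num <= 1 by [].
    move: l0 l1; rewrite le_eqVlt => /orP[/eqP <- _|l0 l1].
      by rewrite mul0r add0r subr0 mul1r.
    have : 0 < l%:num * (f v1 - s * dot d u (nth 0 X)) by rewrite mulr_gt0// subr_gt0.
    have : 0 <= (1 - l%:num) * (f v2 - s * dot d u (nth 0 X)).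
      by rewrite mulr_ge0// subr_ge0// ltW.
    lra.
  move=> _ [i _ <-]; rewrite /A/= fX -subr_gt0.
  have := uy i; congr (_ < _).
  rewrite -dotZr -mulN1r -dotZr -dotDr; apply: eq_dot => // j _; ring.
by rewrite /A/= fZ fX ltxx.
Qed.

End convex_hull.

(** * Half-spaces, general position and a linear program *)

Section small_eps.
Context {R : realFieldType}.

(** Strict inequalities survive small perturbations, and equalities can be made
    strict by them. *)
Lemma small_eps (I : finType) (a b : I -> R) :
  (forall i, 0 < a i \/ a i = 0 /\ 0 < b i) ->
  exists2 e, 0 < e & forall i, 0 < a i + e * b i.
Proof.
move=> ab.
pose f i := if 0 < a i then a i / (1 + `|b i|) else 1.
have b1 i : 0 < 1 + `|b i| by rewrite ltr_pwDl.
have f0 i : 0 < f i by rewrite /f; case: ifP => // ai; rewrite divr_gt0.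
pose e := \big[Num.min/1]_i f i.
have e0 : 0 < e by apply: lt_bigmin.
exists e => // i; case: (ab i) => [ai|[-> bi]]; last by rewrite add0r mulr_gt0.
have ef : e <= f i by exact: bigmin_le.
have : e * `|b i| < a i.
  apply: (@le_lt_trans _ _ (f i * `|b i|)); first by rewrite ler_wpM2r.
  by rewrite /f ai -mulrA gtr_pMr// mulrC ltr_pdivrMr// mul1r ltrDr.
have := ler_norm (- b i); rewrite normrN => h.
have : e * - b i <= e * `|b i| by rewrite ler_wpM2l// ltW.
lra.
Qed.

End small_eps.

Section half_spaces.
Context {R : realType} {I : finType}.
Implicit Types (D : nat) (y : I -> nat -> R).

(** [hitU] and [hitL]: the form can be chosen with a positive, resp. negative,
    last coefficient. *)
Definition hitU D y := exists u, 0 < u D /\ forall i, 0 < dot D.+1 u (y i).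
Definition hitL D y := exists u, u D < 0 /\ forall i, 0 < dot D.+1 u (y i).

Lemma dot_set D (u : nat -> R) (a : R) z :
  dot D.+1 (fun j => if j == D then a else u j) z = dot D u z + a * z D.
Proof.
by rewrite dotS eqxx; congr (_ + _); apply: eq_dot => // j jD; rewrite (ltn_eqF jD).
Qed.

Lemma hit_hitUL D y : hit D y -> hitU D y /\ hitL D y.
Proof.
move=> [u uy].
have key (s : R) : exists2 e, 0 < e & forall i, 0 < dot D.+1 (fun j => if j == D then s * e else u j) (y i).
  have [|e e0 he] := @small_eps _ I (fun i => dot D u (y i)) (fun i => s * y i D).
    by move=> i; left.
  by exists e => // i; rewrite dot_set mulrAC mulrC; exact: he.
split.
  have [e e0 he] := key 1; exists (fun j => if j == D then 1 * e else u j).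
  by split; [rewrite eqxx mul1r|exact: he].
have [e e0 he] := key (-1); exists (fun j => if j == D then -1 * e else u j).
by split; [rewrite eqxx mulN1r oppr_lt0|exact: he].
Qed.

(** A positive combination of the two forms has a zero last coefficient. *)
Lemma hitUL_hit D y : hitU D y -> hitL D y -> hit D y.
Proof.
move=> [u [u0 uy]] [v [v0 vy]].
exists (fun j => (- v D) * u j + u D * v j) => i.
have := uy i; have := vy i; rewrite !dotS dotDl !dotZl => h1 h2.
rewrite (_ : _ + _ = (- v D) * (dot D u (y i) + u D * y i D) +
   u D * (dot D v (y i) + v D * y i D)); last by ring.
by rewrite addr_gt0// mulr_gt0// oppr_gt0.
Qed.

Lemma hitS D y : hit D.+1 y <-> hitU D y \/ hitL D y.
Proof.
split=> [[u uy]|[[u [_ uy]]|[u [_ uy]]]]; [|by exists u|by exists u].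
have [u0|u0|u0] := ltgtP (u D) 0; [by right; exists u|by left; exists u|].
have [|U _] := @hit_hitUL D y; last by left.
by exists u => i; have := uy i; rewrite dotS u0 mul0r addr0.
Qed.

Lemma hitL_hitU D y : hitL D y -> hitU D.+1 y.
Proof. by move=> h; have [] := @hit_hitUL D.+1 y; first by apply/hitS; right. Qed.

End half_spaces.

Section generic.
Context {R : realType} {n : nat}.
Implicit Types (D : nat) (y : 'I_n -> nat -> R).

Definition minor_mx D y (f : 'I_D -> 'I_n) : 'M[R]_D := \matrix_(a, b) y (f a) b.

(** General position of the projections of the points on the first [D]
    coordinates. *)
Definition generic D y := forall f : 'I_D -> 'I_n, injective f -> \det (minor_mx y f) != 0.

(** A form that vanishes at [D] points in general position is zero. *)
Lemma generic_kernel D y (u : nat -> R) (T : {set 'I_n}) : generic D y ->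
  (forall i, i \in T -> dot D u (y i) = 0) -> (D <= #|T|)%N -> forall j, (j < D)%N -> u j = 0.
Proof.
move=> gen uT DT j jD.
pose f (a : 'I_D) := enum_val (widen_ord DT a).
have finj : injective f by move=> a b /enum_val_inj/(congr1 val)/=/val_inj.
have := gen f finj; rewrite -unitfE -unitmxE => Mu.
have : minor_mx y f *m (\col_b u b) = 0.
  apply/colP => a; rewrite !mxE -[RHS](uT (f a)); last by rewrite enum_valP.
  by apply: eq_bigr => b _; rewrite !mxE mulrC.
move=> /(congr1 (mulmx (invmx (minor_mx y f)))); rewrite mulKmx// mulmx0.
by move=> /colP/(_ (Ordinal jD)); rewrite !mxE.
Qed.

Lemma cover_inj D (A : {set 'I_n}) : (#|A| <= D)%N -> (D <= n)%N ->
  exists f : 'I_D -> 'I_n, injective f /\ forall i, i \in A -> exists a, f a = i.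
Proof.
move=> AD Dn; pose s := enum A ++ enum (~: A)%SET.
have us : uniq s.
  rewrite cat_uniq !enum_uniq andbT/=; apply/hasPn => i.
  by rewrite !mem_enum !inE.
have ss : size s = n by rewrite size_cat -!cardE cardsC card_ord.
have sD (a : 'I_D) : (a < size s)%N by rewrite ss (leq_trans (ltn_ord a)).
exists (fun a => nth (widen_ord Dn a) s a); split=> [a b|i iA].
  rewrite (set_nth_default (widen_ord Dn b))// => /eqP.
  by rewrite nth_uniq// => /eqP/val_inj.
have iD : (index i s < D)%N.
  rewrite (leq_trans _ AD)// /s index_cat mem_enum iA (leq_trans (_ : _ < size (enum A))%N)//.
    by rewrite index_mem mem_enum.
  by rewrite -cardE.
exists (Ordinal iD); rewrite nth_index// mem_cat mem_enum iA//.
Qed.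

Lemma generic_cokernel D y (w : 'I_n -> R) (A : {set 'I_n}) : generic D y ->
  (#|A| <= D)%N -> (D <= n)%N -> (forall i, i \notin A -> w i = 0) ->
  (forall j, (j < D)%N -> \sum_i w i * y i j = 0) -> forall i, w i = 0.
Proof.
move=> gen AD Dn wA wy i.
have [f [finj fA]] := cover_inj AD Dn.
have := gen f finj; rewrite -unitfE -unitmxE => Mu.
have wM : (\row_a w (f a)) *m minor_mx y f = 0.
  apply/rowP => b; rewrite !mxE -[RHS](wy b (ltn_ord b)).
  under eq_bigr do rewrite !mxE.
  rewrite (bigID (mem (codom f)))/= [X in _ + X]big1 ?addr0; last first.
    move=> k kf; rewrite wA ?mul0r//; apply: contra kf => /fA[a <-]; exact: codom_f.
  rewrite -[RHS]big_filter.
  rewrite -(big_map f xpredT (fun k => w k * y k b))/=; apply: perm_big.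
  apply: uniq_perm; first by rewrite map_inj_uniq// index_enum_uniq.
    by rewrite filter_uniq// index_enum_uniq.
  move=> k; rewrite mem_filter mem_index_enum andbT.
  apply/mapP/codomP => [[a _ ->]|[a ->]]; first by exists a.
  by exists a => //; rewrite mem_index_enum.
have [iA|/wA//] := boolP (i \in A).
have [a <-] := fA i iA.
move: wM => /(congr1 (mulmx^~ (invmx (minor_mx y f)))); rewrite mulmxK// mul0mx.
by move=> /rowP/(_ a); rewrite !mxE.
Qed.

Lemma generic_solve D y (A : {set 'I_n}) (b : 'I_n -> R) : generic D y ->
  (#|A| <= D)%N -> (D <= n)%N -> exists u, forall i, i \in A -> dot D u (y i) = b i.
Proof.
move=> gen AD Dn.
have [f [finj fA]] := cover_inj AD Dn.
have := gen f finj; rewrite -unitfE -unitmxE => Mu.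
pose v := invmx (minor_mx y f) *m \col_a b (f a).
exists (fun j => if insub j is Some k then v k 0 else 0) => i /fA[a <-].
have : (minor_mx y f *m v) a 0 = b (f a) by rewrite mulKVmx// mxE.
move=> <-; rewrite mxE; apply: eq_bigr => j _; by rewrite valK !mxE mulrC.
Qed.

(** At most [D] points lie on the hyperplane of [u], so some form takes the
    value 1 at all of them; adding a small multiple of it makes the weak
    inequalities strict. *)
Lemma generic_perturb D y (u : nat -> R) (c : nat) (s : R) : generic D y -> (D <= n)%N ->
  (exists2 j, (j < D)%N & u j != 0) -> (forall i, 0 <= dot D u (y i)) -> 0 < s * u c ->
  exists2 v, (forall i, 0 < dot D v (y i)) & 0 < s * v c.
Proof.
move=> gen Dn [j0 j0D uj0] uy suc.
pose T := [set i | dot D u (y i) == 0]%SET.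
have TD : (#|T| <= D)%N.
  rewrite leqNgt; apply/negP => /ltnW DT; move: uj0.
  rewrite (@generic_kernel D y u T)// ?eqxx// => i; by rewrite inE => /eqP.
have [v vT] := generic_solve (fun=> 1) gen TD Dn.
pose a (o : option 'I_n) := if o is Some i then dot D u (y i) else s * u c.
pose b (o : option 'I_n) := if o is Some i then dot D v (y i) else s * v c.
have [|e e0 he] := @small_eps _ _ a b.
  case=> [i|]; last by left.
  have := uy i; rewrite le_eqVlt => /orP[/eqP ui|]; last by left.
  right; split; first by rewrite /= -ui.
  by rewrite /= vT// inE -ui.
exists (fun j => u j + e * v j).
  by move=> i; rewrite dotDl dotZl; exact: (he (Some i)).
by have := he None; rewrite /a /b mulrDr mulrCA.
Qed.

(** The projections of the [n] points on the first [n] coordinates are linearly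
    independent, so a form can take the value 1 at all of them, whatever its
    last coefficient. *)
Lemma generic_hitU y : generic n y -> hitU n y.
Proof.
move=> gen.
have [|u uE] := @generic_solve n y [set: 'I_n]%SET (fun i => 1 - y i n) gen _ (leqnn n).
  by rewrite cardsT card_ord.
exists (fun j => if j == n then 1 else u j); rewrite eqxx; split => // i.
by rewrite dot_set uE ?inE// mul1r subrK.
Qed.

End generic.

Section linear_program.
Context {R : realType} {n k : nat}.
Implicit Types (y : 'I_n -> nat -> R) (S : {set 'I_n}).

(** The event by which [hitU k.+1] exceeds [hitL k], see [hitL_hitU]. Up to
    boundary cases it says that the linear program of [optimal] is feasible and
    bounded. *)
Definition leaves y := hitU k.+1 y /\ ~ hitL k y.

(** [S] is the optimal basis of the program: minimize [u k] subject to
    [u k.+1 = 1] and [0 <= dot k.+2 u (y i)] for all [i]. The forms [u] and the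
    weights [w] are primal and dual solutions, strictly complementary. *)
Definition optimal S y := exists u w,
  [/\ u k.+1 = 1, forall i, i \in S -> dot k.+2 u (y i) = 0 &
      forall i, i \notin S -> 0 < dot k.+2 u (y i)] /\
  [/\ forall i, i \in S -> 0 < w i, forall i, i \notin S -> w i = 0 &
      forall j, (j < k.+1)%N -> \sum_i w i * y i j = (j == k)%:R].

Let dot_delta u (a b : R) : dot k.+2 u (fun j => if j == k then a else if j == k.+1 then b else 0) =
  u k * a + u k.+1 * b.
Proof.
rewrite !dotS [dot k _ _]big1 ?add0r ?eqxx ?gtn_eqF// => j _.
by rewrite ltn_eqF// ltn_eqF ?mulr0// ltnS ltnW.
Qed.

Let dot_delta1 (u : nat -> R) : dot k.+1 u (fun j => (j == k)%:R) = u k.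
Proof.
rewrite dotS [dot k _ _]big1 ?add0r ?eqxx ?mulr1// => j _.
by rewrite ltn_eqF// mulr0.
Qed.

(** Weak duality with complementary slackness. *)
Lemma optimal_duality S S' y u w u' : 
  [/\ u k.+1 = 1, forall i, i \in S -> dot k.+2 u (y i) = 0 &
      forall i, i \notin S -> 0 < dot k.+2 u (y i)] ->
  [/\ forall i, i \in S -> 0 < w i, forall i, i \notin S -> w i = 0 &
      forall j, (j < k.+1)%N -> \sum_i w i * y i j = (j == k)%:R] ->
  u' k.+1 = 1 -> (forall i, i \notin S' -> 0 < dot k.+2 u' (y i)) ->
  (forall i, i \in S' -> dot k.+2 u' (y i) = 0) ->
  u k <= u' k /\ (u k = u' k -> {subset S <= S'}).
Proof.
move=> [u1 uS uSc] [wS wSc wy] u'1 u'Sc u'S.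
have dotw v : v k.+1 = 1 -> \sum_i w i * dot k.+2 v (y i) = v k + \sum_i w i * y i k.+1.
  move=> v1; rewrite -dot_sumr dotS v1 mul1r -(dot_delta1 v); congr (_ + _).
  by apply: eq_dot.
have wu0 : \sum_i w i * dot k.+2 u (y i) = 0.
  rewrite big1// => i _; have [iS|iS] := boolP (i \in S); first by rewrite uS ?mulr0.
  by rewrite wSc ?mul0r.
have w0 i : 0 <= w i.
  by have [/wS/ltW//|/wSc ->] := boolP (i \in S).
have u'0 i : 0 <= dot k.+2 u' (y i).
  by have [/u'S ->//|/u'Sc/ltW] := boolP (i \in S').
have t0 i : true -> 0 <= w i * dot k.+2 u' (y i) by rewrite mulr_ge0.
have : 0 <= \sum_i w i * dot k.+2 u' (y i) by exact: sumr_ge0.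
move: wu0; rewrite !dotw// => h1 h2; split; first by lra.
move=> uu' i iS; apply: contraT => iS'.
have : \sum_i w i * dot k.+2 u' (y i) == 0 by rewrite dotw// -uu' h1.
rewrite psumr_eq0// => /allP/(_ i); rewrite mem_index_enum => /(_ isT)/=.
by rewrite mulf_eq0 !gt_eqF ?wS ?u'Sc.
Qed.

Lemma optimal_unique S S' y : optimal S y -> optimal S' y -> S = S'.
Proof.
move=> [u [w [uP wP]]] [u' [w' [uP' wP']]].
have [u1 uS uSc] := uP; have [u1' uS' uSc'] := uP'.
have [h1 h2] := optimal_duality uP wP u1' uSc' uS'.
have [h3 h4] := optimal_duality uP' wP' u1 uSc uS.
have uu : u k = u' k by apply/eqP; rewrite eq_le h1 h3.
by apply/setP => i; apply/idP/idP; [exact: h2|exact: h4].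
Qed.

(** The primal solution [u], made strict on [S] by general position, shows
    [hitU k.+1]; the dual solution [w] excludes [hitL k]. *)
Lemma optimal_leaves S y : (k.+1 <= n)%N -> #|S| = k.+1 -> generic k.+1 y ->
  optimal S y -> leaves y.
Proof.
move=> kn cS gen [u [w [[u1 uS uSc] [wS wSc wy]]]]; split.
  have [|v vS] := generic_solve (A := S) (fun=> 1) gen _ kn; first by rewrite cS.
  have [|e e0 he] := @small_eps _ _ (fun i => dot k.+2 u (y i)) (fun i => dot k.+1 v (y i)).
    move=> i; have [iS|iS] := boolP (i \in S); last by left; exact: uSc.
    by right; rewrite uS// vS.
  exists (fun j => if j == k.+1 then 1 else u j + e * v j); rewrite eqxx; split => // i.
  have := he i; rewrite dot_set dotDl dotZl [dot k.+2 _ _]dotS u1.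
  by rewrite addrAC.
move=> [v [vk vy]].
have : 0 <= \sum_i w i * dot k.+1 v (y i).
  apply: sumr_ge0 => i _; have [iS|/wSc ->] := boolP (i \in S); last by rewrite mul0r.
  by rewrite mulr_ge0 ?ltW ?wS.
rewrite -dot_sumr (eq_dot (v := v) (z := fun j => (j == k)%:R))//.
by rewrite dot_delta1 leNgt vk.
Qed.

(** Strong duality. The dual is feasible since otherwise Farkas' lemma gives a
    form showing [hitL k], and its values are bounded by those of the feasible
    form that shows [hitU k.+1]. Farkas' lemma, used twice, then provides a dual
    solution and a primal solution with the same value. General position in
    dimension [k] and [k.+2] forces the support of the dual solution to have at
    least [k.+1] elements and the primal solution to vanish at no more than
    [k.+1] points, whence strict complementarity. *)
Lemma leaves_optimal y : (k.+1 <= n)%N ->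
  generic k y -> generic k.+1 y -> generic k.+2 y ->
  leaves y -> exists S, #|S| = k.+1 /\ optimal S y.
Proof.
move=> kn gen0 gen1 gen2 [[u0 [u00 u0y]] nL].
(* [c t] is the right-hand side of the dual constraints, the dual value being [t]. *)
pose c (t : R) j : R := if j == k then 1 else if j == k.+1 then - t else 0.
have dotc u t : dot k.+2 u (c t) = u k - t * u k.+1.
  by rewrite dot_delta mulr1 mulrN mulrC.
have [v vy|w0 [w00 w0y]] := @farkas R k.+1 'I_n y (fun j => (j == k)%:R).
  rewrite dot_delta1 leNgt; apply/negP => vk; apply: nL.
  have [||v' v'y v'k] := @generic_perturb _ _ k.+1 y v k (-1) gen1 kn _ vy.
  - by exists k => //; rewrite lt_eqF.
  - by rewrite mulN1r oppr_gt0.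
  by exists v'; split => //; rewrite -oppr_gt0 -mulN1r.
pose Td t := exists w : 'I_n -> R, (forall i, 0 <= w i) /\
  forall j, (j < k.+2)%N -> \sum_i w i * y i j = c t j.
have Tddot t u : Td t -> (forall i, 0 <= dot k.+2 u (y i)) -> 0 <= u k - t * u k.+1.
  move=> [w [w_ge0 wy]] uy; rewrite -dotc -(eq_dot (u := u) (fun _ _ => erefl) wy).
  by rewrite dot_sumr; apply: sumr_ge0 => i _; rewrite mulr_ge0.
pose t0 := - \sum_i w0 i * y i k.+1.
have Td0 : Td t0.
  exists w0; split=> // j; rewrite ltnS leq_eqVlt => /orP[/eqP ->|jk].
    by rewrite /c gtn_eqF// eqxx opprK.
  by rewrite w0y// /c (ltn_eqF jk); case: eqP.
have u0y' i : 0 <= dot k.+2 u0 (y i) by exact: ltW.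
have Tdub : has_sup [set t | Td t].
  split; first by exists t0.
  exists (u0 k / u0 k.+1) => t Tdt; rewrite ler_pdivlMr//.
  by have := Tddot _ _ Tdt u0y'; rewrite subr_ge0.
pose ts := sup [set t | Td t].
have ts_ub t : Td t -> t <= ts by move=> Tdt; apply: sup_upper_bound.
have ts_min u : u k.+1 = 1 -> (forall i, 0 <= dot k.+2 u (y i)) -> ts <= u k.
  move=> u1 uy; apply: ge_sup; first by exists t0.
  by move=> t Tdt; have := Tddot _ _ Tdt uy; rewrite u1 mulr1 subr_ge0.
have normal u : (forall i, 0 <= dot k.+2 u (y i)) -> 0 < u k.+1 ->
    exists u', [/\ u' k.+1 = 1, u' k = u k / u k.+1 & forall i, 0 <= dot k.+2 u' (y i)].
  move=> uy uk; exists (fun j => (u k.+1)^-1 * u j); split.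
  - by rewrite mulVf// gt_eqF.
  - by rewrite mulrC.
  - by move=> i; rewrite dotZl mulr_ge0// invr_ge0 ltW.
(* By Farkas' lemma the dual values form a closed set. *)
have [w [w_ge0 wy]] : Td ts.
  apply: farkas => u uy; rewrite dotc leNgt; apply/negP => un.
  have := Tddot _ _ Td0 uy; have := ts_ub _ Td0.
  have [uk|uk|uk] := ltgtP (u k.+1) 0; last by rewrite uk; move: un; rewrite uk; lra.
    by nra.
  have [u' [u'1 u'k u'y]] := normal u uy uk.
  have := ts_min u' u'1 u'y; rewrite u'k ler_pdivlMr//; lra.
(* If no primal value reached [ts], Farkas' lemma would contradict the
   feasibility of [u0] (case [l = 0]) or give a dual value larger than [ts]. *)
have [u [uy u1 uk]] : exists u, [/\ forall i, 0 <= dot k.+2 u (y i), u k.+1 = 1 & u k <= ts].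
  apply: contrapT => nu.
  pose a (o : option 'I_n) := if o is Some i then y i else fun j => -1 * c ts j.
  pose cc j : R := if j == k then 0 else if j == k.+1 then -1 else 0.
  have [v va|wl [wl0 wlE]] := @farkas R k.+2 _ a cc.
    rewrite dot_delta mulr0 add0r mulrN1 oppr_ge0 leNgt; apply/negP => vk; apply: nu.
    have [u' [u'1 u'k u'y]] := normal v (fun i => va (Some i)) vk.
    exists u'; split => //; rewrite u'k ler_pdivrMr//.
    by have := va None; rewrite /a dotZr dotc; lra.
  pose l := wl None; have l0 : 0 <= l by exact: wl0.
  have wlE' j : (j < k.+2)%N -> \sum_i wl (Some i) * y i j = cc j + l * c ts j.
    move=> jk; have := wlE j jk; rewrite (bigD1 None)//=.
    rewrite (reindex_omap (Some : 'I_n -> _) id)/=; last by case.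
    rewrite (eq_bigl xpredT); last by move=> i; rewrite eqxx.
    by move=> <-; rewrite /l; ring.
  move: l0; rewrite le_eqVlt => /orP[/eqP l0|l0].
    have : 0 <= \sum_i wl (Some i) * dot k.+2 u0 (y i).
      by apply: sumr_ge0 => i _; rewrite mulr_ge0.
    rewrite -dot_sumr (eq_dot (v := u0) (z := cc))//; last first.
      by move=> j jk; rewrite wlE'// -l0 mul0r addr0.
    by rewrite dot_delta mulr0 add0r mulrN1 oppr_ge0 leNgt u00.
  have /ts_ub : Td (ts + l^-1).
    exists (fun i => l^-1 * wl (Some i)); split=> [i|j jk]; first by rewrite mulr_ge0// invr_ge0 ltW.
    under eq_bigr do rewrite -mulrA.
    rewrite -mulr_sumr wlE'// /cc /c; case: eqP => _; first by field; rewrite gt_eqF.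
    by case: eqP => _; field; rewrite gt_eqF.
  by rewrite gerDl leNgt invr_gt0 l0.
have compl : \sum_i w i * dot k.+2 u (y i) = 0.
  rewrite -dot_sumr (eq_dot (v := u) (z := c ts))// dotc u1 mulr1.
  by apply/eqP; rewrite subr_eq0 eq_le uk ts_min.
have tight i : 0 < w i -> dot k.+2 u (y i) = 0.
  move=> wi; move/eqP: compl; rewrite psumr_eq0; last by move=> j _; rewrite mulr_ge0.
  move=> /allP/(_ i); rewrite mem_index_enum => /(_ isT)/=.
  by rewrite mulf_eq0 gt_eqF//= => /eqP.
pose S := [set i | 0 < w i]%SET; pose T := [set i | dot k.+2 u (y i) == 0]%SET.
have ST : S \subset T.
  by apply/fintype.subsetP => i; rewrite !inE => /tight ->.
have T_le : (#|T| <= k.+1)%N.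
  rewrite leqNgt; apply/negP => kT.
  have h : forall i, i \in T -> dot k.+2 u (y i) = 0 by move=> i; rewrite inE => /eqP.
  have := generic_kernel gen2 h kT (ltnSn k.+1); rewrite u1 => /eqP.
  by rewrite oner_eq0.
have S_ge : (k < #|S|)%N.
  rewrite ltnNge; apply/negP => Sk.
  have w0_ i : w i = 0.
    apply: (generic_cokernel gen0 Sk (ltnW kn)) => [i'|j jk].
      by rewrite inE -leNgt => h; apply/eqP; rewrite eq_le h w_ge0.
    by rewrite wy 1?ltnW// 1?ltnW// /c (ltn_eqF jk) ltn_eqF// ltnW.
  have := wy k (ltnW (ltnSn k.+1)); rewrite /c eqxx big1 => [/eqP|i _]; last by rewrite w0_ mul0r.
  by rewrite eq_sym oner_eq0.
have ST' : S = T by apply/eqP; rewrite eqEcard ST (leq_trans T_le).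
exists S; split.
  by apply/eqP; rewrite eqn_leq S_ge andbT ST'.
exists u, w; split; split => //.
- by move=> i; rewrite inE => /tight.
- move=> i; rewrite ST' inE => uT; by rewrite lt_neqAle eq_sym uT uy.
- by move=> i; rewrite inE.
- by move=> i; rewrite inE -leNgt => h; apply/eqP; rewrite eq_le h w_ge0.
- move=> j jk; rewrite wy 1?ltnW// /c; case: eqP => // _; by rewrite ltn_eqF.
Qed.

End linear_program.
Arguments optimal {R n} k S y.
Arguments leaves {R n} k y.

(** * General position holds almost surely *)

Section measurable_hit.
Context {R : realType}.

(** Separation is an open condition, so rational coefficients suffice; this
    makes the event a countable union. *)
Lemma hit_rat D (O : finType) (z : O -> nat -> R) :
  hit D z <-> exists q : {ffun 'I_D -> rat}, forall o, 0 < \sum_(j < D) ratr (q j) * z o j.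
Proof.
split=> [[u uz]|[q qz]]; last first.
  exists (fun j => if insub j is Some k then ratr (q k) else 0) => o.
  by have := qz o; congr (_ < _); apply: eq_bigr => j _; rewrite valK.
have [|e e0 he] := @small_eps R O (fun o => dot D u (z o)) (fun o => - \sum_(j < D) `|z o j|).
  by move=> o; left.
have /choice[q qu] : forall j : 'I_D, exists r : rat, u j < ratr r < u j + e.
  move=> j; have [|r] := @rat_in_itvoo R (u j) (u j + e); first by rewrite ltrDl.
  by rewrite in_itv/= => h; exists r.
exists [ffun j => q j] => o; apply: lt_le_trans (he o) _.
rewrite mulrN mulr_sumr /dot -sumrB; apply: ler_sum => j _.
rewrite ffunE lerBlDr -lerBlDl -mulrBl.
apply: le_trans (ler_norm _) _; rewrite normrM ler_wpM2r//.
have /andP[h1 h2] := qu j.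
by rewrite ler_norml; apply/andP; split; lra.
Qed.

Lemma measurable_forall_gt0 d (T : measurableType d) (J : finType) (f : J -> T -> R) :
  (forall j, measurable_fun setT (f j)) -> measurable [set w | forall j, 0 < f j w].
Proof.
move=> mf; rewrite (_ : [set w | _] = [set w | forall j, - f j w < 0]).
  by apply: measurable_forall_lt0 => j; exact: measurableT_comp.
by apply/seteqP; split => w /= h j; have := h j; rewrite oppr_lt0.
Qed.

Lemma measurable_hit d (T : measurableType d) D (O : finType) (z : T -> O -> nat -> R) :
  (forall o j, measurable_fun setT (fun w => z w o j)) -> measurable [set w | hit D (z w)].
Proof.
move=> mz.
rewrite (_ : [set w | _] = \bigcup_(q : {ffun 'I_D -> rat})
    [set w | forall o, 0 < \sum_(j < D) ratr (q j) * z w o j]).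
  apply: countable_bigcupT_measurable => [|q]; first exact: countableP.
  apply: measurable_forall_gt0 => o; apply: measurable_sum => j.
  exact: measurable_funM.
apply/seteqP; split => [w /= /hit_rat[q qz]|w [q _ /= qz]]; first by exists q.
by apply/hit_rat; exists q.
Qed.

(** A sign condition on the last coefficient is positivity at an additional
    point. *)
Lemma hit_extra D (O : finType) (z : O -> nat -> R) (s : R) :
  hit D.+1 (fun o : option O => if o is Some o' then z o' else fun j => if j == D then s else 0) <->
  exists u, 0 < s * u D /\ forall o, 0 < dot D.+1 u (z o).
Proof.
have e u : dot D.+1 u (fun j => if j == D then s else 0) = s * u D.
  rewrite dotS eqxx [dot _ _ _]big1 ?add0r 1?mulrC// => j _; by rewrite ltn_eqF// mulr0.
split=> [[u uz]|[u [uD uz]]]; exists u.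
  by split; [rewrite -e; exact: (uz None)|move=> o; exact: (uz (Some o))].
by case=> [i|] //; rewrite e.
Qed.

Lemma measurable_hitU d (T : measurableType d) D (O : finType) (z : T -> O -> nat -> R) :
  (forall o j, measurable_fun setT (fun w => z w o j)) -> measurable [set w | hitU D (z w)].
Proof.
move=> mz; rewrite (_ : [set w | _] = [set w | hit D.+1 (fun o : option O =>
    if o is Some o' then z w o' else fun j => if j == D then 1 else 0)]).
  by apply: measurable_hit; case=> [i|] j //; exact: mz.
apply/seteqP; split => w /=.
  by move=> [u [u0 uz]]; apply/hit_extra; exists u; rewrite mul1r.
by move=> /hit_extra [u [u0 uz]]; exists u; rewrite -[u D]mul1r.
Qed.

Lemma measurable_hitL d (T : measurableType d) D (O : finType) (z : T -> O -> nat -> R) :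
  (forall o j, measurable_fun setT (fun w => z w o j)) -> measurable [set w | hitL D (z w)].
Proof.
move=> mz; rewrite (_ : [set w | _] = [set w | hit D.+1 (fun o : option O =>
    if o is Some o' then z w o' else fun j => if j == D then -1 else 0)]).
  by apply: measurable_hit; case=> [i|] j //; exact: mz.
apply/seteqP; split => w /=.
  by move=> [u [u0 uz]]; apply/hit_extra; exists u; rewrite mulN1r oppr_gt0.
by move=> /hit_extra [u [u0 uz]]; exists u; rewrite -oppr_gt0 -mulN1r.
Qed.

Lemma measurable_det d (T : measurableType d) m (M : T -> 'M[R]_m) :
  (forall i j, measurable_fun setT (fun w => M w i j)) ->
  measurable_fun setT (fun w => \det (M w)).
Proof.
move=> mM; apply: measurable_sum => p; apply: measurable_funM => //.
by apply: measurable_prod => i _; exact: mM.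
Qed.

End measurable_hit.

Section gaussian_points.
Context {R : realType} (s : R) (n N : nat).
Local Notation Ix := (option 'I_n * 'I_N.+1)%type.

(** The points [X_i - s X], when [x] collects the coordinates of all the
    vectors: [x (Some i, j)] those of [X_i] and [x (None, j)] those of [X]. *)
Definition pts (x : vec R Ix) (i : 'I_n) (j : nat) : R :=
  x (Some i, inord j) - s * x (None, inord j).

Lemma measurable_pts i j : measurable_fun setT (fun x : vec R Ix => pts x i j).
Proof.
by apply: measurable_funB; [|apply: measurable_funM => //]; exact: measurable_coord.
Qed.

End gaussian_points.

Section null_sets.
Context {R : realType}.

(** A normalised linear form is standard normal, by rotation invariance, and the
    normal law has no atom. *)
Lemma gauss_affine_null (I : finType) (c : I -> R) (v : R) (i0 : I) : c i0 != 0 ->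
  gauss I [set x | \sum_i c i * x i = v] = 0%E.
Proof.
move=> ci0; set r2 := \sum_i c i ^+ 2.
have r20 : 0 < r2.
  rewrite /r2 (bigD1 i0)//= ltr_pwDl ?exprn_even_gt0//.
  by apply: sumr_ge0 => i _; rewrite sqr_ge0.
pose r := Num.sqrt r2; have r0 : 0 < r by rewrite sqrtr_gt0.
have rn0 : r != 0 by rewrite gt_eqF.
pose Q (_ : unit) i := c i / r.
have oQ : orthonormal_rows Q.
  move=> [] []; rewrite /Q; under eq_bigr do rewrite mulrACA -expr2.
  by rewrite -mulr_suml -/r2 -invfM -expr2 sqr_sqrtr ?ltW// divff// gt_eqF.
have iQ := orthonormal_keeps_iid oQ (iid_gauss I).
transitivity (nrm [set v / r]).
  rewrite -(iid_marginal iQ tt (measurable_set1 _)).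
  congr (gauss I _); apply/seteqP; split => x /=; rewrite /Q.
    by move=> <-; rewrite mulr_suml; apply: eq_bigr => i _; rewrite mulrAC.
  move=> h; apply: (mulIf (invr_neq0 rn0)); rewrite -h mulr_suml.
  by apply: eq_bigr => i _; rewrite mulrAC.
have := normal_prob_dominates (0 : R) 1.
move=> /null_content_dominatesP; apply; last exact: lebesgue_measure_set1.
exact: measurable_set1.
Qed.

Lemma integral_le_null d (T : measurableType d) (P : probability T R)
    (f : T -> \bar R) (Z : set T) : measurable_fun setT f ->
  (forall x, 0 <= f x <= 1)%E ->
  measurable Z -> P Z = 0%E -> (forall x, ~ Z x -> f x = 0%E) -> (\int[P]_x f x = 0)%E.
Proof.
move=> mf f01 mZ PZ fZ; apply/eqP; rewrite eq_le; apply/andP; split; last first.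
  by apply: integral_ge0 => x _; have /andP[] := f01 x.
rewrite -[leRHS]PZ -[P Z]mule1 -[leRHS]/(P Z * 1%:E)%E.
have <- : (\int[P]_x (\1_Z x)%:E = P Z * 1%:E)%E by rewrite integral_indic// setIT mule1.
apply: ge0_le_integral => //.
- by move=> x _; have /andP[] := f01 x.
- by apply/measurable_EFinP; exact: measurable_indic.
move=> x _; rewrite indicE; have [/set_mem Zx|/negP nZx] := boolP (x \in Z).
  by have /andP[] := f01 x.
by rewrite fZ//= => Zx; apply: nZx; exact: mem_set.
Qed.

End null_sets.

Section generic_almost_surely.
Context {R : realType}.

Lemma measurable_gauss_mix (I : finType) (K : pred I) (E : set (vec R I)) : measurable E ->
  measurable_fun setT (fun x => gauss I [set y | E (mix K x y)]).
Proof.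
move=> mE.
pose Z : set (vec R I * vec R I) := [set p | E (mix K p.1 p.2)].
have mm : measurable_fun setT (fun p : vec R I * vec R I => mix K p.1 p.2 : vec R I).
  by apply: measurable_vec => i; case: (@iid_mix R I K) => /(_ i).
have mZ : measurable Z by rewrite -[X in measurable X]setTI; exact: mm.
have := measurable_fun_xsection (gauss I) mZ; congr (measurable_fun _ _).
apply/funext => x; congr (gauss I _).
by apply/seteqP; split => y; rewrite /xsection/= inE.
Qed.

Lemma measurable_mix_section (I : finType) (K : pred I) (E : set (vec R I)) x : measurable E ->
  measurable [set y | E (mix K x y)].
Proof.
by move=> mE; rewrite -[X in measurable X]setTI; exact: (measurable_mix2 K x).
Qed.

(** Fubini's theorem for null sets, in terms of resampling. *)
Lemma gauss_mix_null (I : finType) (K : pred I) (Z Z' : set (vec R I)) :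
  measurable Z -> measurable Z' -> gauss I Z' = 0%E ->
  (forall x, ~ Z' x -> gauss I [set y | Z (mix K x y)] = 0%E) -> gauss I Z = 0%E.
Proof.
move=> mZ mZ' Z'0 h; rewrite (gauss_mix K mZ).
apply: (integral_le_null (measurable_gauss_mix K mZ) _ mZ' Z'0 h) => x.
rewrite measure_ge0/=; apply: probability_le1; exact: measurable_mix_section.
Qed.

Lemma finite_union_null d (T : measurableType d) (P : probability T R) (F : finType)
    (Z : F -> set T) : (forall f, measurable (Z f)) -> (forall f, P (Z f) = 0%E) ->
  P [set x | exists f, Z f x] = 0%E.
Proof.
move=> mZ Z0; rewrite (_ : [set x | _] = \big[setU/set0]_(f : F) Z f); last first.
  apply/seteqP; split => [x [f Zx]|x].
    by rewrite -bigcup_seq; exists f => //=; rewrite mem_index_enum.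
  by rewrite -bigcup_seq => -[f _ Zx]; exists f.
apply/negligibleP; first exact: bigsetU_measurable.
apply: big_ind => [|A B|f _]; [exact: negligible_set0|exact: negligibleU|].
by apply/negligibleP; [exact: mZ|exact: Z0].
Qed.

End generic_almost_surely.

Section generic_points.
Context {R : realType} (s : R) (n N : nat).
Local Notation Ix := (option 'I_n * 'I_N.+1)%type.

Lemma measurable_minor D (f : 'I_D -> 'I_n) :
  measurable_fun setT (fun x : vec R Ix => \det (minor_mx (pts s x) f)).
Proof.
apply: measurable_det => i j.
have -> : (fun x : vec R Ix => minor_mx (pts s x) f i j) = (fun x => pts s x (f i) j).
  by apply/funext => x; rewrite mxE.
exact: measurable_pts.
Qed.

Lemma measurable_minor_null D (f : 'I_D -> 'I_n) :
  measurable [set x : vec R Ix | \det (minor_mx (pts s x) f) = 0].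
Proof.
by rewrite -[X in measurable X]setTI; exact: (measurable_minor f measurableT (measurable_set1 0)).
Qed.

(** Induction on the size. Resampling the point of the last row, the determinant
    is an affine function of it whose linear part contains the previous minor,
    almost surely nonzero. *)
Lemma minor_null D (f : 'I_D -> 'I_n) : (D <= N.+1)%N -> injective f ->
  gauss Ix [set x | \det (minor_mx (pts s x) f) = 0] = 0%E.
Proof.
elim: D f => [|D IHD] f DN finj.
  rewrite (_ : [set x | _] = set0) ?measure0//.
  by apply/seteqP; split => // x /=; rewrite det_mx00 => /eqP; rewrite oner_eq0.
pose i0 := f ord_max; pose K (p : Ix) := p.1 == Some i0.
pose f' (a : 'I_D) := f (widen_ord (leqnSn D) a).
have f'inj : injective f' by move=> a b /finj/(congr1 val)/= /val_inj.
have Z'0 := IHD f' (ltnW DN) f'inj.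
apply: (gauss_mix_null (K := K) (measurable_minor_null _) (measurable_minor_null _) Z'0) => x /= x0.
pose C b := cofactor (minor_mx (pts s x) f) ord_max b.
have Cmax : C ord_max != 0.
  rewrite /C /cofactor mulf_eq0 signr_eq0/=; apply/eqP => h; apply: x0; rewrite -h.
  congr (\det _); apply/matrixP => a b; rewrite !mxE /f'.
  by congr (pts s x (f _) _); [apply: val_inj|]; rewrite /= /bump leqNgt ltn_ord.
(* The determinant is an affine function of the resampled row. *)
pose c (p : Ix) := \sum_(b < D.+1) C b * (p == (Some i0, inord b))%:R.
pose v := \sum_(b < D.+1) s * x (None, inord b) * C b.
rewrite (_ : [set y | _] = [set y | \sum_p c p * y p = v]); last first.
  suff E y : \det (minor_mx (pts s (mix K x y)) f) = \sum_p c p * y p - v.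
    by apply/seteqP; split => y /=; rewrite E;
      [move=> /eqP; rewrite subr_eq0 => /eqP|move=> ->; rewrite subrr].
  rewrite (expand_det_row _ ord_max).
  have -> : \sum_p c p * y p = \sum_(b < D.+1) C b * y (Some i0, inord b).
    under eq_bigr do rewrite /c mulr_suml.
    rewrite exchange_big; apply: eq_bigr => b _ /=.
    rewrite (bigD1 (Some i0, inord b))//= eqxx mulr1 big1 ?addr0// => p /negbTE ->.
    by rewrite mulr0 mul0r.
  rewrite /v -sumrB; apply: eq_bigr => b _.
  have -> : cofactor (minor_mx (pts s (mix K x y)) f) ord_max b = C b.
    rewrite /C /cofactor; congr (_ * \det _); apply/matrixP => a a'; rewrite !mxE.
    rewrite /pts /mix /K/=; case: eqP => // -[] /finj /eqP.
    by rewrite eq_sym (negbTE (neq_lift _ _)).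
  by rewrite !mxE /pts /mix /K/= eqxx; ring.
apply: (@gauss_affine_null _ _ _ _ (Some i0, inord D)).
rewrite /c (bigD1 ord_max)//= eqxx mulr1 big1 ?addr0// => b bmax.
rewrite (_ : (_ == _) = false) ?mulr0//; apply: contraNF bmax => /eqP[].
move=> /(congr1 val); rewrite /= !inordK ?(leq_trans (ltn_ord b))// => /esym h.
by apply/eqP; apply: val_inj.
Qed.

Lemma not_genericE D : [set x : vec R Ix | ~ generic D (pts s x)] =
  [set x | exists f : {ffun 'I_D -> 'I_n}, (if injectiveb f then
     [set x : vec R Ix | \det (minor_mx (pts s x) f) = 0] else set0) x].
Proof.
apply/seteqP; split => x /=.
  move=> /existsNP[f /not_implyP[finj /negP]]; rewrite negbK => /eqP f0.
  exists [ffun a => f a]; case: injectiveP => [_|].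
    rewrite /= -f0; congr (\det _); apply/matrixP => a b.
    by rewrite !mxE ffunE.
  by move=> []; move=> a b; rewrite !ffunE; exact: finj.
move=> [f]; case: injectiveP => // finj /= f0 gen.
by have := gen f finj; rewrite f0 eqxx.
Qed.

Let Zf D (f : {ffun 'I_D -> 'I_n}) : measurable (if injectiveb f then
     [set x : vec R Ix | \det (minor_mx (pts s x) f) = 0] else set0).
Proof. by case: ifP => // _; exact: measurable_minor_null. Qed.

Lemma measurable_not_generic D : measurable [set x : vec R Ix | ~ generic D (pts s x)].
Proof.
rewrite not_genericE.
set Z := (X in [set x | exists f, X f x]).
rewrite (_ : [set x | _] = \bigcup_(f in setT) Z f); last first.
  by apply/seteqP; split => [x [f Zx]|x [f _ Zx]]; exists f.
by apply: fin_bigcup_measurable => // f _; exact: Zf.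
Qed.

Lemma not_generic_null D : (D <= N.+1)%N ->
  gauss Ix [set x | ~ generic D (pts s x)] = 0%E.
Proof.
move=> DN; rewrite not_genericE; apply: finite_union_null => f; first exact: Zf.
by case: injectiveP => [finj|_]; [exact: minor_null|exact: measure0].
Qed.

End generic_points.

(** * Optimal bases in terms of minors *)

Lemma sum_codom (V : nmodType) (I J : finType) (f : J -> I) (F : I -> V) : injective f ->
  (forall i, i \notin codom f -> F i = 0) -> \sum_i F i = \sum_a F (f a).
Proof.
move=> finj F0; rewrite (bigID (mem (codom f)))/= [X in _ + X]big1 ?addr0; last exact: F0.
rewrite -[LHS]big_filter -(big_map f xpredT F)/=; apply: perm_big.
apply: uniq_perm; first by rewrite filter_uniq// index_enum_uniq.
  by rewrite map_inj_uniq// index_enum_uniq.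
move=> i; rewrite mem_filter mem_index_enum andbT.
apply/codomP/mapP => [[a ->]|[a _ ->]]; last by exists a.
by exists a => //; rewrite mem_index_enum.
Qed.

Section basis_solution.
Context {R : realType} {n k : nat}.
Implicit Types (y : 'I_n -> nat -> R) (f : 'I_k.+1 -> 'I_n).

(** Cramer's formula for the dual solution on [S = codom f], multiplied by the
    square of the determinant: a polynomial of the same sign. *)
Definition basis_w y f (a : 'I_k.+1) : R :=
  \det (minor_mx y f) * (\adj (minor_mx y f)) ord_max a.

(** The primal solution that vanishes on [codom f], with the same
    normalisation as [basis_w]. *)
Definition basis_u y f (j : nat) : R :=
  if j == k.+1 then \det (minor_mx y f) ^+ 2
  else - \det (minor_mx y f) * \sum_a (\adj (minor_mx y f)) (inord j) a * y (f a) k.+1.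

Lemma basis_u_tight y f a : dot k.+2 (basis_u y f) (y (f a)) = 0.
Proof.
rewrite dotS {2}/basis_u eqxx /dot; set M := minor_mx y f.
have MA := mul_mx_adj M.
transitivity (- \det M * \sum_a' (M *m \adj M) a a' * y (f a') k.+1 + \det M ^+ 2 * y (f a) k.+1).
  congr (_ + _); rewrite mulr_sumr.
  transitivity (\sum_(b < k.+1) \sum_a' - \det M * (M a b * \adj M b a' * y (f a') k.+1)).
    apply: eq_bigr => b _; rewrite /basis_u ltn_eqF// inord_val mulr_sumr mulr_suml.
    by apply: eq_bigr => a' _; rewrite [M a b]mxE /M; ring.
  rewrite exchange_big; apply: eq_bigr => a' _.
  by rewrite !mxE mulr_suml mulr_sumr.
rewrite MA (bigD1 a)//= big1 ?addr0; last first.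
  by move=> a' /negbTE a'a; rewrite mxE eq_sym a'a mulr0n mul0r.
by rewrite mxE eqxx mulr1n; ring.
Qed.

(** The solutions of [optimal] are determined by their equations; what remains
    are the signs of two families of polynomials. The first family involves only
    the points of [S], and so does the form evaluated in the second. *)
Lemma optimalP y f (S : {set 'I_n}) : injective f -> (forall i, (i \in S) = (i \in codom f)) ->
  generic k.+1 y ->
  optimal k S y <-> (forall a, 0 < basis_w y f a) /\
                    (forall i, i \notin S -> 0 < dot k.+2 (basis_u y f) (y i)).
Proof.
move=> finj Sf gen; set M := minor_mx y f.
have D0 : \det M != 0 by exact: gen.
have D2 : 0 < \det M ^+ 2 by rewrite exprn_even_gt0.
have fS a : f a \in S by rewrite Sf codom_f.
split=> [[u [w [[u1 uS uSc] [wS wSc wy]]]]|[w0 u0]].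
  have wM : (\row_a w (f a)) *m M = row ord_max 1%:M.
    apply/rowP => b; rewrite !mxE; transitivity (\sum_i w i * y i b).
      rewrite (sum_codom finj (F := fun i => w i * y i b)); last first.
        by move=> i; rewrite -Sf => /wSc ->; rewrite mul0r.
      by apply: eq_bigr => a _; rewrite !mxE.
    by rewrite wy// eq_sym.
  have wE a : basis_w y f a = \det M ^+ 2 * w (f a).
    have := congr1 (fun A => (A *m \adj M) 0 a) wM.
    rewrite -mulmxA mul_mx_adj mul_mx_scalar -row_mul mul1mx [LHS]mxE [(\row__ _) _ _]mxE [RHS]mxE => h.
    by rewrite /basis_w -/M -h mulrA expr2.
  have uM : M *m (\col_b u (val b)) = - \col_a y (f a) k.+1.
    apply/colP => a; rewrite !mxE; apply/eqP; rewrite -subr_eq0 opprK; apply/eqP.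
    rewrite -[RHS](uS _ (fS a)) dotS u1 mul1r; congr (_ + _).
    by apply: eq_bigr => b _; rewrite !mxE mulrC.
  have uE j : (j < k.+2)%N -> basis_u y f j = \det M ^+ 2 * u j.
    rewrite ltnS leq_eqVlt /basis_u -/M => /orP[/eqP ->|jk]; first by rewrite eqxx u1 mulr1.
    rewrite (ltn_eqF jk).
    have := congr1 (fun A => (\adj M *m A) (inord j) 0) uM.
    rewrite mulmxA mul_adj_mx mul_scalar_mx [LHS]mxE [(\col__ _) _ _]mxE /= inordK// => h.
    rewrite expr2 -mulrA h mulNr -mulrN mulmxN; congr (_ * _).
    by rewrite [RHS]mxE; congr (- _); rewrite [RHS]mxE; apply: eq_bigr => a _; rewrite [(\col__ _) _ _]mxE.
  split=> [a|i iS]; first by rewrite wE mulr_gt0// wS.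
  rewrite (eq_dot (v := fun j => \det M ^+ 2 * u j) (z := y i))// dotZl.
  by rewrite mulr_gt0// uSc.
exists (fun j => (\det M ^+ 2)^-1 * basis_u y f j).
exists (fun i => if [pick a | f a == i] is Some a then (\det M ^+ 2)^-1 * basis_w y f a else 0).
have pickf a : [pick a' | f a' == f a] = Some a.
  by case: pickP => [a' /eqP/finj ->//|/(_ a)]; rewrite eqxx.
split; split.
- by rewrite /basis_u eqxx mulVf// gt_eqF.
- by move=> i; rewrite Sf => /codomP[a ->]; rewrite dotZl basis_u_tight mulr0.
- by move=> i iS; rewrite dotZl mulr_gt0 ?invr_gt0// u0.
- by move=> i; rewrite Sf => /codomP[a ->]; rewrite pickf mulr_gt0 ?invr_gt0.
- move=> i; rewrite Sf; case: pickP => // a /eqP <-; by rewrite codom_f.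
- move=> j jk; rewrite (sum_codom finj); last first.
    by move=> i iS; case: pickP => [a /eqP fa|]; [rewrite -fa codom_f in iS|rewrite mul0r].
  pose b := Ordinal jk.
  transitivity ((\det M)^-1 * (\adj M *m M) ord_max b).
    rewrite [(_ *m _) _ _]mxE mulr_sumr; apply: eq_bigr => a _.
    by rewrite pickf /basis_w -/M [M a b]mxE; field.
  by rewrite mul_adj_mx mxE mulrnAr mulVf// eq_sym.
Qed.

End basis_solution.

(** * Separating a subset of the points from the others *)

Lemma sum_option (V : nmodType) (I : finType) (F : option I -> V) :
  \sum_o F o = F None + \sum_i F (Some i).
Proof.
rewrite (bigD1 None)//=; congr (_ + _).
rewrite (reindex_omap (Some : I -> _) id)/=; last by case.
by apply: eq_bigl => i; rewrite eqxx.
Qed.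

Section split.
Context {R : realType} (s : R) (n N : nat) (S : {set 'I_n}).
Local Notation Ix := (option 'I_n * 'I_N.+1)%type.
Let m : R := #|S|%:R.
Let t := Num.sqrt (1 + m * s ^+ 2).
Let chi (i : 'I_n) : R := (i \in S)%:R.

Let t0 : 0 < t.
Proof. by rewrite sqrtr_gt0 ltr_pwDl// mulr_ge0 ?ler0n// sqr_ge0. Qed.

Let t2 : t ^+ 2 = 1 + m * s ^+ 2.
Proof. by rewrite sqr_sqrtr// addr_ge0// mulr_ge0 ?ler0n// sqr_ge0. Qed.

Let tn0 : t != 0. Proof. by rewrite gt_eqF. Qed.
Let t1n0 : 1 + t != 0. Proof. by rewrite gt_eqF// addr_gt0. Qed.

Let be := - s ^+ 2 / (t * (1 + t)).

Let beE : be * m = t^-1 - 1.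
Proof.
have -> : be * m = - (m * s ^+ 2) / (t * (1 + t)) by rewrite /be; field; rewrite t1n0 tn0.
have -> : m * s ^+ 2 = t ^+ 2 - 1 by rewrite t2 addrAC subrr add0r.
by field; rewrite t1n0 tn0.
Qed.

Let chi2 i : chi i * chi i = chi i.
Proof. by rewrite /chi -natrM mulnb andbb. Qed.

Let sum_chi : \sum_i chi i = m.
Proof.
rewrite /chi -natr_sum /m -sum1_card [in RHS]big_mkcond /=.
congr (_%:R); apply: eq_bigr => i _; by case: (i \in S).
Qed.

Let q (o o' : option 'I_n) : R :=
  match o, o' with
  | None, None => t^-1
  | None, Some a => - (s / t) * chi a
  | Some i, None => s / t * chi i
  | Some i, Some a => (i == a)%:R + be * chi i * chi a
  end.

Let sum_delta (F : 'I_n -> R) i : \sum_a (i == a)%:R * F a = F i.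
Proof.
rewrite (bigD1 i)//= eqxx mul1r big1 ?addr0// => a.
by rewrite eq_sym => /negbTE ->; rewrite mul0r.
Qed.

Let qE (z : option 'I_n -> R) o : \sum_o' q o o' * z o' =
  if o is Some i then z (Some i) + s / t * chi i * z None + be * chi i * \sum_a chi a * z (Some a)
  else t^-1 * z None - s / t * \sum_a chi a * z (Some a).
Proof.
case: o => [i|]; rewrite sum_option /=; last first.
  congr (_ + _); rewrite -[RHS]mulNr mulr_sumr; apply: eq_bigr => a _.
  by rewrite mulrA.
under eq_bigr do rewrite mulrDl.
rewrite big_split/= sum_delta addrCA addrA; congr (_ + _); rewrite mulr_sumr.
by apply: eq_bigr => a _; rewrite mulrA.
Qed.

Let q_orth o o' : \sum_p q o p * q o' p = (o == o')%:R.
Proof.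
have sumcc c : \sum_a chi a * (c * chi a) = c * m.
  rewrite -sum_chi mulr_sumr; apply: eq_bigr => a _.
  by rewrite mulrCA chi2.
rewrite qE; case: o o' => [i|] [i'|] /=.
- rewrite (inj_eq (@Some_inj _)).
  have -> : \sum_a chi a * ((i' == a)%:R + be * chi i' * chi a) = chi i' + be * chi i' * m.
    under eq_bigr do rewrite mulrDr.
    rewrite big_split/= sumcc; congr (_ + _).
    by under eq_bigr do rewrite mulrC; rewrite sum_delta.
  rewrite [i' == i]eq_sym.
  transitivity ((i == i')%:R + chi i * chi i' * (be + s ^+ 2 / t ^+ 2 + be * (1 + be * m))).
    by field.
  rewrite beE /be (_ : _ + _ * _ = 0) ?mulr0 ?addr0//.
  by field; rewrite t1n0 tn0.
- rewrite sumcc; transitivity (s / t * chi i * (t^-1 - 1 - be * m)); first by field.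
  by rewrite beE subrr mulr0.
- have -> : \sum_a chi a * ((i' == a)%:R + be * chi i' * chi a) = chi i' + be * chi i' * m.
    under eq_bigr do rewrite mulrDr.
    rewrite big_split/= sumcc; congr (_ + _).
    by under eq_bigr do rewrite mulrC; rewrite sum_delta.
  transitivity (s / t * chi i' * (t^-1 - 1 - be * m)); first by field.
  by rewrite beE subrr mulr0.
- rewrite sumcc; transitivity ((1 + m * s ^+ 2) / t ^+ 2); first by field.
  by rewrite -t2 divff// expf_neq0.
Qed.

(** An orthogonal matrix that acts in the same way on every coordinate. With
    [t = Num.sqrt (1 + #|S| s^2)], it mixes [X] and the [X_a], [a] in [S], such
    that [pts] at [S] no longer depends on the coordinate [None], and that the
    points outside [S], corrected by the sum over [S], depend on [None] and
    [Some i] only: see [pts_split_in] and [pts_split_out]. *)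
Definition split_mx (p p' : Ix) : R := (p.2 == p'.2)%:R * q p.1 p'.1.

Let split_mxE (x : Ix -> R) p : \sum_p' split_mx p p' * x p' = \sum_o q p.1 o * x (o, p.2).
Proof.
rewrite (eq_bigr (fun p' => split_mx p (p'.1, p'.2) * x (p'.1, p'.2))); last by case.
rewrite -(pair_bigA _ (fun o j => split_mx p (o, j) * x (o, j)))/=.
apply: eq_bigr => o _; rewrite (bigD1 p.2)//= /split_mx/= eqxx mul1r big1 ?addr0// => j.
by rewrite eq_sym => /negbTE ->; rewrite !mul0r.
Qed.

Lemma split_orth : orthonormal_rows split_mx.
Proof.
move=> p p'; rewrite split_mxE; case: p p' => [oo j] [oo' j'] /=.
under eq_bigr do rewrite /split_mx/= mulrCA.
by rewrite -mulr_sumr q_orth xpair_eqE -natrM mulnb andbC [j' == j]eq_sym.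
Qed.

Definition split_map (x : vec R Ix) : vec R Ix := fun p => \sum_p' split_mx p p' * x p'.

Lemma measurable_split_map : measurable_fun setT split_map.
Proof. by apply: measurable_vec => p; exact: measurable_sum_coord. Qed.

Lemma gauss_split_map (E : set (vec R Ix)) : measurable E ->
  gauss Ix E = gauss Ix [set x | E (split_map x)].
Proof.
by move=> mE; rewrite -(iid_law (orthonormal_keeps_iid split_orth (iid_gauss Ix)) mE).
Qed.

Let ptsE x i j : pts s (split_map x) i j =
  x (Some i, inord j) + (s / t * chi i - s / t) * x (None, inord j) +
  (be * chi i + s ^+ 2 / t) * \sum_a chi a * x (Some a, inord j).
Proof.
rewrite /pts /split_map !split_mxE (qE (fun o => x (o, inord j)) (Some i)).
by rewrite (qE (fun o => x (o, inord j)) None); field.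
Qed.

Lemma pts_split_in x i j : i \in S -> pts s (split_map x) i j =
  x (Some i, inord j) + (be + s ^+ 2 / t) * \sum_a chi a * x (Some a, inord j).
Proof. by move=> iS; rewrite ptsE /chi iS !mulr1 subrr mul0r addr0. Qed.

(** The correction is the conditional expectation of a point given the points of
    [S]. *)
Lemma pts_split_out x i j : i \notin S ->
  pts s (split_map x) i j - s ^+ 2 / (1 + m * s ^+ 2) * \sum_(a in S) pts s (split_map x) a j =
  x (Some i, inord j) - s / t * x (None, inord j).
Proof.
move=> iS; rewrite ptsE {1 2}/chi (negbTE iS) !mulr0 add0r add0r.
set T := \sum_a chi a * _.
have TE : \sum_(a in S) x (Some a, inord j) = T.
  by rewrite big_mkcond; apply: eq_bigr => a _; rewrite /chi; case: ifP; rewrite ?mul1r ?mul0r.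
have -> : \sum_(a in S) pts s (split_map x) a j = t * T.
  rewrite (eq_bigr _ (fun a aS => pts_split_in x j aS)) big_split/= TE sumr_const -mulr_natl -/m.
  have -> : m * ((be + s ^+ 2 / t) * T) = (be * m + m * s ^+ 2 / t) * T by field.
  rewrite beE (_ : m * s ^+ 2 = t ^+ 2 - 1) ?t2 1?addrAC ?subrr ?add0r//.
  by rewrite -t2; field.
by rewrite -t2; field.
Qed.

End split.

Section split_probability.
Context {R : realType} (s : R) (n N D : nat) (S : {set 'I_n}).
Local Notation Ix := (option 'I_n * 'I_N.+1)%type.
Hypothesis DN : (D <= N.+1)%N.
Let r := s ^+ 2 / (1 + #|S|%:R * s ^+ 2).

Let k0 : 0 < 1 + #|S|%:R * s ^+ 2 :> R.
Proof. by rewrite ltr_pwDl// mulr_ge0 ?ler0n// sqr_ge0. Qed.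

Let tau := s / Num.sqrt (1 + #|S|%:R * s ^+ 2).

Let tau2 : tau ^+ 2 = r.
Proof. by rewrite /tau /r expr_div_n sqr_sqrtr// ltW. Qed.

(** Up to a common factor, the values of [U] at the residuals are linear forms
    with Gram matrix [I + r J], whatever [U] is. *)
Lemma residual_probability (U : nat -> R) (j0 : nat) : (j0 < D)%N -> U j0 != 0 ->
  gauss Ix [set y | forall i, i \notin S ->
    0 < dot D U (fun j => y (Some i, inord j) - tau * y (None, inord j))] =
  (g (n - #|S|) r)%:E.
Proof.
move=> j0D Uj0.
pose V (c : 'I_N.+1) := if (c < D)%N then U c else 0.
have VE (z : 'I_N.+1 -> R) : dot D U (fun j => z (inord j)) = \sum_c V c * z c.
  rewrite /dot (big_ord_widen _ (fun j => U j * z (inord j)) DN) big_mkcond/=.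
  by apply: eq_bigr => c _; rewrite /V inord_val; case: ifP => // _; rewrite mul0r.
pose L2 := \sum_c V c ^+ 2.
have L20 : 0 < L2.
  have j0N : (j0 < N.+1)%N := leq_trans j0D DN.
  rewrite /L2 (bigD1 (Ordinal j0N))//= ltr_pwDl ?sumr_ge0// => [|c _].
    by rewrite /V/= j0D exprn_even_gt0.
  exact: sqr_ge0.
pose L := Num.sqrt L2.
have L0 : 0 < L by rewrite sqrtr_gt0.
have Ln0 : L != 0 by rewrite gt_eqF.
have L22 : L ^+ 2 = L2 by rewrite sqr_sqrtr// ltW.
pose J := {i : 'I_n | i \notin S}.
pose h (b : J) (oi : option 'I_n) : R := (oi == Some (val b))%:R - tau * (oi == None)%:R.
pose A (b : J) (p : Ix) := - (V p.2 / L) * h b p.1.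
have hN b : h b None = - tau by rewrite /h /= mulr1 sub0r.
have hS b i : h b (Some i) = (i == val b)%:R.
  by rewrite /h (inj_eq (@Some_inj _)) mulr0 subr0.
have hE (b : J) (z : option 'I_n -> R) : \sum_oi h b oi * z oi = z (Some (val b)) - tau * z None.
  rewrite sum_option hN (bigD1 (val b))//= hS eqxx mul1r big1 ?addr0 => [|i /negbTE ib].
    by rewrite mulNr addrC.
  by rewrite hS ib mul0r.
have AE (b : J) (y : Ix -> R) : \sum_p A b p * y p =
    - L^-1 * dot D U (fun j => y (Some (val b), inord j) - tau * y (None, inord j)).
  rewrite (VE (fun c => y (Some (val b), c) - tau * y (None, c))) mulr_sumr.
  rewrite (eq_bigr (fun p => A b (p.1, p.2) * y (p.1, p.2))); last by case.
  rewrite -(pair_bigA _ (fun oi c => A b (oi, c) * y (oi, c)))/= exchange_big/=.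
  apply: eq_bigr => c _; rewrite -(hE b (fun oi => y (oi, c))) !mulr_sumr.
  by apply: eq_bigr => oi _; rewrite /A/=; ring.
have AA b b' : \sum_p A b p * A b' p = (b == b')%:R + r.
  rewrite (eq_bigr (fun p => A b (p.1, p.2) * A b' (p.1, p.2))); last by case.
  rewrite -(pair_bigA _ (fun oi c => A b (oi, c) * A b' (oi, c)))/= exchange_big/=.
  transitivity (\sum_c V c ^+ 2 / L2 * ((b == b')%:R + r)).
    apply: eq_bigr => c _.
    transitivity (V c ^+ 2 / L2 * \sum_oi h b oi * h b' oi).
      by rewrite mulr_sumr; apply: eq_bigr => oi _; rewrite /A/= -L22; field.
    rewrite hE hN hS (inj_eq val_inj) -tau2; congr (_ * _).
    by rewrite mulrN opprK expr2.
  rewrite -mulr_suml -[X in _ * X]mul1r mulrA -mulr_suml -/L2 divff ?mul1r// gt_eqF//.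
have cJ : #|{: J}| = (n - #|S|)%N.
  by rewrite card_sig -[X in (X - _)%N](card_ord n) -(cardC (mem S)) addKn.
have r0 : 0 <= r by rewrite divr_ge0 ?sqr_ge0// ltW.
rewrite -cJ -(g_family (iid_gauss Ix) AA); last by rewrite ltr_pwDl// mulr_ge0// ler0n.
congr (gauss Ix _); apply/seteqP; split => y /= hy.
  by move=> b; rewrite AE mulNr oppr_lt0 mulr_gt0 ?invr_gt0//; exact: (hy (val b) (valP b)).
move=> i iS; have := hy (exist _ i iS); rewrite AE /= mulNr oppr_lt0.
by rewrite pmulr_rgt0// invr_gt0.
Qed.

Variables (W : ('I_n -> nat -> R) -> Prop) (u : ('I_n -> nat -> R) -> nat -> R).
Hypothesis Wloc : forall y y', (forall i j, i \in S -> y i j = y' i j) -> W y -> W y'.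
Hypothesis uloc : forall y y', (forall i j, i \in S -> y i j = y' i j) -> u y = u y'.
Hypothesis unz : forall y, W y -> exists2 j, (j < D)%N & u y j != 0.
Let E (y : 'I_n -> nat -> R) := W y /\ forall i, i \notin S ->
  0 < dot D (u y) (fun j => y i j - r * \sum_(a in S) y a j).
Hypothesis mW : measurable [set x : vec R Ix | W (pts s x)].
Hypothesis mE : measurable [set x : vec R Ix | E (pts s x)].

(** Given the points of [S], the residuals of the other points are independent
    of them, and the conditional probability that a nonzero form is positive at
    all the residuals does not depend on the form. *)
Lemma split_probability : gauss Ix [set x | E (pts s x)] =
  (gauss Ix [set x | W (pts s x)] * (g (n - #|S|) r)%:E)%E.
Proof.
have msp := @measurable_split_map R s n N S.
rewrite (gauss_split_map s S mE) (gauss_split_map s S mW).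
pose K (p : Ix) := if p.1 is Some i then i \notin S else true.
have mE' : measurable [set x : vec R Ix | E (pts s (split_map s S x))].
  by rewrite -[X in measurable X]setTI; exact: (msp measurableT _ mE).
have mW' : measurable [set x : vec R Ix | W (pts s (split_map s S x))].
  by rewrite -[X in measurable X]setTI; exact: (msp measurableT _ mW).
rewrite (gauss_mix K mE').
pose W' := [set x : vec R Ix | W (pts s (split_map s S x))].
transitivity (\int[gauss Ix]_x ((g (n - #|S|) r)%:E * (\1_W' x)%:E))%E; last first.
  rewrite integralZl//; last first.
    exact: integrable_indic.
  by rewrite integral_indic// setIT muleC.
apply: eq_integral => x _.
have inS y i j : i \in S -> pts s (split_map s S (mix K x y)) i j = pts s (split_map s S x) i j.
  move=> iS; rewrite !pts_split_in// /mix /K/= iS/=; congr (_ + _ * _).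
  by apply: eq_bigr => a _; case: (a \in S) => //=; rewrite !mul0r.
have inS' y i j : i \in S -> pts s (split_map s S x) i j = pts s (split_map s S (mix K x y)) i j.
  by move=> iS; rewrite inS.
rewrite indicE; have [/set_mem Wx|/negP nWx] := boolP (x \in W'); last first.
  rewrite mule0 (_ : [set y | _] = set0) ?measure0//.
  apply/seteqP; split => // y /= [Wy _]; apply: nWx; apply: mem_set.
  exact: Wloc (inS y) Wy.
rewrite mule1; have [j0 j0D Uj0] := unz Wx.
rewrite -(residual_probability j0D Uj0); congr (gauss Ix _).
have uE y : u (pts s (split_map s S (mix K x y))) = u (pts s (split_map s S x)).
  exact: uloc (inS y).
have rE y i : i \notin S -> dot D (u (pts s (split_map s S x)))
     (fun j => pts s (split_map s S (mix K x y)) i j -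
       r * \sum_(a in S) pts s (split_map s S (mix K x y)) a j) =
   dot D (u (pts s (split_map s S x))) (fun j => y (Some i, inord j) - tau * y (None, inord j)).
  move=> iS; apply: eq_dot => // j _; rewrite pts_split_out//.
  by rewrite /mix /K/= iS.
apply/seteqP; split => y /=.
  by move=> [_ h] i iS; have := h i iS; rewrite uE rE.
move=> h; split; first exact: Wloc (inS' y) Wx.
by move=> i iS; rewrite uE rE//; exact: h.
Qed.

End split_probability.

(** * Probabilities of separating forms *)

Section partition_probability.
Context {R : realType} d (T : measurableType d) (P : probability T R).

Lemma probability_diff_null (A Z : set T) : measurable A -> measurable Z -> P Z = 0%E ->
  P (A `\` Z) = P A.
Proof.
move=> mA mZ Z0; have AZ0 : P (A `&` Z) = 0%E.
  apply/eqP; rewrite eq_le measure_ge0 andbT -Z0.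
  by apply: le_measure; rewrite ?inE//; exact: measurableI.
transitivity (P (A `\` Z) + P (A `&` Z))%E; first by rewrite AZ0 adde0.
by apply/esym; exact: measureDI.
Qed.

Lemma partition_probability (F : finType) (A : F -> set T) (V Z : set T) :
  (forall f, measurable (A f)) -> measurable V -> measurable Z -> P Z = 0%E ->
  (forall x, ~ Z x -> V x <-> exists f, A f x) ->
  (forall x f f', ~ Z x -> A f x -> A f' x -> f = f') ->
  P V = (\sum_f P (A f))%E.
Proof.
move=> mA mV mZ Z0 VA AA.
rewrite -(probability_diff_null mV mZ Z0).
rewrite (_ : V `\` Z = \bigcup_(f in setT) (A f `\` Z)); last first.
  apply/seteqP; split => [x [Vx nZ]|x [f _ [Ax nZ]]].
    by have [f Ax] := (VA x nZ).1 Vx; exists f.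
  by split => //; apply/(VA x nZ); exists f.
rewrite measure_fin_bigcup//; last by move=> f _; exact: measurableD.
  rewrite (fsbigE (index_enum F)) ?index_enum_uniq//; last by move=> f _; rewrite mem_index_enum.
  rewrite /= (eq_bigl xpredT) => [|f]; last by rewrite in_setT.
  by apply: eq_bigr => f _; exact: probability_diff_null.
  exact: finite_finset.
by move=> f f' _ _ [x [[Ax nZ] [Ax' _]]]; exact: (AA x).
Qed.

End partition_probability.

Section basis_probability.
Context {R : realType} (s : R).

(** The covariance between the residuals of two points outside a set of [k]
    points, at each coordinate. *)
Definition rho (k : nat) : R := s ^+ 2 / (1 + k%:R * s ^+ 2).

Section basis.
Variables (n N k : nat).
Local Notation Ix := (option 'I_n * 'I_N.+1)%type.

(** The part of optimality that concerns the points of the basis: the last unit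
    vector is a positive combination of them in the first [k.+1] coordinates. *)
Definition basis_event (f : 'I_k.+1 -> 'I_n) : set (vec R Ix) :=
  [set x | forall a, 0 < basis_w (pts s x) f a].

Lemma measurable_basis_w (f : 'I_k.+1 -> 'I_n) a :
  measurable_fun setT (fun x : vec R Ix => basis_w (pts s x) f a).
Proof.
apply: measurable_funM; first exact: measurable_minor.
have -> : (fun x : vec R Ix => (\adj (minor_mx (pts s x) f)) ord_max a) =
   (fun x => cofactor (minor_mx (pts s x) f) a ord_max) by apply/funext => x; rewrite mxE.
apply: measurable_funM => //; apply: measurable_det => i j.
have -> : (fun x : vec R Ix => row' a (col' ord_max (minor_mx (pts s x) f)) i j) =
  (fun x => pts s x (f (lift a i)) (lift ord_max j)) by apply/funext => x; rewrite !mxE.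
exact: measurable_pts.
Qed.

Lemma measurable_basis_event f : measurable (basis_event f).
Proof. by apply: measurable_forall_gt0 => a; exact: measurable_basis_w. Qed.

End basis.

Arguments basis_event {n} N {k} f.

(** The probability of [basis_event]; its value is found in [basis_probE] only.
    The case 0 is a convention that makes [face_term] uniform. *)
Definition basis_prob (k : nat) : R :=
  if k is k'.+1 then fine (gauss _ (@basis_event k'.+1 k' k' id)) else 1.

(** The event depends on [k.+1] points and [k.+1] coordinates only. *)
Lemma basis_event_prob n N k (f : 'I_k.+1 -> 'I_n) : (k <= N)%N -> injective f ->
  gauss _ (basis_event N f) = (basis_prob k.+1)%:E.
Proof.
move=> kN finj; rewrite /basis_prob fineK; last first.
  by apply: fin_num_measure; exact: measurable_basis_event.
have kN1 : (k.+1 <= N.+1)%N by [].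
pose gg (p : option 'I_k.+1 * 'I_k.+1) : option 'I_n * 'I_N.+1 :=
  (omap f p.1, widen_ord kN1 p.2).
have ginj : injective gg.
  move=> [[a|] b] [[a'|] b'] //= [].
    by move=> /finj -> bb; congr pair; apply: val_inj.
  by move=> bb; congr pair; apply: val_inj.
rewrite -(iid_law (iid_sub ginj (iid_gauss _)) (measurable_basis_event (n := k.+1) id)).
congr (gauss _ _); apply/seteqP.
suff E x : minor_mx (pts s x) f = minor_mx (pts s (fun p => x (gg p))) id.
  by split => x /= h a; have := h a; rewrite /basis_w E.
apply/matrixP => a b; rewrite !mxE /pts /gg /=; congr (x (_, _) - _ * x (_, _)).
  by apply: val_inj; rewrite /= !inordK// (leq_trans (ltn_ord b)).
by apply: val_inj; rewrite /= !inordK// (leq_trans (ltn_ord b)).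
Qed.

Section optimal_probability.
Variables (n N k : nat).
Hypotheses (kN : (k.+1 <= N)%N).
Local Notation Ix := (option 'I_n * 'I_N.+1)%type.

Definition opt_event (S : {set 'I_n}) (f : 'I_k.+1 -> 'I_n) : set (vec R Ix) :=
  [set x | (forall a, 0 < basis_w (pts s x) f a) /\
           (forall i, i \notin S -> 0 < dot k.+2 (basis_u (pts s x) f) (pts s x i))].

Lemma measurable_basis_u (f : 'I_k.+1 -> 'I_n) j :
  measurable_fun setT (fun x : vec R Ix => basis_u (pts s x) f j).
Proof.
have md := @measurable_minor R s n N _ f.
rewrite /basis_u; case: eqP => _; first exact: measurable_funX.
apply: measurable_funM; first exact: measurableT_comp.
apply: measurable_sum => a; apply: measurable_funM; last exact: measurable_pts.
have -> : (fun x : vec R Ix => (\adj (minor_mx (pts s x) f)) (inord j) a) =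
   (fun x => cofactor (minor_mx (pts s x) f) a (inord j)) by apply/funext => x; rewrite mxE.
apply: measurable_funM => //; apply: measurable_det => i i'.
have -> : (fun x : vec R Ix => row' a (col' (inord j) (minor_mx (pts s x) f)) i i') =
  (fun x => pts s x (f (lift a i)) (lift (inord j) i')) by apply/funext => x; rewrite !mxE.
exact: measurable_pts.
Qed.

Lemma measurable_dot (u : vec R Ix -> nat -> R) (z : vec R Ix -> nat -> R) D :
  (forall j, measurable_fun setT (u ^~ j)) -> (forall j, measurable_fun setT (z ^~ j)) ->
  measurable_fun setT (fun x => dot D (u x) (z x)).
Proof. by move=> mu mz; apply: measurable_sum => j; exact: measurable_funM. Qed.

Lemma measurable_opt_event S f : measurable (opt_event S f).
Proof.
apply: measurableI; first exact: measurable_basis_event.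
rewrite [X in measurable X](_ : _ = \bigcap_(i in [set i | i \notin S])
    [set x | 0 < dot k.+2 (basis_u (pts s x) f) (pts s x i)]).
  apply: fin_bigcap_measurable => // i _.
  rewrite (_ : [set x | _] = (fun x => dot k.+2 (basis_u (pts s x) f) (pts s x i)) @^-1` `]0, +oo[).
    rewrite -[X in measurable X]setTI; apply: measurable_dot => // j.
      exact: measurable_basis_u.
    exact: measurable_pts.
  by apply/seteqP; split => x /=; rewrite in_itv/= andbT.
by apply/seteqP; split => x /= h i; exact: h.
Qed.

(** The optimal form vanishes on [S]; hence its values outside [S] are also its
    values at the residuals, and [split_probability] applies. *)
Lemma opt_event_prob (S : {set 'I_n}) (f : 'I_k.+1 -> 'I_n) :
  injective f -> (forall i, (i \in S) = (i \in codom f)) ->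
  gauss Ix (opt_event S f) = (basis_prob k.+1 * g (n - k.+1) (rho k.+1))%:E.
Proof.
move=> finj Sf.
have cS : #|S| = k.+1.
  by rewrite (eq_card Sf) card_codom// card_ord.
have fS a : f a \in S by rewrite Sf codom_f.
pose W (y : 'I_n -> nat -> R) := forall a, 0 < basis_w y f a.
pose u (y : 'I_n -> nat -> R) := basis_u y f.
have EE x : opt_event S f x <-> W (pts s x) /\ forall i, i \notin S ->
    0 < dot k.+2 (u (pts s x)) (fun j => pts s x i j -
       s ^+ 2 / (1 + #|S|%:R * s ^+ 2) * \sum_(a in S) pts s x a j).
  rewrite /opt_event /=; suff h i : dot k.+2 (u (pts s x)) (fun j => pts s x i j -
       s ^+ 2 / (1 + #|S|%:R * s ^+ 2) * \sum_(a in S) pts s x a j) =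
       dot k.+2 (basis_u (pts s x) f) (pts s x i).
    by split=> -[h1 h2]; split => // i iS; have := h2 i iS; rewrite h.
  set c := _ / _; rewrite (eq_dot (v := u (pts s x))
    (z := fun j => pts s x i j + (- c) * \sum_a (a \in S)%:R * pts s x a j))//; last first.
    move=> j _; rewrite mulNr; congr (_ - _ * _); rewrite big_mkcond; apply: eq_bigr => a _.
    by case: (a \in S); rewrite ?mul1r ?mul0r.
  rewrite dotDr dotZr dot_sumr [X in _ + _ * X]big1 ?mulr0 ?addr0// => a _.
  have [|_] := boolP (a \in S); last by rewrite mul0r.
  by rewrite Sf => /codomP[b ->]; rewrite basis_u_tight mulr0.
have mloc (y y' : 'I_n -> nat -> R) :
    (forall i j, i \in S -> y i j = y' i j) -> minor_mx y f = minor_mx y' f.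
  by move=> yy; apply/matrixP => a b; rewrite !mxE yy.
have Eset : opt_event S f = [set x | W (pts s x) /\ forall i, i \notin S ->
    0 < dot k.+2 (u (pts s x)) (fun j => pts s x i j -
       s ^+ 2 / (1 + #|S|%:R * s ^+ 2) * \sum_(a in S) pts s x a j)].
  by apply/seteqP; split => x; [move/(EE x).1|move/(EE x).2].
rewrite Eset (@split_probability R s n N k.+2 S kN W u).
- by rewrite cS EFinM -(basis_event_prob (N := N) (ltnW kN) finj).
- by move=> y y' yy Wy a; have := Wy a; rewrite /basis_w (mloc _ _ yy).
- move=> y y' yy; apply/funext => j; rewrite /u /basis_u (mloc _ _ yy); case: ifP => // _.
  by congr (_ * _); apply: eq_bigr => a _; rewrite yy.
- move=> y Wy; exists k.+1 => //; rewrite /u /basis_u eqxx expf_neq0//.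
  by apply/eqP => h0; have := Wy ord0; rewrite /basis_w h0 mul0r ltxx.
- exact: measurable_basis_event.
- by rewrite -Eset; exact: measurable_opt_event.
Qed.

End optimal_probability.
End basis_probability.

Lemma enum_basis n k (i0 : 'I_n) (S : {set 'I_n}) : #|S| = k.+1 ->
  let f := fun a : 'I_k.+1 => nth i0 (enum S) a in
  injective f /\ forall i, (i \in S) = (i \in codom f).
Proof.
move=> cS f; have sz : size (enum S) = k.+1 by rewrite -cardE.
split=> [a a'|i].
  by move/eqP; rewrite nth_uniq ?sz ?enum_uniq// => /eqP/val_inj.
apply/idP/codomP => [iS|[a ->]]; last by rewrite -mem_enum mem_nth// sz.
move: iS; rewrite -mem_enum => /(nthP i0)[a]; rewrite sz => ak <-.
by exists (Ordinal ak).
Qed.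

Lemma probability_eq_off_null {R : realType} d (T : measurableType d) (P : probability T R)
    (A B Z : set T) : measurable Z -> measurable A -> measurable B -> P Z = 0%E ->
  (forall x, ~ Z x -> A x <-> B x) -> P A = P B.
Proof.
move=> mZ mA mB Z0 AB.
rewrite -(probability_diff_null mA mZ Z0) -(probability_diff_null mB mZ Z0).
by congr (P _); apply/seteqP; split => x [h nZ]; split => //; exact/(AB x nZ).
Qed.

Section hitting_probabilities.
Context {R : realType} (s : R) (n N : nat).
Hypothesis nN : (n <= N)%N.
Local Notation Ix := (option 'I_n * 'I_N.+1)%type.
Local Notation Y := (@pts R s n N).

(** This is [b n k (s ^+ 2)], as [face_term_b] shows from [basis_probE]. *)
Definition face_term (k : nat) : R := 'C(n, k)%:R * (basis_prob s k * g (n - k) (rho s k)).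

Lemma measurable_hitU_pts D : measurable [set x : vec R Ix | hitU D (Y x)].
Proof. by apply: measurable_hitU => i j; exact: measurable_pts. Qed.

Lemma measurable_hitL_pts D : measurable [set x : vec R Ix | hitL D (Y x)].
Proof. by apply: measurable_hitL => i j; exact: measurable_pts. Qed.

Lemma measurable_hit_pts D : measurable [set x : vec R Ix | hit D (Y x)].
Proof. by apply: measurable_hit => i j; exact: measurable_pts. Qed.

(** Almost surely there is exactly one optimal basis, and the bases are
    equiprobable. *)
Lemma leaves_prob k : (k.+1 <= n)%N ->
  gauss Ix [set x | leaves k (Y x)] = (face_term k.+1)%:E.
Proof.
move=> kn; pose i0 := Ordinal (leq_trans (ltn0Sn k) kn).
pose f (S : {set 'I_n}) (a : 'I_k.+1) := nth i0 (enum S) a.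
pose A (S : {set 'I_n}) := if #|S| == k.+1 then @opt_event R s n N k S (f S) else set0.
pose Z := [set x : vec R Ix | ~ generic k (Y x)] `|`
  [set x | ~ generic k.+1 (Y x)] `|` [set x | ~ generic k.+2 (Y x)].
have mZ : measurable Z by apply: measurableU; [apply: measurableU|]; exact: measurable_not_generic.
have kN : (k.+1 <= N)%N := leq_trans kn nN.
have Z0 : gauss Ix Z = 0%E.
  have ng D : (D <= k.+2)%N -> gauss Ix [set x | ~ generic D (Y x)] = 0%E.
    by move=> Dk; apply: not_generic_null; exact: leq_trans Dk _.
  have mg := @measurable_not_generic R s n N.
  by rewrite /Z !measureU0; do ?[exact: mg|apply: measurableU|apply: ng; by [|exact: leqW]].
have AP x S : A S x <-> #|S| = k.+1 /\ opt_event s S (f S) x.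
  by rewrite /A; case: eqP => h; split=> // -[].
transitivity (\sum_S gauss Ix (A S))%E; last first.
  rewrite (eq_bigr (fun S : {set 'I_n} =>
      (if #|S| == k.+1 then basis_prob s k.+1 * g (n - k.+1) (rho s k.+1) else 0)%:E)).
    rewrite sumEFin -big_mkcond sumr_const; congr (_%:E).
    rewrite /face_term [RHS]mulr_natl; congr (_ *+ _).
    by rewrite -[n in RHS]card_ord -card_draws cardsE.
  move=> S _; rewrite /A; case: eqP => [cS|_]; last by rewrite measure0.
  by have [fi Sf] := enum_basis i0 cS; exact: opt_event_prob.
apply: (@partition_probability _ _ _ (gauss Ix) _ A _ Z) => //.
- by move=> S; rewrite /A; case: ifP => // _; exact: measurable_opt_event.
- rewrite (_ : [set x | _] = [set x | hitU k.+1 (Y x)] `\` [set x | hitL k (Y x)])//.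
  by apply: measurableD; [exact: measurable_hitU_pts|exact: measurable_hitL_pts].
- move=> x /not_orP[/not_orP[/contrapT g0 /contrapT g1] /contrapT g2]; split.
    move=> /(leaves_optimal kn g0 g1 g2)[S [cS oS]]; exists S; apply/AP; split => //.
    by have [fi Sf] := enum_basis i0 cS; exact/(optimalP fi Sf g1).
  move=> [S /AP[cS oS]]; apply: (optimal_leaves kn cS g1).
  by have [fi Sf] := enum_basis i0 cS; exact/(optimalP fi Sf g1).
- move=> x S S' /not_orP[/not_orP[_ /contrapT g1] _] /AP[cS oS] /AP[cS' oS'].
  have [fi Sf] := enum_basis i0 cS; have [fi' Sf'] := enum_basis i0 cS'.
  by apply: (@optimal_unique _ _ k S S' (Y x)); [exact/(optimalP fi Sf g1)|exact/(optimalP fi' Sf' g1)].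
Qed.

(** Changing the sign of the last coordinate of all the vectors exchanges the two
    events. *)
Lemma hitL_prob k : (k <= N)%N ->
  gauss Ix [set x | hitL k (Y x)] = gauss Ix [set x | hitU k (Y x)].
Proof.
move=> kN; pose sg (p : Ix) : R := if p.2 == inord k then - 1 else 1.
have sg2 p : sg p ^+ 2 = 1 by rewrite /sg; case: ifP => _; rewrite ?sqrrN expr1n.
rewrite -(iid_law (iid_sign sg2 (iid_gauss Ix)) (measurable_hitL_pts k)).
congr (gauss Ix _).
have YE x i j : (j < k.+1)%N ->
    Y (fun p => sg p * x p) i j = (if j == k then - 1 else 1) * Y x i j.
  move=> jk; rewrite /pts /sg /= -val_eqE /= !inordK ?ltnS// ?(leq_trans _ kN)//.
  by case: ifP => _; rewrite ?mul1r// !mulN1r; ring.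
pose fl (u : nat -> R) j := (if j == k then - 1 else 1) * u j.
have dfl u x i : dot k.+1 u (Y (fun p => sg p * x p) i) = dot k.+1 (fl u) (Y x i).
  by apply: eq_bigr => j _; rewrite YE// /fl mulrCA mulrA.
have flfl u x i : dot k.+1 (fl (fl u)) (Y x i) = dot k.+1 u (Y x i).
  by apply: eq_bigr => j _; rewrite /fl; case: ifP => _; rewrite ?mulN1r ?opprK ?mul1r.
apply/seteqP; split => x /= [u [u0 ux]]; exists (fl u); rewrite {1}/fl eqxx mulN1r.
  by split; [rewrite oppr_gt0|move=> i; rewrite -dfl].
by split; [rewrite oppr_lt0|move=> i; rewrite dfl flfl].
Qed.

Lemma hitU_step k : (k.+1 <= n)%N ->
  gauss Ix [set x | hitU k.+1 (Y x)] =
  (gauss Ix [set x | hitU k (Y x)] + (face_term k.+1)%:E)%E.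
Proof.
move=> kn; rewrite -leaves_prob// -(hitL_prob (leq_trans (ltnW kn) nN)).
rewrite -measureU//.
- congr (gauss Ix _); apply/seteqP; split => x /=.
    by move=> hu; have [hl|hl] := pselect (hitL k (Y x)); [left|right].
  by case=> [/hitL_hitU|[]].
- exact: measurable_hitL_pts.
- rewrite (_ : [set x | leaves _ _] = [set x | hitU k.+1 (Y x)] `\` [set x | hitL k (Y x)])//.
  by apply: measurableD; [exact: measurable_hitU_pts|exact: measurable_hitL_pts].
- by apply/seteqP; split => // x [/= hl [_]].
Qed.

(** In dimension one, no linear programming: all the points are positive. *)
Lemma hitU0_prob : gauss Ix [set x | hitU 0 (Y x)] = (face_term 0)%:E.
Proof.
rewrite /face_term bin0 mul1r mul1r subn0.
have := @residual_probability R s n N 1 finset.set0 (ltn0Sn N) (fun _ => 1) 0 (ltn0Sn 0) (oner_neq0 _).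
rewrite cards0 mul0r addr0 sqrtr1 !divr1 subn0 /rho mul0r addr0 divr1 => <-.
congr (gauss Ix _); apply/seteqP; split => x /=.
  move=> [u [u0 ux]] i _; have := ux i; rewrite /dot !big_ord_recl !big_ord0 !addr0 mul1r.
  by rewrite pmulr_rgt0.
by move=> h; exists (fun _ => 1); split => // i; apply: h; rewrite inE.
Qed.

Lemma hitU_prob D : (D <= n)%N ->
  gauss Ix [set x | hitU D (Y x)] = (\sum_(k < D.+1) face_term k)%:E.
Proof.
elim: D => [|D IHD] Dn; first by rewrite hitU0_prob big_ord_recl big_ord0 addr0.
by rewrite hitU_step// IHD ?(ltnW Dn)// [in RHS]big_ord_recr/= EFinD.
Qed.

(** Points in general position are separated as soon as the dimension exceeds
    their number. *)
Lemma face_term_sum : \sum_(k < n.+1) face_term k = 1.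
Proof.
apply: EFin_inj; rewrite -hitU_prob// -[RHS](@probability_setT _ _ _ (gauss Ix)).
apply: (@probability_eq_off_null _ _ (vec R Ix) (gauss Ix) _ _ _ (@measurable_not_generic R s n N n)) => //.
- exact: measurable_hitU_pts.
- exact: not_generic_null (leqW nN).
- by move=> x /contrapT/generic_hitU h; split.
Qed.

(** Inclusion-exclusion for [hitU] and [hitL], which have the same
    probability. *)
Lemma hit_step D : (D <= N)%N ->
  (gauss Ix [set x | hit D.+1 (Y x)] + gauss Ix [set x | hit D (Y x)] =
   gauss Ix [set x | hitU D (Y x)] + gauss Ix [set x | hitU D (Y x)])%E.
Proof.
move=> DN; have mU := measurable_hitU_pts D; have mL := measurable_hitL_pts D.
have -> : [set x | hit D.+1 (Y x)] = [set x : vec R Ix | hitU D (Y x)] `|`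
    ([set x | hitL D (Y x)] `\` [set x | hitU D (Y x)]).
  apply/seteqP; split => x /=; last by move=> [h|[h _]]; apply/hitS; [left|right].
  by move=> /hitS[?|?]; [left|have [?|?] := pselect (hitU D (Y x)); [left|right]].
have -> : [set x | hit D (Y x)] = [set x | hitL D (Y x)] `&` [set x | hitU D (Y x)].
  apply/seteqP; split => x /=; first by move=> /hit_hitUL[].
  by move=> [? ?]; exact: hitUL_hit.
transitivity (gauss Ix [set x | hitU D (Y x)] +
  (gauss Ix ([set x | hitL D (Y x)] `\` [set x | hitU D (Y x)]) +
   gauss Ix ([set x | hitL D (Y x)] `&` [set x | hitU D (Y x)])))%E.
  rewrite addeA; congr (_ + _)%E; apply: measureU => //; first exact: measurableD.
  by apply/seteqP; split => // x [/= hu [_]].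
by congr (_ + _)%E; rewrite -[RHS](hitL_prob DN); apply/esym; exact: measureDI.
Qed.

Lemma hit0_prob : (0 < n)%N -> gauss Ix [set x | hit 0 (Y x)] = 0%E.
Proof.
move=> n0; rewrite (_ : [set x | _] = set0) ?measure0//.
apply/seteqP; split => // x [u /(_ (Ordinal n0))].
by rewrite /dot big_ord0 ltxx.
Qed.

Lemma hit_prob_step D : (D <= n)%N ->
  fine (gauss Ix [set x | hit D.+1 (Y x)]) + fine (gauss Ix [set x | hit D (Y x)]) =
  2 * \sum_(k < D.+1) face_term k.
Proof.
move=> Dn; apply: EFin_inj; rewrite EFinD !fineK ?fin_num_measure//;
  do ?exact: measurable_hit_pts.
by rewrite hit_step ?(leq_trans Dn)// hitU_prob// -EFinD mulr_natl mulr2n.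
Qed.

End hitting_probabilities.

(** * The complementarity partition *)

Lemma sum_option_ord1 (V : nmodType) n (F : option 'I_n * 'I_1 -> V) :
  \sum_p F p = F (None, ord0) + \sum_(i < n) F (Some i, ord0).
Proof.
rewrite (eq_bigr (fun p => F (p.1, p.2))); last by case.
rewrite -(pair_bigA _ (fun i j => F (i, j)))/= sum_option big_ord_recl big_ord0 addr0.
by congr (_ + _); apply: eq_bigr => i _; rewrite big_ord_recl big_ord0 addr0.
Qed.

Section complementarity.
Context {R : realType} {n : nat}.
Implicit Types (S : {set 'I_n}) (y : 'I_n -> R) (s : R).

(** The solution [t] of [t = - s^2 * \sum_(i in S) (y i + t)]. *)
Definition shift s S y : R := - (rho s #|S| * \sum_(a in S) y a).

(** The signs of the [y i + t] are those prescribed by [S]; in other words [t]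
    solves the piecewise linear equation where the sum runs over the [i] such
    that [y i + t < 0]. *)
Definition splits s S y :=
  (forall i, i \in S -> y i + shift s S y < 0) /\
  (forall i, i \notin S -> 0 < y i + shift s S y).

Lemma den_gt0 s (k : nat) : 0 < 1 + k%:R * s ^+ 2 :> R.
Proof. by rewrite ltr_pwDl// mulr_ge0 ?ler0n// sqr_ge0. Qed.

Lemma shift_balance s S y t :
  t + s ^+ 2 * \sum_(i in S) (y i + t) = (1 + #|S|%:R * s ^+ 2) * (t - shift s S y).
Proof.
rewrite big_split/= sumr_const -mulr_natl /shift /rho.
by field; rewrite gt_eqF// den_gt0.
Qed.

Lemma shift_fixpoint s S y :
  shift s S y = - (s ^+ 2 * \sum_(i in S) (y i + shift s S y)).
Proof. by apply/eqP; rewrite -subr_eq0 opprK shift_balance subrr mulr0. Qed.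

(** The equation has a single solution since its right-hand side decreases with
    [t]. *)
Lemma splits_unique s S S' y : splits s S y -> splits s S' y -> S = S'.
Proof.
wlog tt : S S' / shift s S y <= shift s S' y => [wl|].
  have [tt|/ltW tt] := leP (shift s S y) (shift s S' y); first exact: wl.
  by move=> h h'; apply/esym; exact: wl.
move=> [hS hSc] [hS' hSc'].
have sub i : i \in S' -> i \in S.
  move=> iS'; apply/negPn/negP => /hSc; rewrite ltNge => /negP; apply.
  by rewrite (le_trans _ (ltW (hS' _ iS')))// lerD2l.
have t't : shift s S' y <= shift s S y.
  rewrite [leLHS]shift_fixpoint [leRHS]shift_fixpoint lerN2 ler_wpM2l ?sqr_ge0//.
  rewrite big_mkcond [leRHS]big_mkcond/=; apply: ler_sum => i _.
  have [iS'|iS'] := boolP (i \in S'); first by rewrite (sub _ iS') lerD2l.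
  by case: ifPn => // /hS/ltW.
have E : shift s S y = shift s S' y by apply/eqP; rewrite eq_le tt.
apply/setP => i; apply/idP/idP; last exact: sub.
move=> iS; apply/negPn/negP => /hSc'; rewrite -E ltNge => /negP; apply.
exact: ltW (hS _ iS).
Qed.

(** The right-hand side of the equation is the maximum over [S] of affine
    functions of [t], so the solution is the largest of all shifts: adding an
    element to a maximizing [S], or removing one, does not increase the shift,
    which gives the signs. *)
Lemma splits_exists s y : (forall S i, y i + shift s S y != 0) -> exists S, splits s S y.
Proof.
move=> nz.
(* If [s = 0], all shifts are zero and maximality gives no information. *)
have [->|s0] := eqVneq s 0.
  exists [set i | y i < 0]%SET.
  rewrite /splits; have -> : shift 0 [set i | y i < 0]%SET y = 0 by rewrite /shift /rho expr0n/= !mul0r oppr0.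
  split=> i; rewrite inE addr0// -leNgt le_eqVlt => /orP[/eqP yi|//].
  by have := nz finset.set0 i; rewrite -yi /shift big_set0 mulr0 oppr0 addr0 eqxx.
have s2 : 0 < s ^+ 2 by rewrite exprn_even_gt0.
have [S _ maxS] := @Order.TotalTheory.arg_maxP _ _ _ (finset.set0 : {set 'I_n}) xpredT
  (fun S => shift s S y) isT.
have key (T : {set 'I_n}) :
    0 <= s ^+ 2 * (\sum_(i in T) (y i + shift s S y) - \sum_(i in S) (y i + shift s S y)).
  have : 0 <= shift s S y + s ^+ 2 * \sum_(i in T) (y i + shift s S y).
    by rewrite (shift_balance s T y) mulr_ge0 ?(ltW (den_gt0 _ _))// subr_ge0; exact: maxS.
  by rewrite [X in X + _]shift_fixpoint mulrBr addrC.
exists S; split=> i iS; rewrite lt_neqAle ?nz /=.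
  have := key (S :\ i)%SET; rewrite (big_setD1 i iS)/= pmulr_rge0//.
  lra.
have := key (i |: S)%SET; rewrite (big_setU1 i iS)/= pmulr_rge0//.
rewrite eq_sym nz/=; lra.
Qed.

End complementarity.

Section complementarity_probability.
Context {R : realType} (s : R) (n : nat).
Local Notation Ix := (option 'I_n * 'I_1)%type.
Local Notation Y := (@pts R s n 0).
Implicit Types (S : {set 'I_n}).

(** The linear form [y i + shift s S y] in terms of the Gaussian coordinates. *)
Definition shifted_form S (i : 'I_n) (p : Ix) : R :=
  if p.1 is Some j then (j == i)%:R - rho s #|S| * (j \in S)%:R
  else - s / (1 + #|S|%:R * s ^+ 2).

Lemma shifted_formE S i (x : vec R Ix) :
  \sum_p shifted_form S i p * x p = Y x i 0 + shift s S (fun a => Y x a 0).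
Proof.
have io : inord 0 = ord0 :> 'I_1 by apply: val_inj; rewrite /= inordK.
rewrite sum_option_ord1; under eq_bigr do rewrite /shifted_form/= mulrBl.
rewrite /shifted_form/= big_split/= sumrN (bigD1 i)//= eqxx mul1r big1 ?addr0; last first.
  by move=> j /negbTE ->; rewrite mul0r.
rewrite /shift /pts io.
rewrite (_ : \sum_(a in S) _ = \sum_(a in S) x (Some a, ord0) - #|S|%:R * (s * x (None, ord0))); last first.
  by rewrite big_split/= sumrN sumr_const mulr_natl.
rewrite (_ : \sum_j _ = rho s #|S| * \sum_(a in S) x (Some a, ord0)); last first.
  rewrite mulr_sumr [RHS]big_mkcond; apply: eq_bigr => a _.
  by case: ifP; rewrite ?mulr1// mulr0 mul0r.
by rewrite /rho; field; rewrite gt_eqF// den_gt0.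
Qed.

Lemma shifted_form_gram S a a' : a \in S -> a' \in S ->
  \sum_p shifted_form S a p * shifted_form S a' p = (a == a')%:R - rho s #|S|.
Proof.
move=> aS aS'; rewrite sum_option_ord1.
rewrite /shifted_form/=; set r := rho s #|S|.
have -> : \sum_(i < n) ((i == a)%:R - r * (i \in S)%:R) * ((i == a')%:R - r * (i \in S)%:R) =
   \sum_(i < n) (i == a)%:R * (i == a')%:R - r * \sum_(i < n) (i == a)%:R * (i \in S)%:R
   - r * \sum_(i < n) (i == a')%:R * (i \in S)%:R + r ^+ 2 * \sum_(i < n) (i \in S)%:R.
  rewrite !mulr_sumr -!sumrB -big_split/=; apply: eq_bigr => i _.
  by case: (i \in S); rewrite ?mulr1 ?mulr0; ring.
have pick b (F : 'I_n -> R) : \sum_(i < n) (i == b)%:R * F i = F b.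
  by rewrite (bigD1 b)//= eqxx mul1r big1 ?addr0// => j /negbTE ->; rewrite mul0r.
rewrite !pick aS aS' !mulr1 (_ : \sum_i (i \in S)%:R = #|S|%:R); last first.
  by rewrite -natr_sum -sum1_card [in RHS]big_mkcond; congr (_%:R); apply: eq_bigr => i _; case: ifP.
by rewrite /r /rho; field; rewrite gt_eqF// den_gt0.
Qed.

Lemma rho_lt1 S i : i \in S -> rho s #|S| < 1.
Proof.
move=> iS; rewrite /rho ltr_pdivrMr ?den_gt0// mul1r.
have : (1 <= #|S|)%N by rewrite card_gt0; apply/set0Pn; exists i.
rewrite -(ler_nat R) => h; have := sqr_ge0 s; nra.
Qed.

Lemma tie_null S i : gauss Ix [set x | Y x i 0 + shift s S (fun a => Y x a 0) = 0] = 0%E.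
Proof.
rewrite (_ : [set x | _] = [set x | \sum_p shifted_form S i p * x p = 0]).
  apply: (@gauss_affine_null _ _ _ _ (Some i, ord0)); rewrite /shifted_form/= eqxx.
  have [iS|_] := boolP (i \in S); last by rewrite mulr0 subr0 oner_neq0.
  by rewrite mulr1 subr_eq0 gt_eqF// (rho_lt1 iS).
by apply/seteqP; split => x /=; rewrite shifted_formE.
Qed.

Definition split_event S : set (vec R Ix) := [set x | splits s S (fun i => Y x i 0)].

Let measurable_form S i : measurable_fun setT (fun x : vec R Ix => Y x i 0 + shift s S (fun a => Y x a 0)).
Proof.
rewrite (_ : (fun x => _) = (fun x : vec R Ix => \sum_p shifted_form S i p * x p)).
  exact: measurable_sum_coord.
by apply/funext => x; rewrite shifted_formE.
Qed.

Let W S (y : 'I_n -> nat -> R) := forall i, i \in S -> y i 0 + shift s S (fun a => y a 0) < 0.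

Let measurable_W S : measurable [set x : vec R Ix | W S (Y x)].
Proof.
rewrite (_ : [set x | _] = [set x : vec R Ix | forall j : {i | i \in S},
   Y x (val j) 0 + shift s S (fun a => Y x a 0) < 0]).
  by apply: measurable_forall_lt0 => j; exact: measurable_form.
apply/seteqP; split => x /= h; first by move=> [i iS]; exact: h.
by move=> i iS; exact: (h (exist _ i iS)).
Qed.

Lemma measurable_split_event S : measurable (split_event S).
Proof.
apply: measurableI; first exact: measurable_W.
rewrite [X in measurable X](_ : _ = [set x : vec R Ix | forall j : {i | i \notin S},
   0 < Y x (val j) 0 + shift s S (fun a => Y x a 0)]).
  by apply: measurable_forall_gt0 => j; exact: measurable_form.
apply/seteqP; split => x /= h; first by move=> [i iS]; exact: h.
by move=> i iS; exact: (h (exist _ i iS)).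
Qed.

(** The forms indexed by [S] have Gram matrix [I - rho J], and the other ones
    involve the residuals of [split_probability]. *)
Lemma split_event_prob S : gauss Ix (split_event S) =
  (g #|S| (- rho s #|S|) * g (n - #|S|) (rho s #|S|))%:E.
Proof.
pose u (y : 'I_n -> nat -> R) (j : nat) : R := 1.
have Eset : split_event S = [set x | W S (Y x) /\ forall i, i \notin S ->
    0 < dot 1 (u (Y x)) (fun j => Y x i j -
       s ^+ 2 / (1 + #|S|%:R * s ^+ 2) * \sum_(a in S) Y x a j)].
  have dE x i : dot 1 (u (Y x)) (fun j => Y x i j -
       s ^+ 2 / (1 + #|S|%:R * s ^+ 2) * \sum_(a in S) Y x a j) =
       Y x i 0 + shift s S (fun a => Y x a 0).
    by rewrite /dot big_ord_recl big_ord0 addr0 mul1r.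
  by apply/seteqP; split => x /= [h1 h2]; split => // i iS; have := h2 i iS; rewrite dE.
rewrite Eset (@split_probability R s n 0 1 S isT (W S) u).
- rewrite EFinM; congr (_ * _)%E.
  pose J := {i | i \in S}.
  have cJ : #|{: J}| = #|S| by rewrite card_sig.
  rewrite -cJ -(@g_family _ _ _ (gauss Ix) Ix J _ (fun j => shifted_form S (val j)) _ (iid_gauss Ix)).
  + congr (gauss Ix _); apply/seteqP; split => x /= h.
      by move=> [i iS]; rewrite shifted_formE; exact: h.
    by move=> i iS; have := h (exist _ i iS); rewrite shifted_formE.
  + by move=> [i iS] [j jS]; rewrite shifted_form_gram//= cJ.
  + rewrite cJ /rho.
    have -> : 1 + #|S|%:R * - (s ^+ 2 / (1 + #|S|%:R * s ^+ 2)) = (1 + #|S|%:R * s ^+ 2)^-1.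
      by field; rewrite gt_eqF// den_gt0.
    by rewrite invr_gt0 den_gt0.
- move=> y y' yy Wy i iS; have := Wy i iS.
  by rewrite /shift (yy _ _ iS) (eq_bigr (fun a => y' a 0))// => a aS; exact: yy.
- by [].
- by move=> y _; exists 0 => //; rewrite oner_neq0.
- exact: measurable_W.
- by rewrite -Eset; exact: measurable_split_event.
Qed.

(** The events [split_event S] form a partition up to a null set. *)
Lemma complementarity_sum :
  \sum_(k < n.+1) 'C(n, k)%:R * (g k (- rho s k) * g (n - k) (rho s k)) = 1.
Proof.
pose Z := [set x : vec R Ix | exists q : {set 'I_n} * 'I_n,
  Y x q.2 0 + shift s q.1 (fun a => Y x a 0) = 0].
have mq (q : {set 'I_n} * 'I_n) :
    measurable [set x : vec R Ix | Y x q.2 0 + shift s q.1 (fun a => Y x a 0) = 0].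
  by rewrite -[X in measurable X]setTI; exact: (measurable_form q.1 q.2 measurableT (measurable_set1 0)).
have mZ : measurable Z.
  rewrite (_ : Z = \bigcup_(q in [set: {set 'I_n} * 'I_n])
     [set x : vec R Ix | Y x q.2 0 + shift s q.1 (fun a => Y x a 0) = 0]).
    by apply: fin_bigcup_measurable => // q _; exact: mq.
  by apply/seteqP; split => x [q]; [exists q|move=> _; exists q].
have Z0 : gauss Ix Z = 0%E.
  exact: (finite_union_null mq (fun q => tie_null q.1 q.2)).
have : gauss Ix setT = (\sum_S gauss Ix (split_event S))%E.
  apply: (@partition_probability _ _ _ (gauss Ix) _ split_event setT Z) => //.
  - exact: measurable_split_event.
  - move=> x nZ; split=> // _; apply: splits_exists => S i; apply/eqP => h.
    by apply: nZ; exists (S, i).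
  - by move=> x S S' _; exact: splits_unique.
rewrite probability_setT (eq_bigr _ (fun S _ => split_event_prob S)) sumEFin => E.
transitivity (\sum_(S : {set 'I_n}) g #|S| (- rho s #|S|) * g (n - #|S|) (rho s #|S|)); last first.
  by apply/esym; move: E; apply: EFin_inj.
rewrite [RHS](partition_big (fun S : {set 'I_n} => inord #|S| : 'I_n.+1) xpredT)//=.
apply: eq_bigr => k _.
have cS (S : {set 'I_n}) : (inord #|S| == k) = (#|S| == k).
  by rewrite -val_eqE /= inordK// ltnS -[leqRHS](card_ord n) max_card.
rewrite [RHS](eq_bigl _ _ cS) [RHS](eq_bigr (fun _ => g k (- rho s k) * g (n - k) (rho s k))); last first.
  by move=> S /eqP ->.
rewrite [LHS]mulr_natl [RHS]sumr_const; congr (_ *+ _).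
by have := card_draws 'I_n k; rewrite card_ord cardsE => ->.
Qed.

End complementarity_probability.

(** * The formula *)

(** Both sequences satisfy the same triangular system, namely [face_term_sum]
    and [complementarity_sum]: no direct computation of [basis_prob] is
    needed. *)
Lemma basis_probE {R : realType} (s : R) k : basis_prob s k = g k (- rho s k).
Proof.
elim/ltn_ind: k => k IHk.
have := complementarity_sum s k; rewrite -[X in _ = X -> _](face_term_sum s (leqnn k)) !big_ord_recr/=.
rewrite /face_term binn subnn mul1r mulr1.
rewrite (eq_bigr (fun i : 'I_k => 'C(k, i)%:R * (basis_prob s i * g (k - i) (rho s i)))); last first.
  by move=> i _; rewrite IHk.
by rewrite !mul1r mulr1 => /addrI.
Qed.

Lemma face_term_b {R : realType} (s : R) n k : (k <= n)%N -> face_term s n k = b n k (s ^+ 2).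
Proof. by move=> kn; rewrite /face_term /b kn basis_probE mulrA. Qed.

Lemma alternate_sum_step {R : realType} n D (t : R) :
  \sum_(0 <= j < D.+2) b n (D.+2%:Z - 1 - (2 * j)%:Z) t =
  b n D.+1 t + \sum_(0 <= j < D) b n (D%:Z - 1 - (2 * j)%:Z) t.
Proof.
rewrite big_nat_recl// big_nat_recr//; congr (_ + _).
  by congr (b _ _ _); lia.
(* The index of the last term is negative. *)
have -> : b n (D.+2%:Z - 1 - (2 * D.+1)%:Z) t = 0.
  by rewrite (_ : _ - _ = Negz D)//; lia.
rewrite [LHS]addr0; apply: eq_bigr => j _; congr (b _ _ _); lia.
Qed.

Lemma hit_prob {R : realType} (s : R) n N D : (0 < n)%N -> (n <= N)%N -> (D <= n.+1)%N ->
  fine (gauss _ [set x | hit D (@pts R s n N x)]) =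
  2 * \sum_(0 <= j < D) b n (D%:Z - 1 - (2 * j)%:Z) (s ^+ 2).
Proof.
move=> n0 nN; pose p D := fine (gauss _ [set x | hit D (@pts R s n N x)]).
have p0 : p 0 = 0 by rewrite /p hit0_prob.
have ps E : (E <= n)%N -> p E.+1 + p E = 2 * \sum_(k < E.+1) face_term s n k.
  by move=> En; exact: hit_prob_step.
rewrite -/(p D).
elim/ltn_ind: D => -[|[|D]] IHD Dn.
- by rewrite p0 big_geq// mulr0.
- have := ps 0 (leq0n n); rewrite p0 addr0 => ->; rewrite big_ord_recl big_ord0 addr0.
  by rewrite big_nat1 face_term_b.
have := ps D.+1 Dn; rewrite big_ord_recr/= mulrDr -(ps D (ltnW Dn)).
rewrite (@face_term_b R s n D.+1 Dn) alternate_sum_step mulrDr -IHD//.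
  lra.
exact: leq_trans (leqnSn _) (ltnW Dn).
Qed.

Lemma joint_iid {R : realType} d (T : measurableType d) (P : probability T R) (F : finType) m
    (Z : F -> {RV P >-> m.-tuple R}) :
  (forall o, standard_gaussian (Z o)) -> independent P (fun o w => Z o w) ->
  iid P (fun p w => tnth (Z p.1 w) p.2).
Proof.
move=> sZ iZ; split=> [[c j]|B mB].
  by have [mZ _] := standard_gaussian_iid (sZ c); exact: mZ.
pose C o := [set t : m.-tuple R | forall j, B (o, j) (tnth t j)].
have mC o : measurable (C o).
  rewrite (_ : C o = \bigcap_(j in [set: 'I_m]) ((fun t : m.-tuple R => tnth t j) @^-1` B (o, j))).
    apply: fin_bigcap_measurable => // j _; rewrite -[X in measurable X]setTI.
    exact: measurable_tnth.
  by apply/seteqP; split => t h j; [move=> _; exact: h|exact: (h j I)].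
have := iZ [set: F]%SET C mC.
rewrite (_ : \bigcap_(i in _) _ = [set w | forall p, B p (tnth (Z p.1 w) p.2)]); last first.
  apply/seteqP; split => w h; first by move=> [c j]; apply: (h c); rewrite /= inE.
  by move=> o _ j; exact: (h (o, j)).
move=> E; etransitivity; first exact: E.
rewrite (eq_bigl xpredT); last by move=> o; rewrite inE.
rewrite (eq_bigr (fun o => \big[mule/1]_j nrm (B (o, j)))%E); last first.
  by move=> o _; have [_ boxZ] := standard_gaussian_iid (sZ o); exact: (boxZ (fun j => B (o, j))).
by rewrite pair_bigA; apply: eq_bigr => -[].
Qed.

Theorem theorem1p1 (R : realType) (d n : nat) (hd : (1 <= d)%N)
    (hn : (d.+1 <= n)%N) (disp : measure_display) (T : measurableType disp)
    (P : probability T R) (X : {RV P >-> d.-tuple R})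
    (Xs : 'I_n -> {RV P >-> d.-tuple R})
    (hX : standard_gaussian X) (hXs : forall i : 'I_n, standard_gaussian (Xs i))
    (hindep : independent P (fun (o : option 'I_n) (w : T) =>
       if o is Some i then Xs i w else X w))
    (sigma : R) (hsigma : 0 <= sigma) :
  P [set w | ~ convex_hull (range (fun i : 'I_n => row_of_tuple (Xs i w)))
                 (sigma *: row_of_tuple (X w))] =
  (2 * \sum_(0 <= j < d) b n (d%:Z - 1 - (2 * j)%:Z) (sigma ^+ 2))%:E.
Proof.
case: d hd hn X Xs hX hXs hindep => [//|d] _ hn X Xs hX hXs hindep.
(* The event is transported to vectors of dimension [n + 1], which is where
   [hit_prob] holds; it involves only the first [d + 1] coordinates. *)
have dn : (d.+1 <= n.+1)%N by exact: leq_trans (leqnSn d.+1) (leqW hn).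
have n0 : (0 < n)%N by exact: leq_trans hn.
rewrite -(hit_prob sigma n0 (leqnn n) dn) fineK; last first.
  by apply: fin_num_measure; exact: measurable_hit_pts.
pose Z (o : option 'I_n) := if o is Some i then Xs i else X.
have iZ : iid P (fun p w => tnth (Z p.1 w) p.2).
  apply: joint_iid; first by case.
  by move: hindep; congr (independent _ _); apply/funext => -[].
transitivity (gauss (option 'I_n * 'I_d.+1)%type [set x | hit d.+1 (pts sigma x)]).
  rewrite -(iid_law iZ (@measurable_hit_pts R sigma n d d.+1)).
  congr (P _).
  apply/seteqP.
  suff E w : hit d.+1 (fun i j => nth 0 (Xs i w) j - sigma * nth 0 (X w) j) <->
      hit d.+1 (pts sigma (fun p : option 'I_n * 'I_d.+1 => tnth (Z p.1 w) p.2)).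
    split => w; first by move/not_in_convex_hull/(E w).1.
    by move/(E w).2/(not_in_convex_hull (X w) (fun i => Xs i w) sigma).2.
  have D u i : dot d.+1 u (fun j => nth 0 (Xs i w) j - sigma * nth 0 (X w) j) =
      dot d.+1 u (pts sigma (fun p : option 'I_n * 'I_d.+1 => tnth (Z p.1 w) p.2) i).
    apply: eq_dot => // j jd; rewrite /pts /= !(tnth_nth 0) !inordK//.
  by split => -[u hu]; exists u => i; have := hu i; rewrite D.
pose f (p : option 'I_n * 'I_d.+1) : option 'I_n * 'I_n.+1 := (p.1, widen_ord dn p.2).
have finj : injective f by move=> [c j] [c' j'] [-> /= jj]; congr pair; apply: val_inj.
etransitivity.
  exact: (esym (iid_law (iid_sub finj (iid_gauss _)) (@measurable_hit_pts R sigma n d d.+1))).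
congr (gauss _ _); apply/seteqP.
suff D u i x : dot d.+1 u (pts sigma (fun p => x (f p)) i) = dot d.+1 u (pts sigma x i).
  by split => x /= -[u hu]; exists u => i; have := hu i; rewrite D.
apply: eq_dot => // j jd; rewrite /pts /f /=; congr (x (_, _) - _ * x (_, _));
  apply: val_inj; rewrite /= !inordK//; exact: leq_trans jd dn.
Qed.
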